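(* Let $v$ be a valuation on a field $F$, let $A$ be a finite-dimensional simple $F$-algebra with center $K=Z(A)$, and let $v_1,\ldots,v_r$ be all the extensions of $v$ to $K$. Let $\alpha$ be a $v$-gauge on $A$. Then there exist $v_i$-gauges $\alpha_i$ on $A$ (viewed as a $K$-algebra), for $i=1,\ldots,r$, such that $$\alpha(a)=\min\big(\alpha_1(a),\ldots,\alpha_r(a)\big)\qquad\text{for all } a\in A.$$ Furthermore, there is a graded isomorphism $$\operatorname{gr}_\alpha(A)\cong_g \operatorname{gr}_{\alpha_1}(A)\times\cdots\times\operatorname{gr}_{\alpha_r}(A).$$ Hence, the semisimple $\overline F^{\,v}$-algebra $\operatorname{gr}_\alpha(A)_0$ has at least $r$ simple components. Moreover, the $\operatorname{gr}_{\alpha_i}(A)$ are the graded simple components of $\operatorname{gr}_\alpha(A)$ and, for each $i$, $$[\operatorname{gr}_{\alpha_i}(A):\operatorname{gr}_v(F)]=[A:K]\,[\operatorname{gr}_{v_i}(K):\operatorname{gr}_v(F)].$$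
   Context: $\Gamma$ is a fixed divisible totally ordered abelian group, large enough to contain the values of all valuations and value functions considered; extensions of $v$ to larger fields also take values in $\Gamma\cup\{\infty\}$. All algebras are associative, unital, finite-dimensional. For a valuation $v\colon F\to\Gamma\cup\{\infty\}$, $\overline F^{\,v}$ is its residue field, and $\operatorname{gr}_v(F)=\bigoplus_{\gamma\in\Gamma}F_{\ge\gamma}/F_{>\gamma}$, where $F_{\ge\gamma}=\{c: v(c)\ge\gamma\}$, $F_{>\gamma}=\{c:v(c)>\gamma\}$. Let $A$ be a finite-dimensional $F$-algebra. A $v$-value function on $A$ is a map $\alpha\colon A\to\Gamma\cup\{\infty\}$ with $\alpha(x)=\infty$ iff $x=0$; $\alpha(x+y)\ge\min(\alpha(x),\alpha(y))$; and $\alpha(xc)=\alpha(x)+v(c)$ for $x,y\in A$, $c\in F$. It defines $A_{\ge\gamma}=\{x:\alpha(x)\ge\gamma\}$, $A_{>\gamma}=\{x:\alpha(x)>\gamma\}$, $A_\gamma=A_{\ge\gamma}/A_{>\gamma}$ and $\operatorname{gr}_\alpha(A)=\bigoplus_{\gamma\in\Gamma}A_\gamma$, a graded $\operatorname{gr}_v(F)$-module, which is free of finite rank; $[\,\cdot:\operatorname{gr}_v(F)]$ denotes the rank. $\alpha$ is a $v$-norm if $A$ has an $F$-base $(x_i)$ with $\alpha(\sum x_ic_i)=\min_i(\alpha(x_i)+v(c_i))$ for all $c_i\in F$. $\alpha$ is surmultiplicative if $\alpha(1)=0$ and $\alpha(xy)\ge\alpha(x)+\alpha(y)$; then $\operatorname{gr}_\alpha(A)$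 is a graded $\operatorname{gr}_v(F)$-algebra via $(x+A_{>\gamma})(y+A_{>\delta})=xy+A_{>\gamma+\delta}$ for $x\in A_{\ge\gamma}$, $y\in A_{\ge\delta}$. A $v$-gauge is a surmultiplicative $v$-norm $\alpha$ such that $\operatorname{gr}_\alpha(A)$ is graded semisimple, i.e. has no nonzero homogeneous nilpotent two-sided ideal. A $v_i$-gauge on $A$ is defined in the same way, with $(K,v_i)$ replacing $(F,v)$. $\operatorname{gr}_\alpha(A)_0$ is the degree-zero component. $\cong_g$ denotes isomorphism of graded $\operatorname{gr}_v(F)$-algebras; each $\operatorname{gr}_{\alpha_i}(A)$ is a $\operatorname{gr}_v(F)$-algebra via $\operatorname{gr}_v(F)\subseteq\operatorname{gr}_{v_i}(K)$. A graded algebra is graded simple if it has no proper nonzero homogeneous two-sided ideals. *)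

(* Defs.v *)
From HB Require Import structures.
From mathcomp Require Import all_boot all_order all_algebra all_field.

Set Implicit Arguments.
Unset Strict Implicit.
Unset Printing Implicit Defensive.

Import Order.TTheory GRing.Theory Num.Theory.
Local Open Scope ring_scope.

HB.mixin Record isDivOrderedGroup G of Num.POrderedZmodule G := {
  dog_le_total : total (@Order.le ring_display G);
  dog_leD2l : forall z x y : G, x <= y -> z + x <= z + y;
  dog_divisible : forall (n : nat) (x : G), (0 < n)%N -> exists y, y *+ n = x
}.

#[short(type="divOrderedGroupType")]
HB.structure Definition DivOrderedGroup :=
  {G of isDivOrderedGroup G & Num.POrderedZmodule G}.

(* The ordered monoid G U {oo}; [None] is the point at infinity. *)
Definition ext (G : divOrderedGroupType) : Type := option G.

Section Ext.
Variable G : divOrderedGroupType.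
Implicit Types x y z : ext G.

Definition Fin (g : G) : ext G := Some g.
Definition oo : ext G := None.

Definition ext_le x y : bool :=
  match x, y with
  | _, None => true
  | None, Some _ => false
  | Some a, Some b => a <= b
  end.

Definition ext_add x y : ext G :=
  match x, y with Some a, Some b => Some (a + b) | _, _ => None end.

Fact ext_le_refl : reflexive ext_le. Proof. by case=> /=. Qed.

Fact ext_le_anti : antisymmetric ext_le.
Proof. by case=> [a|] [b|] //= /le_anti->. Qed.

Fact ext_le_trans : transitive ext_le.
Proof. by case=> [a|] [b|] [c|] //=; apply: le_trans. Qed.

Fact ext_le_total : total ext_le.
Proof. by case=> [a|] [b|] //=; apply: dog_le_total. Qed.

HB.instance Definition _ := Choice.copy (ext G) (option G).
HB.instance Definition _ := Order.Le_isPOrder.Build ring_display (ext G)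
  ext_le_refl ext_le_anti ext_le_trans.
HB.instance Definition _ :=
  Order.POrder_isTotal.Build ring_display (ext G) ext_le_total.

Fact ext_addA : associative ext_add.
Proof. by case=> [a|] [b|] [c|] //=; rewrite addrA. Qed.
Fact ext_addC : commutative ext_add.
Proof. by case=> [a|] [b|] //=; rewrite addrC. Qed.
Fact ext_add0 : left_id (Fin 0) ext_add.
Proof. by case=> [a|] //=; rewrite add0r. Qed.

HB.instance Definition _ :=
  GRing.isNmodule.Build (ext G) ext_addA ext_addC ext_add0.

Lemma Fin_le (a b : G) : (Fin a <= Fin b) = (a <= b). Proof. by []. Qed.
Lemma le_oo x : x <= oo. Proof. by case: x. Qed.
Lemma oo_le x : oo <= x -> x = oo. Proof. by case: x. Qed.
Lemma addoo x : x + oo = oo. Proof. by case: x. Qed.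

End Ext.

Arguments oo {G}.
Arguments Fin {G}.

Definition two_sided_ideal (F : fieldType) (A : falgType F) (I : {vspace A}) :=
  (fullv * I <= I)%VS /\ (I * fullv <= I)%VS.

(* [A] is nonzero, as every [falgType] is. *)
Definition simple_algebra (F : fieldType) (A : falgType F) :=
  forall I : {vspace A}, two_sided_ideal I -> I = 0%VS \/ I = fullv.

(* The proof of simplicity is an argument so that Z(A) is canonically a field. *)
Definition center (F : fieldType) (A : falgType F) of simple_algebra A : Type :=
  subvs_of 'Z({: A})%AS.

Section CenterField.
Variables (F : fieldType) (A : falgType F) (hA : simple_algebra A).
Local Notation Z := (center hA).

HB.instance Definition _ := Falgebra.copy Z (subvs_of 'Z({: A})%AS).

Definition center_val (z : Z) : A := vsval z.

Lemma center_comm (z : Z) (x : A) : center_val z * x = x * center_val z.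
Proof.
by have /memv_capP[_ /centvP->] := valP z; rewrite ?memvf.
Qed.

Lemma center_val_inj : injective center_val.
Proof. exact: val_inj. Qed.

Fact center_mulC : commutative (@GRing.mul Z).
Proof. by move=> x y; apply: center_val_inj; apply: center_comm. Qed.

HB.instance Definition _ := GRing.PzRing_hasCommutativeMul.Build Z center_mulC.

Fact center_val_monoid : monoid_morphism center_val.
Proof.
split=> //; rewrite /center_val /= algid_center.
by apply/eqP; rewrite algid_eq1 memvf.
Qed.
Fact center_val_zmod : zmod_morphism center_val.
Proof. by move=> x y; rewrite /center_val linearB. Qed.

HB.instance Definition _ :=
  GRing.isZmodMorphism.Build Z A center_val center_val_zmod.
HB.instance Definition _ :=
  GRing.isMonoidMorphism.Build Z A center_val center_val_monoid.

Fact center_field : GRing.field_axiom Z.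
Proof.
move=> z nz_z; set u := center_val z.
have nz_u : u != 0 by apply: contra_neq nz_z => u0; apply: center_val_inj.
have [] : <[u]>%VS = 0%VS \/ (fullv * <[u]>)%VS = fullv; last 1 first.
- move=> defA; have: 1 \in (fullv * <[u]>)%VS by rewrite defA memvf.
  case/memv_cosetP=> w _ w1; apply: vsval_unitr; apply/unitrP.
  by exists w; split; [|change (u * w = 1); rewrite /u center_comm].
- have [] := hA (I := (fullv * <[u]>)%VS); last by right.
  + split; first by rewrite prodvA prodvSl ?subvf.
    apply/prodvP=> _ y /memv_cosetP[w _ ->] _.
    by rewrite -mulrA center_comm mulrA memv_mul ?memvf ?memv_line.
  + move=> U0; left; apply/eqP; rewrite -subv0 -U0 -memvE -[X in X \in _]mul1r.
    by rewrite memv_mul ?memvf ?memv_line.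
by move/eqP; rewrite -subv0 -memvE memv0 (negPf nz_u).
Qed.

HB.instance Definition _ := GRing.ComUnitRing_isField.Build Z center_field.

End CenterField.

Definition over_center (F : fieldType) (A : falgType F)
  of simple_algebra A : Type := A.

Section OverCenter.
Variables (F : fieldType) (A : falgType F) (hA : simple_algebra A).
Local Notation Z := (center hA).
Local Notation A_Z := (over_center hA).

HB.instance Definition _ := GRing.UnitRing.copy A_Z A.

Definition over_center_scale (z : Z) (x : A_Z) : A_Z := center_val z * (x : A).
Local Infix "*Z:" := over_center_scale (at level 40).

Fact over_center_scaleA a b x : a *Z: (b *Z: x) = (a * b) *Z: x.
Proof. exact: mulrA. Qed.
Fact over_center_scale1 : left_id 1 over_center_scale.
Proof. by move=> x; rewrite /over_center_scale rmorph1 mul1r. Qed.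
Fact over_center_scaleDr : right_distributive over_center_scale +%R.
Proof. by move=> a x y; apply: mulrDr. Qed.
Fact over_center_scaleDl x :
  {morph (fun a => a *Z: x) : a b / a + b >-> a + b}.
Proof. by move=> a b; rewrite /over_center_scale rmorphD; apply: mulrDl. Qed.

HB.instance Definition _ := GRing.Zmodule_isLmodule.Build Z A_Z
  over_center_scaleA over_center_scale1 over_center_scaleDr over_center_scaleDl.

Fact over_center_scaleAl a (x y : A_Z) : a *Z: (x * y) = (a *Z: x) * y.
Proof. exact: mulrA. Qed.
HB.instance Definition _ :=
  GRing.Lmodule_isLalgebra.Build Z A_Z over_center_scaleAl.

Fact over_center_scaleAr a (x y : A_Z) : a *Z: (x * y) = x * (a *Z: y).
Proof. by rewrite /over_center_scale mulrA center_comm -mulrA. Qed.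
HB.instance Definition _ :=
  GRing.Lalgebra_isAlgebra.Build Z A_Z over_center_scaleAr.

Lemma over_center_semisimple : exists2 X : seq A, 0 \notin X &
  let sumX := (\sum_(x <- X) 'Z({: A}) * <[x]>)%VS in
  sumX = fullv /\ directv sumX.
Proof.
pose K := ('Z({: A}))%AS; pose sumK X := (\sum_(x <- X) K * <[x]>)%VS.
suff [X [nzX defX dxX]]: exists X, [/\ 0 \notin X, sumK X = fullv & directv (sumK X)].
  by exists X.
have K1 : 1 \in K by rewrite memv_cap memvf; apply: centv1.
pose X := Nil A; have: (\dim {: A} - \dim (sumK X) < (\dim {: A}).+1)%N.
  by rewrite ltnS leq_subr.
have: 0 \notin X /\ directv (sumK X).
  by rewrite /sumK directvE /= !big_nil dimv0.
elim: _.+1 (X) => // k IHk {}X [nzX dxX]; rewrite ltnS => leXk.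
have [sAX | /subvPn/sig2W[y _ notXy]] := boolP (fullv <= sumK X)%VS.
  by exists X; split=> //; apply/eqP; rewrite eqEsubv subvf.
have nz_y: y != 0 by rewrite (memPnC notXy) ?mem0v.
have Ky : y \in (K * <[y]>)%VS by rewrite -[X in X \in _]mul1r memv_mul ?memv_line.
have dxY: directv (sumK (y :: X)).
  rewrite directvE /= !big_cons [_ == _]directv_addE dxX directvE eqxx /=.
  rewrite -/(sumK X) eqEsubv sub0v andbT.
  apply/subvP=> _ /memv_capP[/memv_cosetP[a Ka ->]] Xay.
  have [a0 | nz_a] := eqVneq (Subvs Ka : Z) 0.
    by have /= -> := congr1 val a0; rewrite mul0r mem0v.
  have Ua : a \is a GRing.unit.
    have Uz : (Subvs Ka : Z) \is a GRing.unit by rewrite unitfE.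
    exact: (rmorph_unit (@center_val _ _ hA) Uz).
  case/negP: notXy; rewrite -[y](mulKr Ua) /sumK.
  by rewrite -big_distrr -(prodv_id K) /= -prodvA big_distrr memv_mul ?memvV.
apply: (IHk (y :: X)); first by rewrite !inE eq_sym negb_or nz_y.
have ltXY : (\dim (sumK X) < \dim (sumK (y :: X)))%N.
  rewrite (directvP dxY) /= big_cons -(directvP dxX) /= -[X in (X < _)%N]add0n.
  rewrite ltn_add2r lt0n dimv_eq0; apply: contraNneq nz_y => K0.
  by rewrite -memv0 -K0.
by rewrite (leq_trans _ leXk) // ltn_sub2l // (leq_trans ltXY) ?dimvS ?subvf.
Qed.

Fact over_center_vect : Lmodule_hasFinDim Z A_Z.
Proof.
have /sig2_eqW : exists2 X : seq A, 0 \notin X &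
  let sumX := (\sum_(x <- X) 'Z({: A}) * <[x]>)%VS in
  (sumX == fullv) && directv sumX.
  by have [X nzX [dX xX]] := over_center_semisimple; exists X; rewrite //= xX dX eqxx.
case=> bL nz_bL /= /andP[/eqP defL dxSbL].
rewrite directvE /= (big_nth 0) [eqbRHS](big_nth 0) in defL dxSbL.
rewrite !big_mkord -directvE in defL dxSbL.
set n := size bL in defL dxSbL; set SbL := (\sum_i _)%VS in defL dxSbL.
have in_bL (i : 'I_n) (a : Z) :
    center_val a * bL`_i \in ('Z({: A}) * <[bL`_i]>)%VS.
  by rewrite memv_mul ?(valP a) ?memv_line.
have nz_bLi (i : 'I_n): bL`_i != 0 by rewrite (memPn nz_bL) ?mem_nth.
pose r2v (v : 'rV[Z]_n) : A_Z := \sum_i v 0 i *: (bL`_i : A_Z).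
have r2v_lin: linear r2v.
  move=> a u v; rewrite /r2v scaler_sumr -big_split /=; apply: eq_bigr => i _.
  by rewrite scalerA -scalerDl !mxE.
pose r2vlM := GRing.isLinear.Build _ _ _ _ r2v r2v_lin.
pose r2vL : {linear _ -> _} := HB.pack r2v r2vlM.
have v2rP x: {r : 'rV[Z]_n | x = r2v r}.
  apply: sig_eqW; have /memv_sumP[y Fy ->]: (x : A) \in SbL.
    by rewrite defL memvf.
  have /fin_all_exists[r Dr] i: exists r, y i = r *: (bL`_i : A_Z).
    by have /memv_cosetP[a Fa ->] := Fy i isT; exists (Subvs Fa).
  by exists (\row_i r i); apply: eq_bigr => i _; rewrite mxE.
pose v2r x := sval (v2rP x).
have v2rK: cancel v2r r2vL by rewrite /v2r => x; case: (v2rP x).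
suffices r2vK: cancel r2v v2r.
  by exists n, v2r; [apply: can2_linear v2rK | exists r2v].
move=> r; apply/rowP=> i.
have /forall_inP/(_ i isT)/eqP : [forall (j | true),
    center_val (v2r (r2v r) 0 j) * bL`_j == center_val (r 0 j) * bL`_j].
  by move/directv_sum_unique: dxSbL => <- //; apply/eqP/v2rK.
move=> /eqP; rewrite -subr_eq0 -mulrBl -(rmorphB (@center_val _ _ hA)) => /eqP z0.
apply/eqP; rewrite -subr_eq0; apply: contraTT (nz_bLi i) => nz_z.
rewrite negbK -[bL`_i]mul1r -(rmorph1 (@center_val _ _ hA)) -(mulVf nz_z).
by rewrite rmorphM -mulrA z0 mulr0.
Qed.

HB.instance Definition _ := over_center_vect.
HB.instance Definition _ := GRing.Algebra.on A_Z.

End OverCenter.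

Record valuation (G : divOrderedGroupType) (F : fieldType) := Valuation {
  valuation_fun :> F -> ext G;
  valuation_oo : forall x, valuation_fun x = oo <-> x = 0;
  valuationM : forall x y,
    valuation_fun (x * y) = valuation_fun x + valuation_fun y;
  valuationD : forall x y,
    Num.min (valuation_fun x) (valuation_fun y) <= valuation_fun (x + y)
}.

Definition extends (G : divOrderedGroupType) (F : fieldType)
    (K : fieldExtType F) (v : valuation G F) (w : valuation G K) :=
  forall c : F, w c%:A = v c.

Section ValueFunctions.
Variables (G : divOrderedGroupType) (F : fieldType) (A : falgType F).
Variables (v : valuation G F) (alpha : A -> ext G).

Definition value_function :=
  [/\ forall x, alpha x = oo <-> x = 0,
      forall x y, Num.min (alpha x) (alpha y) <= alpha (x + y)
    & forall x (c : F), alpha (c *: x) = alpha x + v c].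

Definition surmultiplicative :=
  alpha 1 = Fin 0 /\ forall x y, alpha x + alpha y <= alpha (x * y).

Definition norm :=
  value_function /\
  exists2 X : (\dim {: A}).-tuple A, basis_of {: A} X &
    forall c : 'I_(\dim {: A}) -> F,
      alpha (\sum_(i < \dim {: A}) c i *: X`_i) =
        \big[Num.min/oo]_(i < \dim {: A}) (alpha X`_i + v (c i)).

End ValueFunctions.

(* What the construction of the associated graded ring uses, for both
   valuations and surmultiplicative value functions. *)
Record filtration (G : divOrderedGroupType) (B : nzRingType) := Filtration {
  filtration_fun :> B -> ext G;
  filtration0 : filtration_fun 0 = oo;
  filtrationN : forall x, filtration_fun (- x) = filtration_fun x;
  filtrationD : forall x y,
    Num.min (filtration_fun x) (filtration_fun y) <= filtration_fun (x + y);
  filtration1 : filtration_fun 1 = Fin 0;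
  filtrationM : forall x y,
    filtration_fun x + filtration_fun y <= filtration_fun (x * y)
}.

Section Filtrations.
Variables (G : divOrderedGroupType) (F : fieldType) (v : valuation G F).

Lemma Fin_leD (a b : G) x y : Fin a <= x -> Fin b <= y -> Fin (a + b) <= x + y.
Proof.
case: x y => [x|] [y|] // ax leby.
have {}ax : a <= x := ax; have {}leby : b <= y := leby.
change (a + b <= x + y); apply: (@le_trans _ _ (a + y)); first exact: dog_leD2l.
by rewrite ![_ + y]addrC dog_leD2l.
Qed.

Lemma Fin_leltD (a b : G) x y : Fin a <= x -> Fin b < y -> Fin (a + b) < x + y.
Proof.
move=> lax; rewrite !lt_def => /andP[nby leby].
rewrite (Fin_leD lax leby) andbT; apply: contra nby => /eqP.
case: x y lax leby => [x|] [y|] // lax leby [xy].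
have {}lax : a <= x := lax; have {}leby : b <= y := leby.
apply/eqP; congr Some; apply: le_anti; rewrite leby andbT.
have := dog_leD2l y _ _ lax; rewrite [y + x]addrC xy addrC => h.
by have := dog_leD2l (- a) _ _ h; rewrite !addKr.
Qed.

Lemma valuation1 : v 1 = Fin 0.
Proof.
case v1 : (v 1) => [a|].
  have := valuationM v 1 1; rewrite mulr1 v1 => -[/eqP].
  by rewrite -[X in X == _]addr0 (inj_eq (addrI a)) => /eqP <-.
by have /eqP := (valuation_oo v 1).1 v1; rewrite oner_eq0.
Qed.

Lemma valuationN1 : v (-1) = Fin 0.
Proof.
have := valuationM v (-1) (-1); rewrite mulrNN mulr1 valuation1.
case: (v (-1)) => [a|] // [a0]; congr Fin.
have /orP[a_ge|a_le] := dog_le_total 0 a.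
  by apply/le_anti; rewrite a_ge andbT a0 -[X in X <= _]addr0 dog_leD2l.
by apply/le_anti; rewrite a_le /= a0 -[X in _ <= X]addr0 dog_leD2l.
Qed.

Fact valuation_filtration0 : v 0 = oo. Proof. exact/valuation_oo. Qed.
Fact valuation_filtrationN x : v (- x) = v x.
Proof. by rewrite -mulN1r valuationM valuationN1 add0r. Qed.
Fact valuation_filtrationM x y : v x + v y <= v (x * y).
Proof. by rewrite valuationM. Qed.

Definition valuation_filtration : filtration G F :=
  Filtration valuation_filtration0 valuation_filtrationN (valuationD v)
    valuation1 valuation_filtrationM.

Variables (A : falgType F) (alpha : A -> ext G).
Hypotheses (valA : value_function v alpha) (surA : surmultiplicative alpha).

Fact surm_filtration0 : alpha 0 = oo. Proof. by case: valA => /(_ 0)[_ ->]. Qed.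
Fact surm_filtrationN x : alpha (- x) = alpha x.
Proof. by case: valA => _ _; rewrite -scaleN1r => ->; rewrite valuationN1 addr0. Qed.
Fact surm_filtrationD x y : Num.min (alpha x) (alpha y) <= alpha (x + y).
Proof. by case: valA. Qed.

Definition surm_filtration : filtration G A :=
  Filtration surm_filtration0 surm_filtrationN surm_filtrationD
    surA.1 surA.2.

End Filtrations.

(* A graded ring [\bigoplus_g B_g] is given by its homogeneous components and
   the multiplication between them.  The degree [k] of a product is tied to
   [g + h] by an equation, so that no transport along equalities of degrees is
   ever needed. *)
Record gradedRing (G : divOrderedGroupType) := GradedRing {
  gcomp :> G -> zmodType;
  gone : gcomp 0;
  gmul : forall g h k : G, g + h = k -> gcomp g -> gcomp h -> gcomp k;
  gmulDl : forall g h k (e : g + h = k) x y z,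
    gmul e (x + y) z = gmul e x z + gmul e y z;
  gmulDr : forall g h k (e : g + h = k) x y z,
    gmul e x (y + z) = gmul e x y + gmul e x z;
  gmul1l : forall g (e : 0 + g = g) x, gmul e gone x = x;
  gmul1r : forall g (e : g + 0 = g) x, gmul e x gone = x;
  gmulA : forall a b c ab bc abc
    (e1 : a + b = ab) (e2 : ab + c = abc) (e3 : b + c = bc) (e4 : a + bc = abc)
    x y z, gmul e2 (gmul e1 x y) z = gmul e4 x (gmul e3 y z)
}.

Arguments gone {G} g : rename.
Arguments gmul {G} g {_ _ _} _ _ _ : rename.

Section GradedRings.
Variable G : divOrderedGroupType.
Implicit Types R B C : gradedRing G.

Record gradedMorphism B C := GradedMorphism {
  gmorph :> forall g, {additive B g -> C g};
  gmorph1 : gmorph 0 (gone B) = gone C;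
  gmorphM : forall g h k (e : g + h = k) x y,
    gmorph k (gmul B e x y) = gmul C e (gmorph g x) (gmorph h y)
}.

Section Comp.
Variables (B C D : gradedRing G).
Variables (f : gradedMorphism C D) (g : gradedMorphism B C).

Definition gmorph_comp_fun k : {additive B k -> D k} := f k \o g k.

Fact gmorph_comp_fun1 : gmorph_comp_fun 0 (gone B) = gone D.
Proof. by rewrite /= !gmorph1. Qed.
Fact gmorph_comp_funM a b k (e : a + b = k) x y :
  gmorph_comp_fun k (gmul B e x y) =
    gmul D e (gmorph_comp_fun a x) (gmorph_comp_fun b y).
Proof. by rewrite /= !gmorphM. Qed.

Definition gmorph_comp : gradedMorphism B D :=
  GradedMorphism gmorph_comp_fun1 gmorph_comp_funM.

End Comp.

Record gradedAlgebra R := GradedAlgebra {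
  galg_ring :> gradedRing G;
  gstruct : gradedMorphism R galg_ring;
  gstruct_central : forall g h k (e : g + h = k) (e' : h + g = k) c x,
    gmul galg_ring e (gstruct g c) x = gmul galg_ring e' x (gstruct g c)
}.

Section Restrict.
Variables (R S : gradedRing G) (f : gradedMorphism R S) (B : gradedAlgebra S).

Fact grestrict_central g h k (e : g + h = k) (e' : h + g = k)
    (c : R g) (x : B h) :
  gmul B e (gmorph_comp (gstruct B) f g c) x =
    gmul B e' x (gmorph_comp (gstruct B) f g c).
Proof. exact: gstruct_central. Qed.

Definition grestrict : gradedAlgebra R := GradedAlgebra grestrict_central.

End Restrict.

Section Product.
Variables (R : gradedRing G) (I : finType) (B : I -> gradedAlgebra R).

Definition gprod_comp (g : G) : Type := {dffun forall i, B i g}.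

Section Zmodule.
Variable g : G.
Implicit Types x y : gprod_comp g.

HB.instance Definition _ :=
  Choice.copy (gprod_comp g) {dffun forall i, B i g}.

Definition gprod0 : gprod_comp g := finfun (fun i => 0 : B i g).
Definition gprod_opp x : gprod_comp g := finfun (fun i => - x i : B i g).
Definition gprod_add x y : gprod_comp g :=
  finfun (fun i => x i + y i : B i g).

Fact gprod_addA : associative gprod_add.
Proof. by move=> x y z; apply/ffunP=> i; rewrite !ffunE addrA. Qed.
Fact gprod_addC : commutative gprod_add.
Proof. by move=> x y; apply/ffunP=> i; rewrite !ffunE addrC. Qed.
Fact gprod_add0 : left_id gprod0 gprod_add.
Proof. by move=> x; apply/ffunP=> i; rewrite !ffunE add0r. Qed.
Fact gprod_addN : left_inverse gprod0 gprod_opp gprod_add.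
Proof. by move=> x; apply/ffunP=> i; rewrite !ffunE addNr. Qed.

HB.instance Definition _ := GRing.isZmodule.Build (gprod_comp g)
  gprod_addA gprod_addC gprod_add0 gprod_addN.

Lemma gprod_addE x y i : (x + y) i = x i + y i.
Proof. by rewrite ffunE. Qed.

End Zmodule.

Definition gprod_one : gprod_comp 0 := finfun (fun i => gone (B i)).
Definition gprod_mul g h k (e : g + h = k)
    (x : gprod_comp g) (y : gprod_comp h) : gprod_comp k :=
  finfun (fun i => gmul (B i) e (x i) (y i)).

Fact gprod_mulDl g h k (e : g + h = k) x y z :
  gprod_mul e (x + y) z = gprod_mul e x z + gprod_mul e y z.
Proof. by apply/ffunP=> i; rewrite !ffunE gmulDl. Qed.
Fact gprod_mulDr g h k (e : g + h = k) x y z :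
  gprod_mul e x (y + z) = gprod_mul e x y + gprod_mul e x z.
Proof. by apply/ffunP=> i; rewrite !ffunE gmulDr. Qed.
Fact gprod_mul1l g (e : 0 + g = g) x : gprod_mul e gprod_one x = x.
Proof. by apply/ffunP=> i; rewrite !ffunE gmul1l. Qed.
Fact gprod_mul1r g (e : g + 0 = g) x : gprod_mul e x gprod_one = x.
Proof. by apply/ffunP=> i; rewrite !ffunE gmul1r. Qed.
Fact gprod_mulA a b c ab bc abc
    (e1 : a + b = ab) (e2 : ab + c = abc) (e3 : b + c = bc) (e4 : a + bc = abc)
    x y z :
  gprod_mul e2 (gprod_mul e1 x y) z = gprod_mul e4 x (gprod_mul e3 y z).
Proof. by apply/ffunP=> i; rewrite !ffunE (gmulA _ e2 e3 e4). Qed.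

Definition gprod_ring : gradedRing G :=
  GradedRing gprod_mulDl gprod_mulDr gprod_mul1l gprod_mul1r gprod_mulA.

Definition gprod_struct_fun g (c : R g) : gprod_ring g :=
  finfun (fun i => gstruct (B i) g c).

Fact gprod_struct_zmod g : zmod_morphism (@gprod_struct_fun g).
Proof. by move=> x y; apply/ffunP=> i; rewrite !ffunE raddfB. Qed.

HB.instance Definition _ g := GRing.isZmodMorphism.Build
  (R g) (gprod_ring g) (@gprod_struct_fun g) (@gprod_struct_zmod g).

Fact gprod_struct1 : gprod_struct_fun (gone R) = gone gprod_ring.
Proof. by apply/ffunP=> i; rewrite !ffunE gmorph1. Qed.
Fact gprod_structM g h k (e : g + h = k) x y :
  gprod_struct_fun (gmul R e x y) =
    gmul gprod_ring e (gprod_struct_fun x) (gprod_struct_fun y).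
Proof. by apply/ffunP=> i; rewrite !ffunE gmorphM. Qed.

Definition gprod_struct : gradedMorphism R gprod_ring :=
  @GradedMorphism _ gprod_ring (fun g => @gprod_struct_fun g)
    gprod_struct1 gprod_structM.

Fact gprod_central g h k (e : g + h = k) (e' : h + g = k)
    (c : R g) (x : gprod_ring h) :
  gmul gprod_ring e (gprod_struct g c) x =
    gmul gprod_ring e' x (gprod_struct g c).
Proof. by apply/ffunP=> i; rewrite !ffunE (gstruct_central e e'). Qed.

Definition gprod : gradedAlgebra R := GradedAlgebra gprod_central.

End Product.

Definition galg_isomorphic R (B C : gradedAlgebra R) :=
  exists phi : gradedMorphism B C,
    (forall g, bijective (phi g)) /\
    (forall g (c : R g), phi g (gstruct B g c) = gstruct C g c).

(* Homogeneous two-sided ideals, given by their homogeneous components. *)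
Record homogeneous_ideal B (I : forall g, B g -> Prop) := HomogeneousIdeal {
  hideal0 : forall g, I g 0;
  hidealB : forall g x y, I g x -> I g y -> I g (x - y);
  hidealMl : forall g h k (e : g + h = k) x y, I h y -> I k (gmul B e x y);
  hidealMr : forall g h k (e : g + h = k) x y, I g x -> I k (gmul B e x y)
}.

Definition zero_hideal B (I : forall g, B g -> Prop) :=
  forall g x, I g x -> x = 0.
Definition full_hideal B (I : forall g, B g -> Prop) := forall g x, I g x.

(* [@hideal_prod B I n k z]: z, of degree k, is a product of n homogeneous
   elements of I.  As I is homogeneous, I^n = 0 iff all these products vanish. *)
Inductive hideal_prod B (I : forall g, B g -> Prop) :
    nat -> forall k, B k -> Prop :=
| HProd0 : hideal_prod I 0 (gone B)
| HProdS n g h k (e : g + h = k) x y :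
    I g x -> hideal_prod I n y -> hideal_prod I n.+1 (gmul B e x y).

Definition nilpotent_hideal B (I : forall g, B g -> Prop) :=
  exists n, forall g (x : B g), hideal_prod I n x -> x = 0.

Definition graded_semisimple B :=
  forall I, @homogeneous_ideal B I -> nilpotent_hideal I -> zero_hideal I.

Definition graded_simple B :=
  gone B != 0 /\
  forall I, @homogeneous_ideal B I -> zero_hideal I \/ full_hideal I.

Definition graded_simple_components R (B : gradedAlgebra R) (I : finType)
    (S : I -> gradedAlgebra R) :=
  galg_isomorphic B (gprod S) /\ forall i, graded_simple (S i).

(* [S : R] = n, for S seen as a graded R-module through f : S has a homogeneous
   R-base (b_j) of n elements, where b_j has degree d_j.  An element of degree g
   is then a unique combination of the b_j with coefficients of degree g - d_j.
   For R = gr_v(F), a commutative graded field, n is determined by f. *)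
Definition has_graded_rank R S (f : gradedMorphism R S) (n : nat) :=
  exists (d : 'I_n -> G) (b : forall j, S (d j)),
  forall g (x : S g), exists! c : {dffun forall j, R (g - d j)},
    x = \sum_j gmul S (subrKC (d j) g) (b j) (f (g - d j) (c j)).

End GradedRings.

Arguments gone {G} g.
Arguments gmul {G} g {_ _ _} _ _ _.

Section DegreeZero.
Variables (G : divOrderedGroupType) (B : gradedRing G).

Definition deg0 : Type := B 0.

HB.instance Definition _ := GRing.Zmodule.copy deg0 (B 0).

Definition deg0_mul (x y : deg0) : deg0 := gmul B (addr0 0) x y.

Fact deg0_mulA : associative deg0_mul.
Proof. by move=> x y z; apply/esym; apply: gmulA. Qed.
Fact deg0_mul1l : left_id (gone B : deg0) deg0_mul.
Proof. by move=> x; apply: gmul1l. Qed.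
Fact deg0_mul1r : right_id (gone B : deg0) deg0_mul.
Proof. by move=> x; apply: gmul1r. Qed.
Fact deg0_mulDl : left_distributive deg0_mul +%R.
Proof. by move=> x y z; apply: gmulDl. Qed.
Fact deg0_mulDr : right_distributive deg0_mul +%R.
Proof. by move=> x y z; apply: gmulDr. Qed.

HB.instance Definition _ := GRing.Zmodule_isPzRing.Build deg0
  deg0_mulA deg0_mul1l deg0_mul1r deg0_mulDl deg0_mulDr.

End DegreeZero.

Section Semisimple.
Variable R : pzRingType.
Implicit Types I J : R -> Prop.

Record ring_ideal I := RingIdeal {
  ring_ideal0 : I 0;
  ring_idealB : forall x y, I x -> I y -> I (x - y);
  ring_idealMl : forall x y, I y -> I (x * y);
  ring_idealMr : forall x y, I x -> I (x * y)
}.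

Definition nilpotent_ring_ideal I :=
  exists n, forall x : 'I_n -> R, (forall i, I (x i)) -> \prod_i x i = 0.

(* No nonzero nilpotent two-sided ideal: this is semisimplicity when R is a
   finite-dimensional algebra over a field. *)
Definition semisimple_ring :=
  forall I, ring_ideal I -> nilpotent_ring_ideal I -> forall x, I x -> x = 0.

(* The last clause says that S, with the operations of R, has only the trivial
   two-sided ideals; J is not required to be an ideal of R. *)
Definition simple_ring_ideal S :=
  (exists2 x, S x & x != 0) /\
  forall J, (forall x, J x -> S x) -> J 0 ->
    (forall x y, J x -> J y -> J (x - y)) ->
    (forall s x, S s -> J x -> J (s * x) /\ J (x * s)) ->
    (forall x, J x -> x = 0) \/ (forall x, S x -> J x).

Definition simple_components n (S : 'I_n -> R -> Prop) :=
  (forall j, ring_ideal (S j) /\ simple_ring_ideal (S j)) /\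
  (forall x, exists! y : {ffun 'I_n -> R},
     (forall j, S j (y j)) /\ x = \sum_j y j).

End Semisimple.

Definition deg0_finite_dim (G : divOrderedGroupType) (R : gradedRing G)
    (B : gradedAlgebra R) :=
  exists n (b : 'I_n -> deg0 B), forall x : deg0 B,
  exists c : 'I_n -> deg0 R,
    x = \sum_i b i * (gstruct B 0 (c i) : deg0 B).

Section AssociatedGraded.
Variables (G : divOrderedGroupType) (B : nzRingType) (beta : filtration G B).

Section Component.
Variable g : G.

(* B_{>= g} *)
Definition fil_ge_pred : {pred B} := fun x => Fin g <= beta x.

Fact fil_ge_zmod_closed : zmod_closed fil_ge_pred.
Proof.
split=> [|x y]; rewrite ?unfold_in /fil_ge_pred; first by rewrite filtration0 le_oo.
move=> gx gy; apply: le_trans (filtrationD _ _ _).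
by rewrite filtrationN le_min gx.
Qed.
HB.instance Definition _ := GRing.isZmodClosed.Build B fil_ge_pred
  fil_ge_zmod_closed.

Record fil_ge := FilGe { fil_ge_val :> B; _ : fil_ge_val \in fil_ge_pred }.
HB.instance Definition _ := [isSub for fil_ge_val].
HB.instance Definition _ := [Choice of fil_ge by <:].
HB.instance Definition _ := [SubChoice_isSubZmodule of fil_ge by <:].

(* B_{> g}, as a subgroup of B_{>= g} *)
Definition fil_gt_pred : {pred fil_ge} := fun x => Fin g < beta (val x).

Fact fil_gt_zmod_closed : zmod_closed fil_gt_pred.
Proof.
split=> [|x y]; rewrite ?unfold_in /fil_gt_pred.
  by rewrite raddf0 filtration0 lt_def le_oo.
move=> gx gy; rewrite raddfB; apply: lt_le_trans (filtrationD _ _ _).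
by rewrite filtrationN lt_min gx.
Qed.
HB.instance Definition _ := GRing.isZmodClosed.Build fil_ge fil_gt_pred
  fil_gt_zmod_closed.

(* B_g = B_{>= g} / B_{> g} *)
Definition gr_comp : zmodType := Quotient.quot fil_gt_pred.

(* x |-> x + B_{> g} *)
Definition gr_class (x : fil_ge) : gr_comp :=
  (\pi_(Quotient.quot fil_gt_pred) x)%qT.
Definition gr_repr (u : gr_comp) : fil_ge :=
  repr (u : Quotient.quot fil_gt_pred).

Fact gr_class_zmod : zmod_morphism gr_class.
Proof. by move=> x y; apply: raddfB. Qed.
HB.instance Definition _ :=
  GRing.isZmodMorphism.Build fil_ge gr_comp gr_class gr_class_zmod.

Lemma gr_reprK u : gr_class (gr_repr u) = u.
Proof. exact: reprK. Qed.

Lemma gr_class_eq x y :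
  (gr_class x == gr_class y) = (Fin g < beta (val x - val y)).
Proof. by rewrite -Quotient.idealrBE unfold_in /fil_gt_pred raddfB. Qed.

End Component.

Fact fil_ge_mul_subproof g h k (e : g + h = k) (x : fil_ge g) (y : fil_ge h) :
  val x * val y \in fil_ge_pred k.
Proof.
rewrite unfold_in /fil_ge_pred -e; apply: le_trans (filtrationM _ _ _).
by apply: Fin_leD; [apply: (valP x) | apply: (valP y)].
Qed.
Definition fil_ge_mul g h k (e : g + h = k) x y : fil_ge k :=
  FilGe (@fil_ge_mul_subproof g h k e x y).

Fact fil_ge_one_subproof : 1 \in fil_ge_pred 0.
Proof. by rewrite unfold_in /fil_ge_pred filtration1. Qed.
Definition fil_ge_one : fil_ge 0 := FilGe fil_ge_one_subproof.

Definition gr_one : gr_comp 0 := gr_class fil_ge_one.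
Definition gr_mul g h k (e : g + h = k) (u : gr_comp g) (w : gr_comp h) :
  gr_comp k := gr_class (fil_ge_mul e (gr_repr u) (gr_repr w)).

Lemma Fin_ltgeD (a b : G) x y : Fin a < x -> Fin b <= y -> Fin (a + b) < x + y.
Proof. by rewrite [x + y]addrC [a + b]addrC => ax bley; apply: Fin_leltD. Qed.

Lemma gr_mul_class g h k (e : g + h = k) x y :
  gr_mul e (gr_class x) (gr_class y) = gr_class (fil_ge_mul e x y).
Proof.
apply/eqP; rewrite gr_class_eq /= -e.
set x' := gr_repr _; set y' := gr_repr _.
have Dx : Fin g < beta (val x' - val x) by rewrite -gr_class_eq gr_reprK.
have Dy : Fin h < beta (val y' - val y) by rewrite -gr_class_eq gr_reprK.
have -> : val x' * val y' - val x * val y =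
    (val x' - val x) * val y' + val x * (val y' - val y).
  by rewrite mulrBl mulrBr addrA subrK.
apply: lt_le_trans (filtrationD _ _ _); rewrite lt_min.
apply/andP; split; apply: lt_le_trans (filtrationM _ _ _).
  by apply: Fin_ltgeD => //; apply: (valP y').
by apply: Fin_leltD => //; apply: (valP x).
Qed.

Fact gr_mulDl g h k (e : g + h = k) x y z :
  gr_mul e (x + y) z = gr_mul e x z + gr_mul e y z.
Proof.
rewrite -[x]gr_reprK -[y]gr_reprK -[z]gr_reprK -raddfD !gr_mul_class -raddfD.
by congr gr_class; apply: val_inj; rewrite /= mulrDl.
Qed.
Fact gr_mulDr g h k (e : g + h = k) x y z :
  gr_mul e x (y + z) = gr_mul e x y + gr_mul e x z.
Proof.
rewrite -[x]gr_reprK -[y]gr_reprK -[z]gr_reprK -raddfD !gr_mul_class -raddfD.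
by congr gr_class; apply: val_inj; rewrite /= mulrDr.
Qed.
Fact gr_mul1l g (e : 0 + g = g) x : gr_mul e gr_one x = x.
Proof.
rewrite -[x]gr_reprK gr_mul_class; congr gr_class.
by apply: val_inj; rewrite /= mul1r.
Qed.
Fact gr_mul1r g (e : g + 0 = g) x : gr_mul e x gr_one = x.
Proof.
rewrite -[x]gr_reprK gr_mul_class; congr gr_class.
by apply: val_inj; rewrite /= mulr1.
Qed.
Fact gr_mulA a b c ab bc abc
    (e1 : a + b = ab) (e2 : ab + c = abc) (e3 : b + c = bc) (e4 : a + bc = abc)
    x y z : gr_mul e2 (gr_mul e1 x y) z = gr_mul e4 x (gr_mul e3 y z).
Proof.
rewrite -[x]gr_reprK -[y]gr_reprK -[z]gr_reprK !gr_mul_class; congr gr_class.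
by apply: val_inj; rewrite /= mulrA.
Qed.

Definition gr : gradedRing G :=
  GradedRing gr_mulDl gr_mulDr gr_mul1l gr_mul1r gr_mulA.

End AssociatedGraded.

(* A ring morphism that does not decrease values induces
   x + B_{> g} |-> f(x) + C_{> g} on the graded rings. *)
Section GradedMap.
Variables (G : divOrderedGroupType) (B C : nzRingType).
Variables (beta : filtration G B) (gamma : filtration G C).
Variables (f : {rmorphism B -> C}) (le_f : forall x, beta x <= gamma (f x)).

Fact gr_map_subproof g (x : fil_ge beta g) : f (val x) \in fil_ge_pred gamma g.
Proof. exact: le_trans (valP x) (le_f _). Qed.

Definition gr_map_fun g (u : gr beta g) : gr gamma g :=
  gr_class (FilGe (gr_map_subproof (gr_repr u))).

Lemma gr_map_class g (x : fil_ge beta g) :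
  gr_map_fun (gr_class x) = gr_class (FilGe (gr_map_subproof x)).
Proof.
apply/eqP; rewrite gr_class_eq /= -rmorphB; apply: lt_le_trans (le_f _).
by rewrite -gr_class_eq gr_reprK.
Qed.

Fact gr_map_zmod g : zmod_morphism (@gr_map_fun g).
Proof.
move=> x y; rewrite -[x]gr_reprK -[y]gr_reprK -raddfB !gr_map_class -raddfB.
by congr gr_class; apply: val_inj; rewrite /= rmorphB.
Qed.
HB.instance Definition _ g := GRing.isZmodMorphism.Build
  (gr beta g) (gr gamma g) (@gr_map_fun g) (@gr_map_zmod g).

Fact gr_map1 : gr_map_fun (gone (gr beta)) = gone (gr gamma).
Proof.
rewrite [LHS]gr_map_class; congr gr_class.
by apply: val_inj; rewrite /= rmorph1.
Qed.
Fact gr_mapM g h k (e : g + h = k) x y :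
  gr_map_fun (gmul (gr beta) e x y) =
    gmul (gr gamma) e (gr_map_fun x) (gr_map_fun y).
Proof.
rewrite -[x]gr_reprK -[y]gr_reprK /= gr_mul_class !gr_map_class gr_mul_class.
by congr gr_class; apply: val_inj; rewrite /= rmorphM.
Qed.

Definition gr_map : gradedMorphism (gr beta) (gr gamma) :=
  @GradedMorphism _ (gr beta) (gr gamma) (fun g => @gr_map_fun g)
    gr_map1 gr_mapM.

Hypothesis f_central : forall x y, f x * y = y * f x.

Fact gr_map_central g h k (e : g + h = k) (e' : h + g = k)
    (c : gr beta g) (x : gr gamma h) :
  gmul (gr gamma) e (gr_map g c) x = gmul (gr gamma) e' x (gr_map g c).
Proof.
rewrite -[c]gr_reprK -[x]gr_reprK /= gr_map_class !gr_mul_class.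
by congr gr_class; apply: val_inj; rewrite /= f_central.
Qed.

Definition gr_algebra : gradedAlgebra (gr beta) := GradedAlgebra gr_map_central.

End GradedMap.

Definition gr_valuation (G : divOrderedGroupType) (F : fieldType)
  (v : valuation G F) : gradedRing G := gr (valuation_filtration v).

Record gauge (G : divOrderedGroupType) (F : fieldType) (v : valuation G F)
    (A : falgType F) := Gauge {
  gauge_fun :> A -> ext G;
  gauge_norm : norm v gauge_fun;
  gauge_surm : surmultiplicative gauge_fun;
  gauge_semisimple :
    graded_semisimple (gr (surm_filtration gauge_norm.1 gauge_surm))
}.

Section GaugeGraded.
Variables (G : divOrderedGroupType) (F : fieldType) (v : valuation G F).
Variables (A : falgType F) (alpha : gauge v A).

Definition gauge_filtration : filtration G A :=
  surm_filtration (gauge_norm alpha).1 (gauge_surm alpha).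

Fact gauge_in_alg c : valuation_filtration v c <= gauge_filtration (in_alg A c).
Proof.
change (v c <= alpha c%:A); case: (gauge_norm alpha).1 => _ _ ->.
by rewrite (gauge_surm alpha).1 add0r.
Qed.

Fact in_alg_central (c : F) (x : A) : in_alg A c * x = x * in_alg A c.
Proof. by rewrite /= -scalerAl -scalerAr mul1r mulr1. Qed.

Definition gr_gauge : gradedAlgebra (gr_valuation v) :=
  gr_algebra gauge_in_alg in_alg_central.

End GaugeGraded.

Section GradedExtension.
Variables (G : divOrderedGroupType) (F : fieldType) (K : fieldExtType F).
Variables (v : valuation G F) (w : valuation G K) (ext_vw : extends v w).

Fact gr_extension_subproof c :
  valuation_filtration v c <= valuation_filtration w (in_alg K c).
Proof. by change (v c <= w c%:A); rewrite ext_vw. Qed.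

Definition gr_extension : gradedMorphism (gr_valuation v) (gr_valuation w) :=
  gr_map gr_extension_subproof.

End GradedExtension.

(* Main.v *)
(* The restriction of alpha to the center K is a power-multiplicative value
   function, so gr(K) is reduced and its primitive idempotents of degree 0 lift to
   elements eps_1, ..., eps_r of K.  Let C_i be the multiplicative set of the d in
   K with alpha d = 0 = alpha (eps_i d).  Then alpha_i u, the largest value of
   alpha (d u) for d in C_i, exists for every u in A.  On K it is a valuation, since
   the localization at C_i of the ring {alpha >= 0} is a valuation ring, by the
   argument for Pruefer extensions.  These are all the extensions of v, because
   every extension dominates alpha on K, by integrality.  On A the functions
   alpha_i are the required gauges, and the idempotents eps_i patch independent
   elements together, so that gr(A) is the product of the gr_{alpha_i}(A).

   That maxima are attained, here and for the existence of orthogonal bases, rests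
   on one fact: an operator that strictly increases all values has a characteristic
   polynomial congruent to a power of 'X.  The same fact gives graded simplicity.
   An ideal of gr_{alpha_i}(A) is generated by a central idempotent, and if z lifts
   a nontrivial one, then a |-> z a (1 - z) increases all values; the Cayley-Hamilton
   relation for it is then a nontrivial relation in the tensor product of A and its
   opposite over K, which acts faithfully on A since A is central simple over K. *)

Require Import Defs.
From HB Require Import structures.
From mathcomp Require Import all_boot all_order all_fingroup all_algebra all_field.
From mathcomp Require Import ring.
From Stdlib Require Import Classical.

Set Implicit Arguments.
Unset Strict Implicit.
Unset Printing Implicit Defensive.

Import Order.TTheory GRing.Theory Num.Theory.
Local Open Scope ring_scope.

(** * Values and ultrametric functions *)

(** No completion or henselization of (F, v) enters. Maxima are found by linear algebra over F and
    K, with orthogonal families, called towers. The idempotents of gr(K) cannot be lifted to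
    idempotents, because K is a field; the eps_i are idempotent only modulo elements of positive
    value. Hence the i-th component of A is not the image of a projection, and localization at i
    replaces it: multiplying u by elements of C_i raises its value until the leading class of u has
    a nonzero component at i ([good]). On such elements the scalars of K act additively on values.

    The semisimplicity of gr(A) is used in the form u gr(A) u != 0 for homogeneous u != 0. For
    central u this says alpha (u^2) = 2 alpha u, the power-multiplicativity on K. For general u,
    Brauer's lemma turns it into idempotents in every nonzero right ideal, whence ideals generated
    by central idempotents, both in gr and in its degree-zero part. *)

Section ExtArith.
Variable G : divOrderedGroupType.
Implicit Types (x y z : ext G) (g h : G).

Lemma ext0E : Fin 0 = 0 :> ext G. Proof. by []. Qed.

Lemma addoox x : oo + x = oo. Proof. by case: x. Qed.

Lemma ext_leD x x' y y' : x <= x' -> y <= y' -> x + y <= x' + y'.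
Proof.
case: x' => [x'|]; last by rewrite addoox le_oo.
case: y' => [y'|]; last by rewrite addoo le_oo.
case: x => [x|] // lex; case: y => [y|] // ley; exact: Fin_leD.
Qed.

Lemma fin_of_neq_oo x : x != oo -> exists g, x = Fin g.
Proof. by case: x => [g|] // _; exists g. Qed.

Lemma fin_of_lt x y : x < y -> exists g, x = Fin g.
Proof. by case: x => [g|] //; [exists g | case: y]. Qed.

Lemma ext_lt_oo g : Fin g < oo :> ext G. Proof. by rewrite lt_def. Qed.

Lemma ext_lt_leD x x' y y' : x < x' -> y <= y' -> y != oo -> x + y < x' + y'.
Proof.
move=> ltx ley ny; have [g xg] := fin_of_lt ltx; have [h yh] := fin_of_neq_oo ny.
by subst; rewrite -[_ + Fin h]/(Fin (g + h)) Fin_ltgeD.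
Qed.

Lemma ext_le_ltD x x' y y' : x <= x' -> y < y' -> x != oo -> x + y < x' + y'.
Proof. by move=> lex lty nx; rewrite addrC [x' + _]addrC ext_lt_leD. Qed.

Lemma ext_ltD x x' y y' : x < x' -> y < y' -> x + y < x' + y'.
Proof. by move=> ltx lty; apply: ext_lt_leD; rewrite ?ltW //; case: y lty => [|] //; case: y'. Qed.

Lemma FinD g h : Fin (g + h) = Fin g + Fin h. Proof. by []. Qed.

Lemma FinNK g x : Fin (- g) + (Fin g + x) = x.
Proof. by rewrite addrA -FinD addNr add0r. Qed.

Lemma FinKN g x : Fin g + (Fin (- g) + x) = x.
Proof. by rewrite addrA -FinD addrN add0r. Qed.

Lemma Fin_addNr g : Fin (- g) + Fin g = 0. Proof. by rewrite -FinD addNr. Qed.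
Lemma Fin_addrN g : Fin g + Fin (- g) = 0. Proof. by rewrite -FinD addrN. Qed.

Lemma Fin_leD2l g x y : (Fin g + x <= Fin g + y) = (x <= y).
Proof.
apply/idP/idP => [|h]; last exact: ext_leD.
by move/(ext_leD (lexx (Fin (- g)))); rewrite !FinNK.
Qed.

Lemma Fin_ltD2l g x y : (Fin g + x < Fin g + y) = (x < y).
Proof. by rewrite !ltNge Fin_leD2l. Qed.

Lemma FinMn g n : Fin (g *+ n) = Fin g *+ n.
Proof. by elim: n => [|n IH] //; rewrite !mulrS FinD IH. Qed.

Lemma ext_add_neq_oo x y : (x + y != oo) = (x != oo) && (y != oo).
Proof. by case: x y => [x|] [y|]. Qed.

Lemma ext_leMn n x y : x <= y -> x *+ n <= y *+ n.
Proof. by move=> le; elim: n => [|n IH]; rewrite ?mulr0n // !mulrS ext_leD. Qed.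

Lemma ext_ltMn n x y : x < y -> x *+ n.+1 < y *+ n.+1.
Proof.
move=> lt; elim: n => [|n IH]; rewrite ?mulr1n // mulrS [ltRHS]mulrS.
exact: ext_ltD.
Qed.

End ExtArith.

(** The additive part of a value function, free of scalars: on A the same function is used over F
    and over K. *)
Definition ultra (G : divOrderedGroupType) (V : zmodType) (a : V -> ext G) :=
  [/\ forall x, a x = oo <-> x = 0, forall x, a (- x) = a x
    & forall x y, Num.min (a x) (a y) <= a (x + y)].

Section Ultra.
Variables (G : divOrderedGroupType) (V : zmodType) (a : V -> ext G).
Hypothesis ua : ultra a.
Implicit Types (x y : V) (t : ext G).

Lemma ultra0 : a 0 = oo. Proof. by case: ua => /(_ 0)[_ ->]. Qed.

Lemma ultra_eq_oo x : (a x == oo) = (x == 0).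
Proof. by case: ua => h _ _; apply/eqP/eqP => /h. Qed.

Lemma ultraN x : a (- x) = a x. Proof. by case: ua. Qed.

Lemma ultraC x y : a (x - y) = a (y - x). Proof. by rewrite -ultraN opprB. Qed.

Lemma ultraD x y : Num.min (a x) (a y) <= a (x + y). Proof. by case: ua. Qed.

Lemma ultra_leD t x y : t <= a x -> t <= a y -> t <= a (x + y).
Proof. by move=> lx ly; apply: le_trans (ultraD _ _); rewrite le_min lx. Qed.

Lemma ultra_leB t x y : t <= a x -> t <= a y -> t <= a (x - y).
Proof. by move=> lx ly; apply: ultra_leD; rewrite ?ultraN. Qed.

Lemma ultra_ltD t x y : t < a x -> t < a y -> t < a (x + y).
Proof. by move=> lx ly; apply: lt_le_trans (ultraD _ _); rewrite lt_min lx. Qed.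

Lemma ultra_ltB t x y : t < a x -> t < a y -> t < a (x - y).
Proof. by move=> lx ly; apply: ultra_ltD; rewrite ?ultraN. Qed.

Lemma ultra_le_sum (I : Type) (r : seq I) (P : pred I) (f : I -> V) t :
  (forall i, P i -> t <= a (f i)) -> t <= a (\sum_(i <- r | P i) f i).
Proof.
by move=> le_t; elim/big_ind: _ => //; [rewrite ultra0 le_oo | apply: ultra_leD].
Qed.

Lemma ultra_lt_sum (I : Type) (r : seq I) (P : pred I) (f : I -> V) t :
  t < oo -> (forall i, P i -> t < a (f i)) -> t < a (\sum_(i <- r | P i) f i).
Proof.
by move=> t_oo lt_t; elim/big_ind: _ => //; [rewrite ultra0 | apply: ultra_ltD].
Qed.

Lemma ultra_eq_l x y : a x < a y -> a (x + y) = a x.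
Proof.
move=> ltxy; apply/le_anti/andP; split; last by apply: ultra_leD => //; apply: ltW.
by rewrite leNgt; apply/negP => lt; have := ultra_ltB lt ltxy; rewrite addrK ltxx.
Qed.

Lemma ultra_eqB x y : a x < a (x - y) -> a y = a x.
Proof.
move=> lt; have := @ultra_eq_l (- x) (x - y).
by rewrite addKr !ultraN => /(_ lt).
Qed.

Lemma ultra_lt_trans t x y z : t < a (x - y) -> t < a (y - z) -> t < a (x - z).
Proof. by move=> l1 l2; rewrite -[x](subrK y) -addrA ultra_ltD. Qed.

Lemma ultra_ltE t x y : t < a (x - y) -> (t < a x) = (t < a y).
Proof.
move=> lt; apply/idP/idP => h.
  by rewrite -[y](subKr x) ultra_ltB.
by rewrite -[x](subrK y) ultra_ltD.
Qed.

End Ultra.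

Definition scaled (G : divOrderedGroupType) (F : fieldType) (V : lmodType F)
    (v : valuation G F) (a : V -> ext G) :=
  ultra a /\ forall (c : F) x, a (c *: x) = a x + v c.

Section Valuations.
Variables (G : divOrderedGroupType) (F : fieldType) (v : valuation G F).

Lemma valuation_ultra : ultra v.
Proof.
split; [exact: valuation_oo | exact: valuation_filtrationN | exact: valuationD].
Qed.

Lemma valuation_neq_oo c : (v c != oo) = (c != 0).
Proof. by rewrite (ultra_eq_oo valuation_ultra). Qed.

Lemma valuationV c : c != 0 -> v c + v c^-1 = 0.
Proof. by move=> nz; rewrite -valuationM mulfV // valuation1. Qed.

Lemma valuationVE c g : v c = Fin g -> v c^-1 = Fin (- g).
Proof.
move=> vc; have nz : c != 0 by rewrite -valuation_neq_oo vc.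
by have := valuationV nz; rewrite vc => e; rewrite -[LHS](FinNK g) e addr0.
Qed.

Lemma valuationX c n : v (c ^+ n) = v c *+ n.
Proof.
by elim: n => [|n IH]; rewrite ?expr0 ?valuation1 // exprS valuationM IH mulrS.
Qed.

Lemma value_function_scaled (A : falgType F) (alpha : A -> ext G) :
  value_function v alpha <-> scaled v alpha.
Proof.
split=> [va|[[h1 h2 h3] h4]]; last by split.
case: (va) => h1 h2 h3; split; last by [].
by split=> //; apply: surm_filtrationN va.
Qed.

End Valuations.

(** * Orthogonal towers and attained distances *)

Definition subsp (F : fieldType) (V : lmodType F) (U : V -> Prop) :=
  U 0 /\ forall (c : F) x y, U x -> U y -> U (c *: x + y).

Section Subsp.
Variables (F : fieldType) (V : vectType F) (U : V -> Prop).
Hypothesis sU : subsp U.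

Lemma subspZ c x : U x -> U (c *: x).
Proof. by case: sU => U0 UD Ux; rewrite -[_ *: x]addr0; apply: UD. Qed.

Lemma subspD x y : U x -> U y -> U (x + y).
Proof. by case: sU => U0 UD Ux Uy; rewrite -[x]scale1r; apply: UD. Qed.

Lemma subspN x : U x -> U (- x).
Proof. by rewrite -scaleN1r; apply: subspZ. Qed.

Lemma subspB x y : U x -> U y -> U (x - y).
Proof. by move=> Ux Uy; apply: subspD => //; apply: subspN. Qed.

Lemma subsp_sum (I : Type) (r : seq I) (P : pred I) (f : I -> V) :
  (forall i, P i -> U (f i)) -> U (\sum_(i <- r | P i) f i).
Proof. by move=> h; elim/big_ind: _ => //; [case: sU | apply: subspD]. Qed.

Lemma subsp_span (s : seq V) x : (forall y, y \in s -> U y) -> x \in <<s>>%VS -> U x.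
Proof.
move=> sub; rewrite -[s]/(val (in_tuple s)) => /coord_span->.
by apply: subsp_sum => i _; apply/subspZ/sub/mem_nth.
Qed.

End Subsp.

(* The members of s, read from the end, are successively orthogonal to U and to
   the later members: dist(y, U + <<s'>>) is attained at 0. *)
Fixpoint tower (G : divOrderedGroupType) (F : fieldType) (V : vectType F)
    (a : V -> ext G) (U : V -> Prop) (s : seq V) : Prop :=
  if s is y :: s' then
    [/\ y != 0, forall u t, U u -> t \in <<s'>>%VS -> a (u + t + y) <= a y
      & tower a U s']
  else True.

Section Tower.
Variables (G : divOrderedGroupType) (F : fieldType) (v : valuation G F).
Variables (V : vectType F) (a : V -> ext G).
Hypothesis sa : scaled v a.
Implicit Types (U : V -> Prop) (s : seq V) (x y u : V).

Let ua : ultra a := sa.1.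
Let aZ c x : a (c *: x) = a x + v c. Proof. exact: sa.2. Qed.

Lemma tower_free U s : U 0 -> tower a U s -> free s.
Proof.
move=> U0; elim: s => [|y s IH] /=; first by rewrite nil_free.
case=> nz best /IH fs; rewrite free_cons fs andbT.
apply/negP => ys; have := best 0 (- y) U0; rewrite rpredN => /(_ ys).
by rewrite add0r addNr (ultra0 ua) => /oo_le/eqP; rewrite (ultra_eq_oo ua) (negPf nz).
Qed.

Lemma tower_size U s : U 0 -> tower a U s -> (size s <= \dim {: V})%N.
Proof. by move=> U0 /(tower_free U0)/eqP<-; apply/dimvS/subvf. Qed.

Lemma best_scale U y c u : subsp U -> (forall u, U u -> a (u + y) <= a y) ->
  U u -> a (u + c *: y) <= a (c *: y).
Proof.
move=> sU best Uu; have [->|nzc] := eqVneq c 0.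
  by rewrite scale0r (ultra0 ua) le_oo.
rewrite -[u](scalerKV nzc) -scalerDr !aZ ext_leD //.
by apply: best; apply: subspZ.
Qed.

(* orthogonality turns <= into an equality with the minimum *)
Lemma best_min U y c u t : subsp U -> (forall u, U u -> a (u + y) <= a y) ->
  U u -> t <= a (u + c *: y) -> t <= a u /\ t <= a (c *: y).
Proof.
move=> sU best Uu let_; have lec := le_trans let_ (best_scale c sU best Uu).
by split=> //; rewrite -[u](addrK (c *: y)) ultra_leB.
Qed.

Lemma subsp_addspan U s : subsp U ->
  subsp (fun z => exists u t, [/\ U u, t \in <<s>>%VS & z = u + t]).
Proof.
move=> sU; split; first by exists 0, 0; rewrite mem0v addr0; case: sU.
move=> c x y [u [t [Uu st ->]]] [u' [t' [Uu' st' ->]]].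
exists (c *: u + u'), (c *: t + t'); split; first by case: sU => _; apply.
  by rewrite memvD ?memvZ.
by rewrite scalerDr addrACA.
Qed.

(** Peeling off the members of s, [best_min] bounds the value of the sum by that of each term. For U
    = 0 the value of the sum is therefore the minimum over its terms: a tower is an orthogonal base
    of its span. *)
Lemma tower_coord U s u (c : nat -> F) i : subsp U -> tower a U s -> U u ->
  (i < size s)%N ->
  a (u + \sum_(j < size s) c j *: s`_j) <= a s`_i + v (c i).
Proof.
move=> sU; elim: s i c => [|y s IH] //= i c [nz best ts] Uu lti.
have -> : \sum_(j < (size s).+1) c j *: (y :: s)`_j =
    c 0%N *: y + \sum_(j < size s) c j.+1 *: s`_j by rewrite big_ord_recl.
set t := \sum_(j < size s) _; set z := _ + _.
have st : t \in <<s>>%VS.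
  by apply: memv_suml => j _; apply/memvZ/memv_span/mem_nth.
have [|||le1 le2] := @best_min _ y (c 0%N) (u + t) (a z) (subsp_addspan s sU).
- by move=> _ [u' [t' [Uu' st' ->]]]; apply: best.
- by exists u, t.
- by rewrite /z addrA addrAC -addrA.
case: i lti => [|i] lti; first by rewrite -aZ.
exact: le_trans le1 (IH i (fun j => c j.+1) ts Uu lti).
Qed.

Lemma subsp0 : subsp (fun x : V => x = 0).
Proof. by split=> // c x y -> ->; rewrite scaler0 addr0. Qed.

(** Distances to subspaces are attained in a space with an orthogonal base, over any valued field.
    By induction on the tower, everything but the coefficient c of one vector of U is chosen
    optimally inside the span of the shorter tower, and the best c is one of two explicit
    scalars. *)
Lemma prox s U y : tower a (fun x => x = 0) s -> subsp U ->
  (forall u, U u -> u \in <<s>>%VS) -> y \in <<s>>%VS ->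
  exists2 u0, U u0 & forall u, U u -> a (y + u) <= a (y + u0).
Proof.
elim: s U y => [|x s IH] U y /= ts sU Us ys.
  exists 0; first by case: sU.
  by move=> u /Us; rewrite span_nil memv0 => /eqP->.
case: ts => nzx best ts.
have splitx z : z \in <<x :: s>>%VS -> exists c w, w \in <<s>>%VS /\ z = c *: x + w.
  rewrite span_cons => /memv_addP[_ /vlineP[c ->] [w sw ->]]; by exists c, w.
have bestx w : w \in <<s>>%VS -> a (w + x) <= a x.
  by move=> sw; have := best 0 w erefl sw; rewrite add0r.
have ssub : subsp (fun w : V => w \in <<s>>%VS).
  by split=> [|c p q sp sq]; rewrite ?mem0v // memvD ?memvZ.
have minx c w t : w \in <<s>>%VS -> (t <= a (w + c *: x)) = (t <= a w) && (t <= a (c *: x)).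
  move=> sw; apply/idP/andP => [|[]]; last exact: ultra_leD.
  exact: (best_min ssub bestx sw).
pose U' u := U u /\ u \in <<s>>%VS.
have sU' : subsp U'.
  split; first by split; [case: sU | rewrite mem0v].
  move=> c p q [Up sp] [Uq sq]; split; last by rewrite memvD ?memvZ.
  by case: sU => _; apply.
have [[x1 [Ux1 nsx1]]|noU] := classic (exists u, U u /\ u \notin <<s>>%VS); last first.
  have UU' u : U u -> U' u.
    by move=> Uu; split=> //; apply/negPn/negP => n; apply: noU; exists u.
  have [c [w [sw ->]]] := splitx _ ys.
  have [u0 [Uu0 su0] best0] := IH U' w ts sU' (fun u h => h.2) sw.
  exists u0 => // u Uu; have [_ su] := UU' u Uu.
  rewrite -!addrA ![c *: x + _]addrC.
  rewrite minx ?memvD //; have := lexx (a (w + u + c *: x)).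
  rewrite {1}minx ?memvD // => /andP[l1 ->]; rewrite andbT.
  by apply: le_trans l1 (best0 _ (UU' u Uu)).
have [c1 [w1 [sw1 x1E]]] := splitx _ (Us _ Ux1).
have nzc1 : c1 != 0.
  by apply: contraNneq nsx1 => c0; rewrite x1E c0 scale0r add0r.
have [u1 [Uu1 su1] best1] := IH U' (c1^-1 *: w1) ts sU' (fun u h => h.2) (memvZ _ sw1).
(* U is spanned by U' and one more vector x + w0, where w0 is corrected by U' so as to be orthogonal
   to it. *)
pose w0 := c1^-1 *: w1 + u1.
have sw0 : w0 \in <<s>>%VS by rewrite memvD ?memvZ.
have Uxw0 : U (x + w0).
  have -> : x + w0 = c1^-1 *: x1 + u1 by rewrite x1E scalerDr scalerK // addrA.
  by case: sU => _; apply.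
have bestw0 u : U' u -> a (u + w0) <= a w0.
  move=> U'u; rewrite addrC -addrA; apply: best1; exact: subspD.
have Usplit u : U u -> exists c u', U' u' /\ u = c *: (x + w0) + u'.
  move=> Uu; have [c [w [sw uE]]] := splitx _ (Us _ Uu).
  exists c, (u - c *: (x + w0)); split; last by rewrite addrC subrK.
  split; first by apply: subspB => //; apply: subspZ.
  by rewrite uE scalerDr opprD addrACA subrr add0r memvB ?memvZ.
have [cy [wy [swy yE]]] := splitx _ ys.
pose y' := wy - cy *: w0.
have sy' : y' \in <<s>>%VS by rewrite memvB ?memvZ.
have yE' : y = cy *: (x + w0) + y'.
  by rewrite yE /y' scalerDr -addrA; congr (_ + _); rewrite addrC subrK.
(* The projection of U to the span of s along x. *)
pose U2 u := exists c u', U' u' /\ u = c *: w0 + u'.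
have sU2 : subsp U2.
  split; first by exists 0, 0; rewrite scale0r addr0; split=> //; case: sU'.
  move=> c p q [c2 [p' [Up ->]]] [c3 [q' [Uq ->]]].
  exists (c * c2 + c3), (c *: p' + q'); split; first by case: sU' => _; apply.
  by rewrite scalerDr scalerA scalerDl addrACA.
have sU2s u : U2 u -> u \in <<s>>%VS.
  by move=> [c [u' [[_ su'] ->]]]; rewrite memvD ?memvZ.
have [_ [c2 [u2 [U'u2 ->]]] best2] := IH U2 y' ts sU2 sU2s sy'.
pose y1 := y' + (c2 *: w0 + u2).
have sy1 : y1 \in <<s>>%VS by rewrite memvD ?memvZ // memvD ?memvZ //; case: U'u2.
have besty1 u : U2 u -> a (u + y1) <= a y1.
  move=> U2u; rewrite addrC -addrA; apply: best2; apply: subspD => //.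
  by exists c2, u2.
(* The four summands on the right are mutually orthogonal, so the value of the sum is the least of
   theirs. *)
have zE c u : y' + (c *: (x + w0) + u) =
    ((u - u2 + (c - c2) *: w0) + 1 *: y1) + c *: x.
  rewrite scale1r /y1 scalerDr scalerBl.
  rewrite [u - u2 + _]addrACA -opprD [c2 *: w0 + u2]addrC [_ + (y' + _)]addrCA.
  rewrite subrK -!addrA; congr (_ + _).
  by congr (_ + _); rewrite [LHS]addrC [X in X + _]addrC -addrA.
have sl c u : U' u -> u - u2 + (c - c2) *: w0 \in <<s>>%VS.
  by move=> [_ su]; apply: memvD; [apply: memvB => //; case: U'u2 | apply: memvZ].
have value c u t : U' u -> t <= a (y' + (c *: (x + w0) + u)) ->
    [/\ t <= a x + v c, t <= a y1 & t <= a w0 + v (c - c2)].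
  move=> U'u; rewrite zE minx; last by apply: memvD; [apply: sl | apply: memvZ].
  move=> /andP[le1 le2].
  have [|le3 le4] := best_min sU2 besty1 _ le1.
    by exists (c - c2), (u - u2); split; [apply: subspB | rewrite addrC].
  have [|le5 le6] := best_min sU' bestw0 _ le3; first exact: subspB.
  by rewrite scale1r in le4; rewrite -!aZ.
have valueD c t : t <= a x + v c -> t <= a y1 -> t <= a w0 + v (c - c2) ->
    t <= a (y' + (c *: (x + w0) + u2)).
  move=> le1 le2 le3; rewrite zE subrr add0r minx ?memvD ?memvZ //.
  by rewrite scale1r aZ le1 andbT ultra_leD // aZ.
have Ubase c u : U' u -> U (c *: (x + w0) + u) by case: sU => _ UD [Uu _]; apply: UD.
pose f c := a (y' + (c *: (x + w0) + u2)).
(* Only v c and v (c - c2) matter. If v c <= v c2, then c2 is at least as good as c; otherwise v (c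
   - c2) = v c2, and 0 is. *)
have cand c u : U' u -> a (y' + (c *: (x + w0) + u)) <= f 0 \/
    a (y' + (c *: (x + w0) + u)) <= f c2.
  move=> U'u; have [le1 le2 le3] := value c u _ U'u (lexx _).
  have [lec|ltc] := leP (v c) (v c2); [right | left]; apply: valueD => //.
  - exact: le_trans le1 (ext_leD (lexx _) lec).
  - by rewrite subrr (ultra0 (valuation_ultra v)) addoo le_oo.
  - by rewrite (ultra0 (valuation_ultra v)) addoo le_oo.
  have vu := valuation_ultra v.
  rewrite sub0r (ultraN vu); move: le3.
  by rewrite (ultraC vu) (ultra_eq_l vu) ?(ultraN vu).
have [c0 best0] : exists c0, forall c u, U' u ->
    a (y' + (c *: (x + w0) + u)) <= f c0.
  have [le0|/ltW le0] := leP (f 0) (f c2); [exists c2 | exists 0] => c u /(cand c)[] h //;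
  exact: le_trans h le0.
exists ((c0 - cy) *: (x + w0) + u2); first exact: Ubase.
have yuE c u : y + (c *: (x + w0) + u) = y' + ((cy + c) *: (x + w0) + u).
  by rewrite yE' [_ + y']addrC -addrA [_ + (_ + u)]addrA -scalerDl.
move=> _ /Usplit[c [u [U'u ->]]].
by rewrite !yuE [cy + (_ - _)]addrC subrK; apply: best0.
Qed.

End Tower.

Lemma ex_max (P : nat -> Prop) (n0 N : nat) : P n0 -> (forall n, P n -> (n <= N)%N) ->
  exists n, P n /\ forall m, P m -> (m <= n)%N.
Proof.
move=> P0 bound; suff: forall k n, (N - n <= k)%N -> P n ->
    exists n, P n /\ forall m, P m -> (m <= n)%N by move/(_ _ n0 (leqnn _) P0).
elim=> [|k IH] n leNk Pn.
  exists n; split=> // m /bound leN; apply: leq_trans leN _.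
  by rewrite -subn_eq0 -leqn0.
have [[m [Pm ltnm]]|max] := classic (exists m, P m /\ (n < m)%N).
  apply: (IH m) => //; rewrite -ltnS; apply: leq_trans leNk.
  by apply: ltn_sub2l => //; apply: leq_trans ltnm (bound _ Pm).
exists n; split=> // m Pm; rewrite leqNgt; apply/negP => lt.
by apply: max; exists m.
Qed.

Section Complement.
Variables (G : divOrderedGroupType) (F : fieldType) (v : valuation G F).
Variables (V : vectType F) (a : V -> ext G).
Hypothesis sa : scaled v a.

(** A tower in W of maximal length: an element of W outside U + <<t>>, moved by its best
    approximation from [prox], would prolong it. *)
Lemma complement_tower (s : seq V) (U W : V -> Prop) :
  tower a (fun x => x = 0) s -> <<s>>%VS = fullv -> subsp U -> subsp W ->
  (forall u, U u -> W u) ->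
  exists t, [/\ tower a U t, forall y, y \in t -> W y
    & forall z, W z -> exists u, U u /\ z - u \in <<t>>%VS].
Proof.
move=> ts sf sU sW UW.
pose P n := exists t, [/\ size t = n, tower a U t & forall y, y \in t -> W y].
have [||n [[t [sz tt Wt]] max]] := @ex_max P 0%N (\dim {: V}).
- by exists [::].
- by move=> n [t [<- tt _]]; apply: tower_size tt => //; [exact: sa | case: sU].
exists t; split=> // z Wz; apply: NNPP => nz.
have sUt := subsp_addspan t sU.
have [||u0 [u [x [Uu tx u0E]]] best] := prox (y := z) sa ts sUt.
- by rewrite sf => *; apply: memvf.
- by rewrite sf memvf.
have nz0 : z + u0 != 0.
  apply/eqP => z0; apply: nz; exists (- u); split; first exact: subspN.
  by move/eqP: z0; rewrite opprK u0E addrA addr_eq0 => /eqP->; rewrite rpredN.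
have : P n.+1.
  exists (z + u0 :: t); rewrite /= sz; split=> //.
    split=> // u' t' Uu' tt'; rewrite addrC -addrA; apply: best.
    by apply: (subspD sUt); [exists u, x | exists u', t'].
  move=> y; rewrite inE => /orP[/eqP->|/Wt //].
  apply: (subspD sW) => //; rewrite u0E; apply: (subspD sW); first exact: UW.
  exact: (subsp_span sW Wt tx).
by move/max; rewrite ltnn.
Qed.

End Complement.

(** * Characteristic polynomials *)

Section CharPoly.
Variables (G : divOrderedGroupType) (F : fieldType) (v : valuation G F).

Let vu := valuation_ultra v.

(* The Gauss extension of v giving 'X the value g takes a value at least t. *)
Definition gauss_ge (g : G) (p : {poly F}) (t : ext G) :=
  forall k, t <= v p`_k + Fin (g *+ k).

Lemma gauss_geD g p q t : gauss_ge g p t -> gauss_ge g q t -> gauss_ge g (p + q) t.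
Proof.
move=> hp hq k; apply: (@le_trans _ _ (Num.min (v p`_k) (v q`_k) + Fin (g *+ k))).
  by case: (leP (v p`_k)).
by rewrite coefD ext_leD // ultraD.
Qed.

Lemma gauss_geM g p q s t : gauss_ge g p s -> gauss_ge g q t -> gauss_ge g (p * q) (s + t).
Proof.
move=> hp hq k; rewrite coefM [leRHS]addrC -(Fin_leD2l (- (g *+ k))) FinNK.
apply: (ultra_le_sum vu) => i _; rewrite valuationM.
rewrite -(Fin_leD2l (g *+ k)) FinKN.
have -> : g *+ k = g *+ i + g *+ (k - i) by rewrite -mulrnDr subnKC // -ltnS.
rewrite FinD addrACA [Fin _ + _]addrC [Fin _ + v q`_ _]addrC.
exact: ext_leD (hp i) (hq _).
Qed.

Lemma gauss_ge_sum g (I : Type) (r : seq I) (P : pred I) (p : I -> {poly F}) t :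
  (forall i, P i -> gauss_ge g (p i) t) -> gauss_ge g (\sum_(i <- r | P i) p i) t.
Proof.
move=> h; elim/big_ind: _ => //; last by move=> p1 p2; apply: gauss_geD.
by move=> k; rewrite coef0 (ultra0 vu) addoox le_oo.
Qed.

Lemma gauss_ge_prod g (I : Type) (r : seq I) (p : I -> {poly F}) (d : I -> G) :
  (forall i, gauss_ge g (p i) (Fin (d i))) ->
  gauss_ge g (\prod_(i <- r) p i) (Fin (\sum_(i <- r) d i)).
Proof.
move=> h; elim: r => [|i r IH].
  rewrite !big_nil => k; rewrite coef1; case: eqP => [->|_].
    by rewrite mulr0n valuation1 ext0E addr0.
  by rewrite (ultra0 vu) addoox le_oo.
by rewrite !big_cons FinD; apply: gauss_geM.
Qed.

(** In each term of the determinant the weights d (s i) - d i cancel along the permutation s, which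
    leaves n copies of g. *)
Lemma char_poly_gauss n (M : 'M[F]_n) (d : 'I_n -> G) g :
  (forall i l, Fin (g + d l) <= v (M i l) + Fin (d i)) ->
  gauss_ge g (char_poly M) (Fin (g *+ n)).
Proof.
move=> h; apply: gauss_ge_sum => s _.
have entry i : gauss_ge g (char_poly_mx M i (s i)) (Fin (g + d (s i) - d i)).
  move=> k; rewrite !mxE coefB coefMn coefX coefC.
  case: k => [|[|k]] /=.
  - rewrite mul0rn sub0r (ultraN vu) mulr0n addr0.
    by rewrite -(Fin_leD2l (d i)) -FinD [d i + _]addrC subrK [leRHS]addrC.
  - rewrite subr0 mulr1n; case: eqP => [<-|_].
      by rewrite valuation1 addrK ext0E add0r.
    by rewrite (ultra0 vu) addoox le_oo.
  - by rewrite mul0rn subr0 (ultra0 vu) addoox le_oo.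
have -> : g *+ n = 0 + \sum_i (g + d (s i) - d i).
  rewrite add0r sumrB big_split /= sumr_const card_ord.
  by rewrite [X in _ - X](reindex_inj (@perm_inj _ s)) addrK.
rewrite FinD; apply: gauss_geM; last exact: gauss_ge_prod.
have -> : (-1) ^+ s = ((-1) ^+ s)%:P :> {poly F} by rewrite rmorph_sign.
move=> k; rewrite coefC.
case: eqP => [->|_]; last by rewrite (ultra0 vu) addoox le_oo.
by rewrite valuationX valuationN1 mulr0n ext0E mul0rn addr0.
Qed.

Lemma char_poly_coef_ge n (M : 'M[F]_n) (d : 'I_n -> G) g k :
  (forall i l, Fin (g + d l) <= v (M i l) + Fin (d i)) -> (k <= n)%N ->
  Fin (g *+ (n - k)) <= v (char_poly M)`_k.
Proof.
move=> h lekn; have := char_poly_gauss h k.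
by rewrite -{1}(subnKC lekn) mulrnDr FinD [v _ + _]addrC Fin_leD2l.
Qed.

End CharPoly.

Section CayleyHamilton.
Variables (F : fieldType) (V : vectType F) (U : V -> Prop) (T : {linear V -> V}).
Hypotheses (sU : subsp U) (TU : forall u, U u -> U (T u)).
Variables (n : nat) (y : 'I_n.+1 -> V) (M : 'M[F]_n.+1).
Hypothesis TM : forall l, U (T (y l) - \sum_i M i l *: y i).

Lemma iter_matrix_mod k l : U (iter k T (y l) - \sum_i (M ^+ k) i l *: y i).
Proof.
elim: k => [|k IH].
  rewrite (bigD1 l) //= big1 => [|i ne]; rewrite expr0 mxE ?eqxx ?scale1r.
    by rewrite addr0 subrr; case: sU.
  by rewrite (negPf ne) scale0r.
have -> : iter k.+1 T (y l) - \sum_i (M ^+ k.+1) i l *: y i =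
    T (iter k T (y l) - \sum_i (M ^+ k) i l *: y i) +
    \sum_j (M ^+ k) j l *: (T (y j) - \sum_i M i j *: y i).
  rewrite (linearB T) (linear_sum T) /= -addrA; congr (_ + _).
  under [X in - X + _]eq_bigr do rewrite linearZ /=.
  under [X in _ = _ + X]eq_bigr do rewrite scalerBr.
  rewrite sumrB addKr; congr (- _).
  under [RHS]eq_bigr do rewrite scaler_sumr.
  rewrite exchange_big /=; apply: eq_bigr => i _.
  rewrite exprS mxE scaler_suml; apply: eq_bigr => j _.
  by rewrite scalerA mulrC.
apply: (subspD sU); first exact: TU.
by apply: (subsp_sum sU) => j _; apply: (subspZ sU).
Qed.

Lemma Cayley_Hamilton_mod l :
  U (\sum_(k < n.+2) (char_poly M)`_k *: iter k T (y l)).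
Proof.
suff -> : \sum_(k < n.+2) (char_poly M)`_k *: iter k T (y l) =
    \sum_(k < n.+2) (char_poly M)`_k *: (iter k T (y l) - \sum_i (M ^+ k) i l *: y i).
  by apply: (subsp_sum sU) => k _; apply/(subspZ sU)/iter_matrix_mod.
under [RHS]eq_bigr do rewrite scalerBr.
rewrite sumrB [X in _ - X](_ : _ = 0) ?subr0 //.
under eq_bigr do rewrite scaler_sumr.
rewrite exchange_big /= big1 // => i _.
have := Cayley_Hamilton M; move/(congr1 (fun N : 'M_n.+1 => N i l)); rewrite mxE.
rewrite /horner_mx /horner_morph (@horner_coef_wide _ n.+2); last first.
  by rewrite (leq_trans (size_poly _ _)) // size_char_poly.
rewrite summxE => e.
under eq_bigr do rewrite scalerA.
rewrite -scaler_suml [X in X *: _](_ : _ = 0) ?scale0r //; apply: etrans e.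
by apply: eq_bigr => k _; rewrite coef_map /= -mulmxE mul_scalar_mx mxE.
Qed.

End CayleyHamilton.

Section Operators.
Variables (G : divOrderedGroupType) (F : fieldType) (v : valuation G F).
Variables (V : vectType F) (a : V -> ext G).
Hypothesis sa : scaled v a.
Let ua : ultra a := sa.1.
Let vu := valuation_ultra v.

Lemma scaled_fin (s : seq V) : 0 \notin s ->
  exists d : 'I_(size s) -> G, forall i : 'I_(size s), a s`_i = Fin (d i).
Proof.
move=> s0; have fin (i : 'I_(size s)) : exists g, a s`_i = Fin g.
  apply: fin_of_neq_oo; rewrite (ultra_eq_oo ua).
  by apply: contraNneq s0 => <-; apply: mem_nth.
exact: (fin_all_exists fin).
Qed.

Lemma tower_notin0 (U : V -> Prop) s : U 0 -> tower a U s -> 0 \notin s.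
Proof.
by move=> U0 /(tower_free sa U0) fs; apply/negP => /(free_not0 fs); rewrite eqxx.
Qed.

Lemma span_coord (s : seq V) x : x \in <<s>>%VS ->
  exists c : nat -> F, x = \sum_(i < size s) c i *: s`_i.
Proof.
rewrite -[s]/(val (in_tuple s)) => /coord_span e.
exists (fun i => if insub i is Some j then coord (in_tuple s) j x else 0).
by rewrite {1}e; apply: eq_bigr => i _; rewrite valK.
Qed.

Lemma char_poly_monicE n (M : 'M[F]_n) : (char_poly M)`_n = 1.
Proof. by have := monicP (char_poly_monic M); rewrite /lead_coef size_char_poly. Qed.

(* If T strictly increases values modulo U, then its characteristic polynomial on
   the complement <<s>> is congruent to a power of 'X. *)
Lemma increasing_char_poly (U : V -> Prop) (T : {linear V -> V}) (s : seq V) :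
  subsp U -> (forall u, U u -> U (T u)) -> tower a U s -> (0 < size s)%N ->
  (forall y, y \in s -> exists u, [/\ U u, T y - u \in <<s>>%VS &
     exists u', U u' /\ a y < a (T y + u')]) ->
  exists c : nat -> F, [/\ c (size s) = 1, forall k, (k < size s)%N -> Fin 0 < v (c k)
    & forall y, y \in s -> U (\sum_(k < (size s).+1) c k *: iter k T y)].
Proof.
move=> sU TU ts; case sz: (size s) => [|n] // _ hT.
have U0 : U 0 by case: sU.
have s0 := tower_notin0 U0 ts.
pose y (i : 'I_n.+1) := s`_i.
have ys i : y i \in s by rewrite mem_nth // sz.
have [d dE] : exists d : 'I_n.+1 -> G, forall i, a (y i) = Fin (d i).
  by have := scaled_fin s0; rewrite sz.
have hM (l : 'I_n.+1) : exists r : {ffun 'I_n.+1 -> F},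
    U (T (y l) - \sum_i r i *: y i) /\
    (forall i, Fin (d l) < v (r i) + Fin (d i)).
  have [u [Uu Tu [u' [Uu' lt]]]] := hT _ (ys l).
  have [c cE] := span_coord Tu; rewrite sz in cE.
  exists [ffun i : 'I_n.+1 => c i]; under eq_bigr do rewrite ffunE.
  rewrite -cE subKr; split=> // i; rewrite ffunE -!dE.
  apply: lt_le_trans lt _; rewrite [leRHS]addrC.
  have := @tower_coord _ _ v _ _ sa U s (u + u') c i sU ts (subspD sU Uu Uu').
  rewrite sz -cE [u + u']addrC -addrA [u + _]addrC subrK [u' + _]addrC.
  by apply.
have [r /all_and2[rU rlt]] := fin_all_exists hM.
pose M : 'M[F]_n.+1 := \matrix_(i, l) r l i.
have TM l : U (T (y l) - \sum_i M i l *: y i).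
  by under eq_bigr do rewrite mxE; apply: rU.
have Mlt i l : Fin (d l) < v (M i l) + Fin (d i) by rewrite mxE; apply: rlt.
have Tin z : z \in s -> exists l, z = y l.
  move=> zs; have lt : (index z s < n.+1)%N by rewrite -sz index_mem.
  by exists (Ordinal lt); rewrite /y /= nth_index.
(* For M = 0 the gap t below would be [oo]; then T maps the members of s into U, and the power of 'X
   itself serves. *)
have [M0|nM] := classic (forall p, M p.1 p.2 = 0).
  exists (fun k => (k == n.+1)%:R); rewrite eqxx; split=> // [k lt|z zs].
    by rewrite ltn_eqF // (ultra0 vu) ext_lt_oo.
  have [l ->] := Tin _ zs; rewrite big_ord_recr big1 /= => [|k _].
    rewrite eqxx scale1r add0r.
    have UT : U (T (y l)).
      have := TM l; rewrite big1 ?subr0 // => i _.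
      by rewrite (M0 (i, l)) scale0r.
    by rewrite -iterS; elim: (n) => [|m IH] //; rewrite iterS; apply: TU.
  by rewrite ltn_eqF // scale0r.
pose f p : ext G := v (M p.1 p.2) + Fin (d p.1 - d p.2).
have f0 p : Fin 0 < f p.
  rewrite ext0E -(Fin_ltD2l (d p.2)) addr0 addrCA -FinD [d _ + _]addrC subrK.
  exact: Mlt.
(* Finitely many strict inequalities leave a uniform gap t > 0, and [char_poly_coef_ge] applies with
   g = t. *)
have [t tE] : exists t, \big[Num.min/oo]_p f p = Fin t.
  apply: fin_of_neq_oo; apply/eqP => too; apply: nM => p.
  have /oo_le : oo <= f p by rewrite -too bigmin_le.
  rewrite /f; move/eqP; apply: contraTeq => nz.
  by rewrite ext_add_neq_oo valuation_neq_oo nz.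
have t0 : Fin 0 < Fin t.
  by rewrite -tE; apply/bigmin_gtP; split=> [|p _]; [apply: ext_lt_oo | apply: f0].
have tM i l : Fin (t + d l) <= v (M i l) + Fin (d i).
  have : Fin t <= f (i, l) by rewrite -tE bigmin_le.
  rewrite -(Fin_leD2l (d l)) -FinD addrC /f /= addrCA -FinD.
  by rewrite [d l + _]addrC subrK.
exists (fun k => (char_poly M)`_k); split=> [|k lt|z /Tin[l ->]].
- exact: char_poly_monicE.
- apply: lt_le_trans (char_poly_coef_ge tM (ltnW lt)).
  have -> : Fin 0 = (Fin 0 : ext G) *+ (n - k).+1 by rewrite ext0E mul0rn.
  by rewrite FinMn subSn //; apply: ext_ltMn.
- exact: Cayley_Hamilton_mod.
Qed.
End Operators.

Lemma linear_relation (F : fieldType) (V : vectType F) (s : seq V) :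
  (\dim {: V} < size s)%N -> exists c : nat -> F,
    \sum_(i < size s) c i *: s`_i = 0 /\ exists2 i, (i < size s)%N & c i != 0.
Proof.
move=> lt; have nf : ~~ free (in_tuple s).
  by apply: contraL lt => /eqP <-; rewrite -leqNgt; apply/dimvS/subvf.
have /not_all_ex_not[k hk] : ~ (forall k, \sum_(i < size s) k i *: s`_i = 0 ->
    forall i : 'I_(size s), k i = 0).
  by move=> h; move/negP: nf; apply; apply/freeP.
have [k0 /not_all_ex_not[i0 /eqP nz]] := imply_to_and _ _ hk.
exists (fun i => if insub i is Some j then k j else 0); split.
  by apply: etrans k0; apply: eq_bigr => i _; rewrite /= valK.
by exists (val i0) => //=; rewrite valK.
Qed.

(** * Idempotents of the graded ring *)

Section Independence.
Variables (G : divOrderedGroupType) (F : fieldType) (v : valuation G F).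
Variables (V : vectType F) (a : V -> ext G).
Hypothesis sa : scaled v a.
Let ua : ultra a := sa.1.

(* The leading classes of the members of s are linearly independent over gr_v(F). *)
Definition gr_free (s : seq V) := forall (c : nat -> F) (g : G),
  (forall i, (i < size s)%N -> Fin g <= a s`_i + v (c i)) ->
  Fin g < a (\sum_(i < size s) c i *: s`_i) ->
  forall i, (i < size s)%N -> Fin g < a s`_i + v (c i).

Lemma min_index (n : nat) (f : nat -> ext G) : (0 < n)%N ->
  exists i, (i < n)%N /\ forall j, (j < n)%N -> f i <= f j.
Proof.
elim: n => // [[|n]] IH _; first by exists 0%N; split=> // [[]].
have [//|i [lti mini]] := IH.
have [le|/ltW le] := leP (f i) (f n.+1).
  exists i; split=> [|j]; first exact: ltnW.
  by rewrite ltnS leq_eqVlt => /orP[/eqP->|/mini].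
exists n.+1; split=> // j.
rewrite ltnS leq_eqVlt => /orP[/eqP->|/mini] //; exact: le_trans.
Qed.

(** A linear relation over F, read at the least value g of its terms, is a nontrivial relation
    between leading classes. *)
Lemma gr_free_dim s : 0 \notin s -> gr_free s -> (size s <= \dim {: V})%N.
Proof.
move=> s0 fs; rewrite leqNgt; apply/negP => /linear_relation[c [c0 [i0 lti0 nz]]].
have pos : (0 < size s)%N by apply: leq_ltn_trans lti0.
have [i [lti mini]] := min_index (fun i => a s`_i + v (c i)) pos.
have fin : a s`_i + v (c i) != oo.
  have : a s`_i0 + v (c i0) != oo.
    rewrite ext_add_neq_oo valuation_neq_oo nz andbT (ultra_eq_oo ua).
    by apply: contraNneq s0 => <-; rewrite mem_nth.
  by apply: contraNneq => e; apply/eqP/oo_le; rewrite -e mini.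
have [g gE] := fin_of_neq_oo fin.
suff : Fin g < a s`_i + v (c i) by rewrite gE ltxx.
apply: fs => // [j ltj|]; first by rewrite -gE mini.
by rewrite c0 (ultra0 ua) ext_lt_oo.
Qed.

(** k is the first index whose term has the least value g. For s_i = x^i this is the lowest power in
    the relation between leading classes, the one that [fitting] solves for. *)
Lemma gr_dependent s : 0 \notin s -> (\dim {: V} < size s)%N ->
  exists (c : nat -> F) (g : G) k, [/\ (k < size s)%N,
    a s`_k + v (c k) = Fin g,
    forall i, (i < k)%N -> Fin g < a s`_i + v (c i),
    forall i, (i < size s)%N -> Fin g <= a s`_i + v (c i)
  & Fin g < a (\sum_(i < size s) c i *: s`_i)].
Proof.
move=> s0 lt; have : ~ gr_free s by move=> /(gr_free_dim s0); rewrite leqNgt lt.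
case/not_all_ex_not=> c /not_all_ex_not[g] h0.
have [h1 h0'] := imply_to_and _ _ h0.
have [h2 /not_all_ex_not[i h]] := imply_to_and _ _ h0'.
have [lti /negP h3] := imply_to_and _ _ h.
have ex : exists i, (i < size s)%N && ~~ (Fin g < a s`_i + v (c i)).
  by exists i; rewrite lti.
case: (ex_minnP ex) => k /andP[ltk]; rewrite -leNgt => lek mink.
exists c, g, k; split=> // [|j ltj].
  by apply/le_anti; rewrite lek h1.
rewrite ltNge; apply/negP => lej; have /mink : (j < size s)%N && ~~ (Fin g < a s`_j + v (c j)).
  by rewrite -leNgt lej (ltn_trans ltj).
by rewrite leqNgt ltj.
Qed.
End Independence.

Section Surmultiplicative.
Variables (G : divOrderedGroupType) (F : fieldType) (v : valuation G F).
Variables (A : falgType F) (a : A -> ext G).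
Hypotheses (sa : scaled v a) (surA : surmultiplicative a).
Implicit Types x y z : A.

Let ua : ultra a := sa.1.
Let aZ c x : a (c *: x) = a x + v c. Proof. exact: sa.2. Qed.

Lemma surm1 : a 1 = 0. Proof. exact: surA.1. Qed.

Lemma surmM x y s t : s <= a x -> t <= a y -> s + t <= a (x * y).
Proof. by move=> sx ty; apply: le_trans (surA.2 x y); apply: ext_leD. Qed.

Lemma surm_ltM g h x y : Fin g <= a x -> Fin h < a y -> Fin (g + h) < a (x * y).
Proof. by move=> gx hy; apply: lt_le_trans (surA.2 x y); apply: Fin_leltD. Qed.

Lemma surm_Mlt g h x y : Fin g < a x -> Fin h <= a y -> Fin (g + h) < a (x * y).
Proof. by move=> gx hy; apply: lt_le_trans (surA.2 x y); apply: Fin_ltgeD. Qed.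

Lemma surmX x g n : Fin g <= a x -> Fin (g *+ n) <= a (x ^+ n).
Proof.
move=> gx; elim: n => [|n IH]; first by rewrite expr0 surm1 mulr0n.
by rewrite exprS mulrS FinD surmM.
Qed.

Lemma surm_neq0 x g : a x = Fin g -> x != 0.
Proof. by move=> xg; rewrite -(ultra_eq_oo ua) xg. Qed.

Lemma surm_neq_oo x : x != 0 -> exists g, a x = Fin g.
Proof. by rewrite -(ultra_eq_oo ua) => /fin_of_neq_oo. Qed.

(* Fitting: a homogeneous element x of gr(A) that is not nilpotent is a unit
   modulo the annihilator of its powers; the inverse is a polynomial in x. *)
Lemma fitting x g : a x = Fin g -> (forall n, a (x ^+ n) = Fin (g *+ n)) ->
  exists y k, [/\ (0 < k)%N, GRing.comm x y, Fin (- g) <= a y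
    & Fin (g *+ k) < a (x ^+ k * (x * y) - x ^+ k)].
Proof.
move=> xg xn; pose m := (\dim {: A}).+1.
pose s := mkseq (fun i => x ^+ i) m.
have sz : size s = m by rewrite size_mkseq.
have si i : (i < m)%N -> s`_i = x ^+ i by move=> lt; rewrite nth_mkseq.
have s0 : 0 \notin s.
  apply/negP => /mapP[i _ e]; have := xn i.
  by rewrite -e (ultra0 ua).
have [|c [h [k [ltk ck lt_k ge_h sum_gt]]]] := gr_dependent sa s0; first by rewrite sz.
rewrite sz in ltk ge_h sum_gt; rewrite si // xn in ck.
have [b bE] : exists b, v (c k) = Fin b by apply: fin_of_neq_oo; move: ck; case: (v (c k)).
have nzc : c k != 0 by rewrite -(valuation_neq_oo v) bE.
have hE : h = g *+ k + b by move: ck; rewrite bE => -[].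
(* Divided by c k, the relation reads x^k = - sum_(i > k) (c i / c k) x^i in gr(A); y is what
   remains of the right side after x^(k+1) is taken out. *)
pose f i := c i / c k *: x ^+ (i - k).-1.
pose y := - \sum_(i < m | (k < i)%N) f i.
have ge_c i : (i < m)%N -> Fin (g *+ k) <= Fin (g *+ i) + v (c i / c k).
  move=> lti; have := ge_h _ lti; rewrite si // xn valuationM (valuationVE bE) => le.
  by rewrite addrA -[g *+ k](addrK b) -hE FinD ext_leD.
(* A positive exponent is wanted, so the congruence for k is multiplied by x at the end. *)
exists y, k.+1; split=> //.
- apply/commrN/commr_sum => i _; rewrite /GRing.comm /f -scalerAl -scalerAr.
  by rewrite (commrX _ (commr_refl x)).
- rewrite (ultraN ua); apply: (ultra_le_sum ua) => i ltki; rewrite aZ xn.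
  rewrite -(Fin_leD2l (g *+ k + g)) addrA -!FinD -addrA subrr addr0.
  apply: le_trans (ge_c _ (ltn_ord i)) _; rewrite -mulrSr -mulrnDr.
  by rewrite -subnS subnKC.
have key : Fin (g *+ k) < a (x ^+ k * (x * y) - x ^+ k).
  have : Fin (g *+ k) < a ((c k)^-1 *: \sum_(i < m) c i *: s`_i).
    by rewrite aZ (valuationVE bE) -[g *+ k](addrK b) -hE FinD Fin_ltgeD.
  have -> : (c k)^-1 *: (\sum_(i < m) c i *: s`_i) =
      \sum_(i < m | (i < k)%N) (c i / c k) *: x ^+ i + (x ^+ k - x ^+ k * (x * y)).
    rewrite scaler_sumr (bigID (fun i : 'I_m => (i < k)%N)) /=; congr (_ + _).
      by apply: eq_bigr => i _; rewrite si // scalerA mulrC.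
    rewrite (bigD1 (Ordinal ltk)) /= ?ltnn // si // scalerA mulVf // scale1r.
    congr (_ + _); rewrite /y mulrN mulrN opprK !mulr_sumr.
    rewrite (eq_bigl (fun i : 'I_m => (k < i)%N)) => [|i]; last first.
      by rewrite -leqNgt ltn_neqAle andbC eq_sym.
    apply: eq_bigr => i ltki; rewrite si // scalerA [_ * c i]mulrC /f.
    by rewrite -!scalerAr -exprS -exprD prednK ?subn_gt0 // subnKC // ltnW.
  move=> lt1; rewrite (ultraC ua).
  rewrite -[X in a X](addKr (\sum_(i < m | (i < k)%N) (c i / c k) *: x ^+ i)) addrC.
  apply: (ultra_ltB ua) => //; apply: (ultra_lt_sum ua) => [|i ltik]; first exact: ext_lt_oo.
  rewrite aZ xn valuationM (valuationVE bE); have := lt_k _ ltik.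
  rewrite si // xn => lt; rewrite addrA -[g *+ k](addrK b) -hE FinD.
  by apply: ext_lt_leD.
have -> : x ^+ k.+1 * (x * y) - x ^+ k.+1 = x * (x ^+ k * (x * y) - x ^+ k).
  by rewrite exprS mulrBr -mulrA.
by rewrite mulrS surm_ltM // xg.
Qed.

(** In gr(A), x^k (x y)^n = x^k for all n. As x and y commute, e = y^k x^k, so that e e - e = y^k
    (x^k e - x^k) = 0; and e != 0 because x^k e = x^k != 0. *)
Lemma fitting_idempotent x g : a x = Fin g -> (forall n, a (x ^+ n) = Fin (g *+ n)) ->
  exists y k, let e := (x * y) ^+ k in
  [/\ (0 < k)%N, GRing.comm x y & Fin (- g) <= a y] /\
  [/\ Fin (g *+ k) < a (x ^+ k * e - x ^+ k), a e = 0 & Fin 0 < a (e * e - e)].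
Proof.
move=> xg xn; have [y [k [k0 cxy yg lt]]] := fitting xg xn.
exists y, k => e; split=> //.
have h0 : Fin 0 <= a (x * y) by rewrite -(addrN g) FinD surmM // xg.
have e0 : Fin 0 <= a e by have := surmX k h0; rewrite mul0rn.
have lt_e n : Fin (g *+ k) < a (x ^+ k * (x * y) ^+ n - x ^+ k).
  elim: n => [|n IH]; first by rewrite expr0 mulr1 subrr (ultra0 ua) ext_lt_oo.
  apply: (ultra_lt_trans ua) lt; rewrite exprSr mulrA -mulrBl -[g *+ k]addr0.
  exact: surm_Mlt.
split; first exact: lt_e.
  apply/le_anti/andP; split=> //; rewrite leNgt; apply/negP => gt0.
  have : Fin (g *+ k) < a (x ^+ k).
    by rewrite -(ultra_ltE ua (lt_e k)) -[g *+ k]addr0 surm_ltM // xn.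
  by rewrite xn ltxx.
have -> : e * e - e = y ^+ k * (x ^+ k * e - x ^+ k).
  have eE : e = y ^+ k * x ^+ k.
    by rewrite /e [x * y]cxy exprMn_comm //; apply: commr_sym.
  by rewrite mulrBr mulrA -eE.
have yk : Fin (- (g *+ k)) <= a (y ^+ k) by rewrite -mulNrn surmX.
by have := surm_ltM yk (lt_e k); rewrite addNr.
Qed.

(** Multiplying a relation by s_j leaves its j-th term, up to higher values. *)
Lemma orthogonal_gr_free (s : seq A) :
  (forall i, (i < size s)%N -> a s`_i = 0 /\ Fin 0 < a (s`_i * s`_i - s`_i)) ->
  (forall i j, (i < size s)%N -> (j < size s)%N -> i != j -> Fin 0 < a (s`_i * s`_j)) ->
  gr_free v a s.
Proof.
move=> idem orth c g ge_g sum_g j ltj; have [sj0 sjj] := idem _ ltj.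
have ci i : (i < size s)%N -> Fin g <= v (c i).
  by move=> lti; have := ge_g _ lti; rewrite (idem _ lti).1 add0r.
rewrite -aZ.
have sj_ge : Fin 0 <= a s`_j by rewrite sj0.
have := surm_ltM sj_ge sum_g; rewrite add0r.
rewrite mulr_sumr (bigD1 (Ordinal ltj)) //= => lt.
have lt2 : Fin g < a (\sum_(i < size s | i != Ordinal ltj) s`_j * (c i *: s`_i)).
  apply: (ultra_lt_sum ua) => [|i ne]; first exact: ext_lt_oo.
  rewrite -scalerAr aZ -[g]add0r FinD; apply: ext_lt_leD; rewrite ?ci //.
  by apply: orth; rewrite // eq_sym.
have := ultra_ltB ua lt lt2; rewrite addrK -scalerAr; apply: etrans.
apply: (ultra_ltE ua); rewrite (ultraC ua) -scalerBr aZ -[g]add0r FinD.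
by apply: ext_lt_leD; rewrite ?ci.
Qed.

End Surmultiplicative.

Section Semiprime.
Variables (G : divOrderedGroupType) (F : fieldType) (v : valuation G F).
Variables (A : falgType F) (a : A -> ext G).
Hypotheses (sa : scaled v a) (surA : surmultiplicative a).
Implicit Types x y z : A.

Let ua : ultra a := sa.1.
Let aZ c x : a (c *: x) = a x + v c. Proof. exact: sa.2. Qed.
Let vu := valuation_ultra v.

(** On representatives: u gr(A) u != 0 for every nonzero homogeneous u of gr(A). *)
Definition gr_semiprime := forall x, x != 0 ->
  exists2 y, y != 0 & a (x * y * x) = a x + a y + a x.

(* y belongs to the right ideal of gr(A) generated by z *)
Definition in_right_ideal z y := exists t, a y <= a z + a t /\ a y < a (z * t - y).

Lemma in_right_ideal_trans x s y : a (x * s) = a x + a s -> s != 0 -> x != 0 ->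
  y != 0 -> in_right_ideal (x * s) y -> in_right_ideal x y.
Proof.
move=> xs nzs nzx nzy [t [le_t lt_t]]; exists (s * t); split; last by rewrite mulrA.
have [h hE] := surm_neq_oo sa nzx; move: le_t; rewrite xs hE -addrA => /le_trans; apply.
by apply: ext_leD => //; apply: surA.2.
Qed.

(** A relation in which the term of x has the least value can be solved for x, which would put its
    class into the right ideal of z. *)
Lemma gr_free_cons z x (l : seq A) : z != 0 -> x != 0 -> ~ in_right_ideal z x ->
  gr_free v a l -> (forall y, y \in l -> in_right_ideal z y) -> gr_free v a (x :: l).
Proof.
move=> nzz nzx notin fl inl c g ge_g.
have -> : \sum_(i < size (x :: l)) c i *: (x :: l)`_i =
    c 0%N *: x + \sum_(i < size l) c i.+1 *: l`_i by rewrite big_ord_recl.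
move=> sum_g; suff lt0 : Fin g < a x + v (c 0%N).
  case=> [|i] //; rewrite /= ltnS => lti.
  apply: (fl (fun i => c i.+1)) => // [j ltj|]; first exact: (ge_g j.+1).
  by rewrite -[X in a X](addKr (c 0%N *: x)) addrC ultra_ltB // aZ.
rewrite ltNge; apply/negP => le0; apply: notin.
have {le0} c0g : a x + v (c 0%N) = Fin g.
  by apply/le_anti/andP; split=> //; apply: (ge_g 0%N).
have [h zh] := surm_neq_oo sa nzz; have [p xp] := surm_neq_oo sa nzx.
have [b cb] : exists b, v (c 0%N) = Fin b.
  by apply: fin_of_neq_oo; move: c0g; rewrite xp; case: (v (c 0%N)).
have {c0g} gE : g = p + b by move: c0g; rewrite xp cb => -[].
have nzc : c 0%N != 0 by rewrite -(valuation_neq_oo v) cb.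
have ex_t (i : 'I_(size l)) : exists t, a l`_i <= a z + a t /\ a l`_i < a (z * t - l`_i).
  by apply: inl; apply: mem_nth.
have [t tP] := fin_all_exists ex_t.
pose q (i : 'I_(size l)) := c i.+1 / c 0%N.
have vq (i : 'I_(size l)) : Fin p <= a l`_i + v (q i).
  rewrite valuationM (valuationVE cb) addrA -[p](addrK b) -gE FinD ext_leD //.
  exact: (ge_g i.+1 (ltn_ord i)).
exists (- \sum_i q i *: t i); split.
  rewrite xp zh (ultraN ua) -(Fin_leD2l (- h)) FinNK -FinD.
  apply: (ultra_le_sum ua) => i _; rewrite aZ -(Fin_leD2l h) FinD FinKN addrA -zh.
  apply: le_trans (vq i) _; apply: ext_leD => //; exact: (tP i).1.
have -> : z * - (\sum_i q i *: t i) - x =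
    - ((c 0%N)^-1 *: (c 0%N *: x + \sum_(i < size l) c i.+1 *: l`_i))
    - \sum_i q i *: (z * t i - l`_i).
  rewrite scalerDr scalerK // scaler_sumr.
  under [X in _ = - (_ + X) - _]eq_bigr do rewrite scalerA mulrC -/(q _).
  under [X in _ = _ - X]eq_bigr do rewrite scalerBr.
  rewrite sumrB opprD mulrN mulr_sumr opprB addrA subrK addrC.
  by under eq_bigr do rewrite -scalerAr.
rewrite xp; apply: (ultra_ltB ua).
  by rewrite (ultraN ua) aZ (valuationVE cb) -[p](addrK b) -gE FinD Fin_ltgeD.
apply: (ultra_lt_sum ua) => [|i _]; first exact: ext_lt_oo.
rewrite aZ; have [->|nzq] := eqVneq (q i) 0.
  by rewrite (ultra0 vu) addoo ext_lt_oo.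
apply: le_lt_trans (vq i) _; apply: ext_lt_leD; rewrite ?valuation_neq_oo //.
exact: (tP i).2.
Qed.

Definition right_minimal y := forall s, s != 0 -> a (y * s) = a y + a s ->
  in_right_ideal (y * s) y.

(** The descending chain condition for principal right ideals: by [gr_free_cons], the generators
    along a strictly descending chain are independent, and there are at most dim A of them. *)
Lemma exists_right_minimal x : x != 0 -> exists s,
  [/\ s != 0, a (x * s) = a x + a s & right_minimal (x * s)].
Proof.
move=> nzx; apply: NNPP => nomin.
pose bad x := x != 0 /\ forall s, s != 0 -> a (x * s) = a x + a s -> ~ right_minimal (x * s).
have badx : bad x by split=> // s nzs xs m; apply: nomin; exists s.
have : exists s : seq A, [/\ size s = (\dim {: A}).+1, 0 \notin s, gr_free v a s
    & forall y, y \in s -> in_right_ideal x y].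
  elim: (_.+1) x badx {nzx nomin} => [|m IH] x [nzx nomin].
    by exists [::]; split=> // c g _ _ [].
  have /not_all_ex_not[s hs] : ~ right_minimal x.
    have := nomin 1 (oner_neq0 _); rewrite mulr1 (surm1 surA) addr0.
    by apply.
  have [nzs {hs} hs] := imply_to_and _ _ hs; have [xs notin] := imply_to_and _ _ hs.
  have nzxs : x * s != 0.
    by rewrite -(ultra_eq_oo ua) xs ext_add_neq_oo !(ultra_eq_oo ua) nzx.
  have [|l [szl l0 fl inl]] := IH (x * s); first split=> //.
    move=> t nzt xst; rewrite -mulrA; apply: nomin.
      apply: contraNneq nzt => st0; move: xst; rewrite -mulrA st0 mulr0 (ultra0 ua).
      move/esym/eqP; apply: contraTT => nzt.
      by rewrite ext_add_neq_oo !(ultra_eq_oo ua) nzxs.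
    apply/le_anti; rewrite surA.2 andbT mulrA xst xs -addrA ext_leD //.
    exact: surA.2.
  exists (x :: l); split=> /=; first by rewrite szl.
  - by rewrite inE eq_sym negb_or nzx.
  - by apply: (gr_free_cons nzxs).
  - move=> y; rewrite inE => /orP[/eqP->|ly].
      have [h xh] := surm_neq_oo sa nzx.
      by exists 1; rewrite mulr1 (surm1 surA) addr0 subrr (ultra0 ua) xh ext_lt_oo.
    apply: (in_right_ideal_trans xs) => //; last exact: inl.
    by apply: contraNneq l0 => <-.
case=> s [sz s0 fs _]; have := gr_free_dim sa s0 fs.
by rewrite sz ltnn.
Qed.

(** Brauer's lemma. Let y = x s generate a minimal principal right ideal and let y u y != 0. Then y
    lies in the right ideal of y u y, so b = y u is not nilpotent, and [fitting_idempotent] gives an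
    idempotent multiple of b. *)
Lemma exists_idempotent x g : gr_semiprime -> a x = Fin g ->
  exists q, [/\ Fin (- g) <= a q, a (x * q) = 0
    & Fin 0 < a ((x * q) * (x * q) - x * q)].
Proof.
move=> sp xg; have nzx := surm_neq0 sa xg.
have [s [nzs xs min]] := exists_right_minimal nzx.
have [h sh] := surm_neq_oo sa nzs.
have yE : a (x * s) = Fin (g + h) by rewrite xs xg sh.
have nzy := surm_neq0 sa yE; have [u nzu yuy] := sp _ nzy.
have [k uk] := surm_neq_oo sa nzu.
pose y := x * s; pose b := y * u.
have bE : a b = Fin (g + h + k).
  apply/le_anti/andP; split; last by rewrite FinD -yE -uk; apply: surA.2.
  rewrite -(Fin_leD2l (g + h)) addrC -yE; apply: le_trans (surA.2 _ _) _.
  by rewrite yuy yE uk addrC addrA.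
have uyE : a (y * (u * y)) = a y + a (u * y).
  apply/le_anti/andP; split; last exact: surA.2.
  by rewrite mulrA yuy -addrA ext_leD //; apply: surA.2.
have nzuy : u * y != 0.
  apply/eqP => uy0; move: yuy; rewrite -/y -mulrA uy0 mulr0 (ultra0 ua) yE uk.
  by [].
have [t []] := min _ nzuy uyE; rewrite -/y mulrA yuy yE uk => let_ ltt.
have {let_} tE : Fin (- (g + h + k)) <= a t.
  rewrite -(Fin_leD2l (g + h + k + (g + h))) -FinD [X in Fin X]addrAC subrr add0r.
  by move: let_; rewrite -!FinD.
(* From y = b y t in gr(A) it follows that y = b^n y t^n, hence b^n != 0. *)
have iter_t n : Fin (g + h) < a (b ^+ n * y * t ^+ n - y).
  elim: n => [|n IH]; first by rewrite !expr0 mul1r mulr1 subrr (ultra0 ua) ext_lt_oo.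
  have -> : b ^+ n.+1 * y * t ^+ n.+1 - y =
      b ^+ n * (b * y * t - y) * t ^+ n + (b ^+ n * y * t ^+ n - y).
    rewrite addrA mulrBr mulrBl subrK exprSr exprS.
    by rewrite !mulrA.
  apply: (ultra_ltD ua) => //; rewrite -[g + h](addrK ((g + h + k) *+ n)) -mulNrn.
  apply: (surm_Mlt surA); last exact: surmX.
  rewrite addrC; apply: (surm_ltM surA) => //; apply: (surmX surA); by rewrite bE.
have bX n : a (b ^+ n) = Fin ((g + h + k) *+ n).
  apply/le_anti/andP; split; last by apply: surmX; rewrite // bE.
  rewrite leNgt; apply/negP => lt.
  suff : Fin (g + h) < a y by rewrite yE ltxx.
  rewrite -(ultra_ltE ua (iter_t n)) -[g + h](addrK ((g + h + k) *+ n)) -mulNrn.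
  apply: (surm_Mlt surA); last exact: surmX.
  by rewrite addrC; apply: (surm_Mlt surA) => //; rewrite yE.
(* The exponent being positive, the idempotent (b y')^(m+1) has b, and so x, as a left factor. *)
have [y' [[|m] [[m_gt0 _ y'E] [_]]]] := fitting_idempotent sa surA bE bX; first by [].
set e := _ ^+ _ => e0 ee.
have eE : e = x * (s * (u * (y' * (b * y') ^+ m))).
  by rewrite /e exprS /b /y !mulrA.
exists (s * (u * (y' * (b * y') ^+ m))); rewrite -eE; split=> //.
have by0 : Fin 0 <= a ((b * y') ^+ m).
  rewrite -[0](mul0rn _ m); apply: surmX => //.
  by rewrite -(addrN (g + h + k)) FinD; apply: (surmM surA); rewrite ?bE.
have -> : - g = h + (k + (- (g + h + k) + 0)).
  by rewrite addr0 [k + _]addrC opprD subrK opprD addrC subrK.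
by do 3!(rewrite FinD; apply: (surmM surA); rewrite ?sh ?uk //).
Qed.

End Semiprime.

(** * Orthogonal idempotents in a ring *)

Section OrthogonalIdempotents.
Variable R : pzRingType.
Implicit Types x y f g : R.

Definition orthogonal_idempotents n (e : 'I_n -> R) :=
  (forall i, e i != 0) /\ forall i j, e i * e j = if i == j then e i else 0.

(** The substitute for the finite dimension of gr(A)_0 over the residue field; [deg0_bounded]
    provides it with N = dim A. *)
Definition bounded_idempotents N :=
  forall n (e : 'I_n -> R), orthogonal_idempotents e -> (n <= N)%N.

Definition central x := forall y, x * y = y * x.

Definition add_ord n T (x : T) (e : 'I_n -> T) (i : 'I_n.+1) : T :=
  if unlift ord0 i is Some j then e j else x.

Lemma add_ord0 n T (x : T) (e : 'I_n -> T) : add_ord x e ord0 = x.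
Proof. by rewrite /add_ord unlift_none. Qed.

Lemma add_ord_lift n T (x : T) (e : 'I_n -> T) i : add_ord x e (lift ord0 i) = e i.
Proof. by rewrite /add_ord liftK. Qed.

Lemma orthogonal_add n (e : 'I_n -> R) g : orthogonal_idempotents e -> g != 0 ->
  g * g = g -> (forall i, g * e i = 0) -> (forall i, e i * g = 0) ->
  orthogonal_idempotents (add_ord g e).
Proof.
move=> [nze ee] nzg gg ge eg; split=> [i|i j].
  by case: (unliftP ord0 i) => [i'|] ->; rewrite ?add_ord_lift ?add_ord0.
case: (unliftP ord0 i) => [i'|] ->; case: (unliftP ord0 j) => [j'|] ->;
  rewrite ?add_ord_lift ?add_ord0 ?eqxx ?(inj_eq lift_inj) ?ee ?ge ?eg ?gg //.
Qed.

Lemma sum_orthogonal n (e : 'I_n -> R) i : orthogonal_idempotents e ->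
  e i * (\sum_j e j) = e i /\ (\sum_j e j) * e i = e i.
Proof.
move=> [_ ee]; rewrite mulr_sumr mulr_suml; split; rewrite (bigD1 i) //= ee eqxx.
  by rewrite big1 ?addr0 // => j ne; rewrite ee eq_sym (negPf ne).
by rewrite big1 ?addr0 // => j ne; rewrite ee (negPf ne).
Qed.

(** The sum s of a longest orthogonal family in J serves. Otherwise some x - s x has an idempotent
    multiple f; then s f = 0, and f - f s prolongs the family. *)
Lemma left_identity N (J : R -> Prop) : bounded_idempotents N ->
  J 0 -> (forall x y, J x -> J y -> J (x + y)) -> (forall x y, J x -> J (x * y)) ->
  (forall x, J x -> x != 0 -> exists q, x * q != 0 /\ (x * q) * (x * q) = x * q) ->
  exists e, [/\ J e, e * e = e & forall x, J x -> e * x = x].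
Proof.
move=> bN J0 JD JM idem.
pose P n := exists e : 'I_n -> R, orthogonal_idempotents e /\ forall i, J (e i).
have [||n [[e [oe Je]] max]] := @ex_max P 0%N N.
- by exists (fun=> 0); split=> [|[]] //; split=> [[]|[]].
- by move=> n [e [/bN]].
pose s := \sum_j e j; have es i : e i * s = e i by case: (sum_orthogonal i oe).
have se i : s * e i = e i by case: (sum_orthogonal i oe).
have ss : s * s = s by rewrite {1 3}/s mulr_suml; apply: eq_bigr => i _; apply: es.
have Js : J s by rewrite /s; elim/big_ind: _.
exists s; split=> // x Jx; apply/eqP; rewrite eq_sym -subr_eq0; apply: contraT => nz.
have Jy : J (x - s * x) by apply: JD => //; rewrite -mulrN; apply: JM.
have [q [nzf ff]] := idem _ Jy nz; set f := _ * q in nzf ff.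
have sf : s * f = 0 by rewrite /f mulrA mulrBr mulrA ss subrr mul0r.
have Jf : J f by apply: JM.
move: f nzf ff sf Jf => f nzf ff sf Jf.
have : P n.+1.
  exists (add_ord (f - f * s) e); split; last first.
    move=> i; case: (unliftP ord0 i) => [i'|] ->; rewrite ?add_ord_lift ?add_ord0 //.
    by apply: JD => //; rewrite -mulrN; apply: JM.
  have efo i : e i * f = 0 by rewrite -(es i) -mulrA sf mulr0.
  apply: orthogonal_add => //.
  - apply: contraNneq nzf => g0; rewrite -ff -[f in X in X * _](subrK (f * s)) g0 add0r.
    by rewrite -mulrA sf mulr0.
  - by rewrite mulrBl !mulrBr -!mulrA [s * (f * s)]mulrA sf mul0r !mulr0 !subr0 mulrA ff.
  - by move=> i; rewrite mulrBl -mulrA se subrr.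
  - by move=> i; rewrite mulrBr mulrA efo mul0r subrr.
by move/max; rewrite ltnn.
Qed.

(** A longest decomposition of 1: a central idempotent f cutting some e i properly would refine it
    into f e i and e i - f e i. *)
Lemma primitive_idempotents N : bounded_idempotents N -> (1 : R) != 0 ->
  exists n (e : 'I_n -> R), [/\ orthogonal_idempotents e, forall i, central (e i),
    \sum_i e i = 1
  & forall f, central f -> f * f = f -> forall i, f * e i = 0 \/ f * e i = e i].
Proof.
move=> bN nz1.
pose P n := exists e : 'I_n -> R,
  [/\ orthogonal_idempotents e, forall i, central (e i) & \sum_i e i = 1].
have [||n [[e [oe ce e1]] max]] := @ex_max P 1%N N.
- exists (fun=> 1); rewrite big_ord1; split=> //.
    by split=> // i j; rewrite !ord1 eqxx mulr1.
  by move=> _ y; rewrite mul1r mulr1.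
- by move=> n [e [/bN]].
exists n, e; split=> // f cf ff i0; apply: NNPP => /not_or_and[/eqP n0 n1].
have nz2 : e i0 - f * e i0 != 0 by rewrite subr_eq0; apply/eqP => /esym.
have [nze ee] := oe.
pose e' i := if i == i0 then f * e i0 else e i.
have ce' i : central (e' i).
  by rewrite /e'; case: eqP => // _ y; rewrite -mulrA ce mulrA cf -mulrA.
have e'e' i j : e' i * e' j = if i == j then e' i else 0.
  rewrite /e'; case: (eqVneq i i0) => [ii|nei]; case: (eqVneq j i0) => [jj|nej].
  - by rewrite ii jj eqxx -mulrA [e i0 * _]mulrA -cf -mulrA ee eqxx mulrA ff.
  - by rewrite ii [i0 == j]eq_sym (negPf nej) -mulrA ee eq_sym (negPf nej) mulr0.
  - by rewrite jj (negPf nei) mulrA -cf -mulrA ee (negPf nei) mulr0.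
  - exact: ee.
have ge' i : (e i0 - f * e i0) * e' i = 0.
  rewrite /e'; case: (eqVneq i i0) => [_|nei].
    by rewrite mulrBl -!mulrA [e i0 * _]mulrA -cf -mulrA ee eqxx !mulrA ff subrr.
  by rewrite mulrBl -mulrA ee eq_sym (negPf nei) mulr0 subrr.
have : P n.+1.
  exists (add_ord (e i0 - f * e i0) e'); split.
  - apply: orthogonal_add => //.
    + by split=> [i|]; [rewrite /e'; case: (i == i0) | exact: e'e'].
    + rewrite mulrBl !mulrBr -!mulrA [e i0 * (f * _)]mulrA -cf -!mulrA !ee eqxx.
      by rewrite ![f * (f * _)]mulrA ff subrr subr0.
    + by move=> i; rewrite ce' ge'.
  - move=> i; case: (unliftP ord0 i) => [i'|] ->; rewrite ?add_ord_lift ?add_ord0 //.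
    move=> y; rewrite mulrBl mulrBr; congr (_ - _); first exact: ce.
    by rewrite -mulrA ce mulrA -cf mulrA.
  - rewrite big_ord_recl add_ord0; under eq_bigr do rewrite add_ord_lift.
    rewrite -e1 (bigD1 i0) //= [RHS](bigD1 i0) //= {1}/e' eqxx addrA subrK.
    by congr (_ + _); apply: eq_bigr => i ne; rewrite /e' (negPf ne).
by move/max; rewrite ltnn.
Qed.

End OrthogonalIdempotents.

(** * Leading classes and the degree-zero ring *)

Section LeadingClasses.
Variables (G : divOrderedGroupType) (B : nzRingType) (beta : filtration G B).
Implicit Types (x y : B) (g h : G).

(* The class of x in degree g; the junk value is 0 when beta x < g. *)
Definition cls g x : gr beta g := if insub x is Some y then gr_class y else 0.

Lemma clsE g x (gx : x \in fil_ge_pred beta g) : cls g x = gr_class (FilGe gx).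
Proof. by rewrite /cls insubT. Qed.

Lemma cls_eq g x y : Fin g <= beta x -> Fin g <= beta y ->
  (cls g x == cls g y) = (Fin g < beta (x - y)).
Proof. by move=> gx gy; rewrite !clsE gr_class_eq. Qed.

Lemma cls0 g : cls g 0 = 0.
Proof.
have g0 : 0 \in fil_ge_pred beta g by rewrite unfold_in /fil_ge_pred filtration0 le_oo.
rewrite clsE -[RHS](raddf0 (@gr_class _ _ beta g)); congr gr_class; exact: val_inj.
Qed.

Lemma cls_eq0 g x : Fin g <= beta x -> (cls g x == 0) = (Fin g < beta x).
Proof. by move=> gx; rewrite -(cls0 g) cls_eq ?subr0 // filtration0 le_oo. Qed.

Lemma cls_lt g x : Fin g < beta x -> cls g x = 0.
Proof. by move=> gx; apply/eqP; rewrite cls_eq0 // ltW. Qed.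

Lemma clsB g x y : Fin g <= beta x -> Fin g <= beta y ->
  cls g (x - y) = cls g x - cls g y.
Proof.
move=> gx gy; have gxy : Fin g <= beta (x - y).
  by apply: le_trans (filtrationD _ _ _); rewrite filtrationN le_min gx.
rewrite !clsE; rewrite -[RHS](raddfB (@gr_class _ _ beta g)).
by congr gr_class; apply: val_inj.
Qed.

Lemma clsN g x : Fin g <= beta x -> cls g (- x) = - cls g x.
Proof.
move=> gx; have g0 : Fin g <= beta 0 by rewrite filtration0 le_oo.
by rewrite -[- x]sub0r clsB // cls0 sub0r.
Qed.

Lemma clsD g x y : Fin g <= beta x -> Fin g <= beta y ->
  cls g (x + y) = cls g x + cls g y.
Proof.
move=> gx gy; have gNy : Fin g <= beta (- y) by rewrite filtrationN.
by rewrite -[y in x + y]opprK clsB // clsN // opprK.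
Qed.

Lemma cls_sum g (I : finType) (f : I -> B) : (forall i, Fin g <= beta (f i)) ->
  cls g (\sum_i f i) = \sum_i cls g (f i).
Proof.
move=> gf.
suff : Fin g <= beta (\sum_i f i) /\ cls g (\sum_i f i) = \sum_i cls g (f i) by case.
elim/big_rec2: _ => [|i u x _ [gx <-]]; first by rewrite cls0 filtration0 le_oo.
rewrite clsD //; split=> //.
by apply: le_trans (filtrationD _ _ _); rewrite le_min gf.
Qed.

Lemma cls_mul g h k (e : g + h = k) x y : Fin g <= beta x -> Fin h <= beta y ->
  gmul (gr beta) e (cls g x) (cls h y) = cls k (x * y).
Proof.
move=> gx hy; have kxy : Fin k <= beta (x * y).
  by rewrite -e FinD; apply: le_trans (filtrationM _ _ _); apply: ext_leD.
rewrite !clsE; apply: etrans (gr_mul_class _ _ _) _.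
by congr gr_class; apply: val_inj.
Qed.

Lemma cls1 : cls 0 1 = gone (gr beta).
Proof.
have g1 : Fin 0 <= beta 1 by rewrite filtration1.
by rewrite clsE; congr gr_class; apply: val_inj.
Qed.

Lemma cls_ex g (u : gr beta g) : exists2 x, Fin g <= beta x & u = cls g x.
Proof.
exists (val (gr_repr u)); first exact: (valP (gr_repr u)).
rewrite (clsE (valP (gr_repr u))) -[LHS]gr_reprK; congr gr_class; exact: val_inj.
Qed.

Lemma cls_deg0_mul x y : Fin 0 <= beta x -> Fin 0 <= beta y ->
  (cls 0 x : deg0 (gr beta)) * (cls 0 y : deg0 (gr beta)) = cls 0 (x * y).
Proof. exact: cls_mul. Qed.

Lemma cls_deg0_1 : (cls 0 1 : deg0 (gr beta)) = 1.
Proof. exact: cls1. Qed.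

Lemma deg0_nz1 : (1 : deg0 (gr beta)) != 0.
Proof. by rewrite -cls_deg0_1 cls_eq0 filtration1 ?ltxx. Qed.

End LeadingClasses.

Section LeadingClassesAlgebra.
Variables (G : divOrderedGroupType) (F : fieldType) (v : valuation G F).
Variables (A : falgType F) (a : A -> ext G).
Hypotheses (valA : value_function v a) (surA : surmultiplicative a).

Let fil := surm_filtration valA surA.
Let sa : scaled v a := (value_function_scaled v a).1 valA.
Let ua : ultra a := sa.1.

Let M0 x y : Fin 0 <= a x -> Fin 0 <= a y -> Fin 0 <= a (x * y).
Proof. by move=> x0 y0; have := surmM surA x0 y0; rewrite -FinD addr0. Qed.

Lemma deg0_bounded : bounded_idempotents (deg0 (gr fil)) (\dim {: A}).
Proof.
move=> n e [nze ee]; have ex i : exists x, Fin 0 <= a x /\ e i = cls fil 0 x.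
  by have [x x0 eE] := cls_ex (e i : gr fil 0); exists x.
have [x /all_and2[x0 eE]] := fin_all_exists ex.
pose s := [seq x i | i <- enum 'I_n].
have sz : size s = n by rewrite size_map size_enum_ord.
have si (i : 'I_n) : s`_i = x i.
  by rewrite (nth_map i) ?size_enum_ord // nth_ord_enum.
have nx0 i : ~~ (Fin 0 < a (x i)) by rewrite -(cls_eq0 (beta := fil)) // -eE.
have ax i : a (x i) = 0 by apply/le_anti; rewrite x0 leNgt nx0.
have xx i j : i != j -> Fin 0 < a (x i * x j).
  move=> ne; rewrite -(cls_eq0 (beta := fil)).
    by rewrite -cls_deg0_mul // -!eE ee (negPf ne).
  by exact: M0.
rewrite -sz; apply: (gr_free_dim sa).
  apply/negP => /mapP[i _ x00]; have := nx0 i.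
  by rewrite -x00 (ultra0 ua) ext_lt_oo.
apply: orthogonal_gr_free => // [i|i j]; rewrite sz => lti.
  rewrite -[i]/(val (Ordinal lti)) si; split=> //.
  rewrite -[_ < _](cls_eq (beta := fil)) //.
    by rewrite -cls_deg0_mul // -!eE ee eqxx.
  by exact: M0.
move=> ltj; rewrite -[i]/(val (Ordinal lti)) -[j]/(val (Ordinal ltj)) !si => ne.
by apply: xx.
Qed.

Lemma deg0_idempotent : gr_semiprime a ->
  forall g h (e : g + h = 0) (u : gr fil g), u != 0 ->
  exists t : gr fil h, let f : deg0 (gr fil) := gmul (gr fil) e u t in
  f != 0 /\ f * f = f.
Proof.
move=> sp g h e u; have [x gx ->] := cls_ex u; rewrite cls_eq0 // => ngt.
have xg : a x = Fin g by apply/le_anti; rewrite gx leNgt ngt.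
have [q [qg xq idem]] := exists_idempotent sa surA sp xg.
have {}qg : Fin h <= a q by move/eqP: e; rewrite addr_eq0 => /eqP gE; rewrite gE opprK in qg.
have xq0 : a (x * q) = Fin 0 := xq.
exists (cls fil h q) => f.
have fE : f = cls fil 0 (x * q) by apply: cls_mul.
rewrite fE; split; first by rewrite cls_eq0 /= ?xq0 ?ltxx.
rewrite cls_deg0_mul /= ?xq0 //; apply/eqP; rewrite cls_eq //= ?xq0 //.
by apply: M0; rewrite xq0.
Qed.

End LeadingClassesAlgebra.

(* The classes of the eps i are orthogonal idempotents with sum 1 in gr_a(K), and
   each gr_a(K) eps_i is a graded field. *)
Definition lifted_idempotents (G : divOrderedGroupType) (K : fieldType)
    (a : K -> ext G) n (eps : 'I_n -> K) :=
  [/\ forall i, a (eps i) = 0, forall i, Fin 0 < a (eps i * eps i - eps i),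
      forall i j, i != j -> Fin 0 < a (eps i * eps j),
      Fin 0 < a (1 - \sum_i eps i)
    & forall x g i, a x = Fin g -> a (x * eps i) = Fin g ->
        exists y, Fin (- g) <= a y /\ Fin 0 < a (x * y - eps i)].

(** * Lifting the primitive idempotents of the graded ring of the center *)

Section PowerMultiplicative.
Variables (G : divOrderedGroupType) (F : fieldType) (v : valuation G F).
Variables (K : fieldExtType F) (a : K -> ext G).
Hypotheses (valK : value_function v a) (surK : surmultiplicative a).
Hypothesis a_sqr : forall x, a (x * x) = a x + a x.
Implicit Types x y z d : K.

Let sa : scaled v a := (value_function_scaled v a).1 valK.
Let ua : ultra a := sa.1.
Let fil := surm_filtration valK surK.

Let ltM g h k x y : Fin g <= a x -> Fin h < a y -> g + h = k -> Fin k < a (x * y).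
Proof. by move=> ? ? <-; apply: surm_ltM. Qed.

Let leM g h k x y : Fin g <= a x -> Fin h <= a y -> g + h = k -> Fin k <= a (x * y).
Proof. by move=> ? ? <-; rewrite FinD; apply: surmM. Qed.

(** Equality holds for the exponent 2^n, by repeated squaring. It passes to n, because the factors
    x^n and x^(2^n - n) both have at least the expected value. *)
Lemma power_multiplicative x n : a (x ^+ n) = a x *+ n.
Proof.
have pow2 k : a (x ^+ (2 ^ k)) = a x *+ (2 ^ k).
  elim: k => [|k IH]; first by rewrite expn0 expr1 mulr1n.
  by rewrite expnS mul2n -addnn exprD a_sqr IH mulrnDr.
have geX m : a x *+ m <= a (x ^+ m).
  elim: m => [|m IH]; first by rewrite expr0 (surm1 surK) mulr0n.
  by rewrite exprS mulrS; apply: surmM.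
apply/le_anti; rewrite geX andbT.
have [->|nzx] := eqVneq x 0.
  by case: n => [|n]; rewrite ?expr0 ?mulr0n ?(surm1 surK) // (ultra0 ua) mulrS addoox le_oo.
have [g xg] := surm_neq_oo sa nzx.
have lt := ltn_expl n (isT : (1 < 2)%N).
have := pow2 n; rewrite -(subnKC (ltnW lt)) exprD mulrnDr => e.
have : a (x ^+ n) + a x *+ (2 ^ n - n) <= a x *+ n + a x *+ (2 ^ n - n).
  by rewrite -e; apply: (surmM surK).
by rewrite addrC [leRHS]addrC xg -FinMn Fin_leD2l.
Qed.

(** For the inverses: z = x eps_i has no nilpotent class, so there is an idempotent class f with z^k
    f = z^k. By primitivity f eps_i is 0 or eps_i, and 0 would give z^k = z^k eps_i f = 0. *)
Lemma lift_idempotents : exists n (eps : 'I_n -> K), lifted_idempotents a eps.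
Proof.
have bN : bounded_idempotents (deg0 (gr fil)) _ := @deg0_bounded _ _ _ _ _ valK surK.
have comm (x y : deg0 (gr fil)) : x * y = y * x.
  have [x' x0 ->] := cls_ex (x : gr fil 0); have [y' y0 ->] := cls_ex (y : gr fil 0).
  by rewrite !cls_deg0_mul // mulrC.
have [n [e [[nze ee] _ e1 prim]]] := primitive_idempotents bN (deg0_nz1 fil).
have ex i : exists x, Fin 0 <= a x /\ e i = cls fil 0 x.
  by have [x x0 eE] := cls_ex (e i : gr fil 0); exists x.
have [eps /all_and2[eps0 eE]] := fin_all_exists ex.
have a0 i : a (eps i) = 0.
  by apply/le_anti; rewrite eps0 leNgt -(cls_eq0 (beta := fil)) // -eE nze.
have clsM0 x y : Fin 0 <= a x -> Fin 0 <= a y -> Fin 0 <= a (x * y).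
  by move=> x0 y0; apply: (leM x0 y0); rewrite addr0.
have idem i : Fin 0 < a (eps i * eps i - eps i).
  rewrite -[_ < _](cls_eq (beta := fil)) ?clsM0 ?eps0 //.
  by rewrite -cls_deg0_mul // -!eE ee eqxx.
exists n, eps; split=> //.
- move=> i j ne; rewrite -[_ < _](cls_eq0 (beta := fil)) ?clsM0 ?eps0 //.
  by rewrite -cls_deg0_mul // -!eE ee (negPf ne).
- rewrite -[_ < _](cls_eq (beta := fil)) /=; first 1 last.
  + by rewrite (surm1 surK).
  + by apply: (ultra_le_sum ua) => i _; apply: eps0.
  rewrite cls_sum // -[X in X == _]/(cls fil 0 1 : deg0 (gr fil)) cls_deg0_1 -e1.
  by under eq_bigr do rewrite eE.
move=> x g i xg xeg; set z := x * eps i in xeg.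
have zX m : a (z ^+ m) = Fin (g *+ m) by rewrite power_multiplicative xeg FinMn.
have [y [k [[k0 _ yg]]]] := fitting_idempotent sa surK xeg zX.
set f := (z * y) ^+ k => -[zf f0 ff].
have f_ge0 : Fin 0 <= a f by rewrite f0.
have [||fe0|fe1] := prim (cls fil 0 f) _ _ i.
- by move=> u; apply: comm.
- rewrite cls_deg0_mul //; apply/eqP; rewrite cls_eq //; exact: clsM0.
- have {fe0} fe0 : Fin 0 < a (f * eps i).
    by rewrite -[_ < _](cls_eq0 (beta := fil)) ?clsM0 // -cls_deg0_mul // -eE fe0.
  have zk : Fin (g *+ k) < a (z ^+ k * eps i - z ^+ k).
    have -> : z ^+ k * eps i - z ^+ k = x ^+ k * eps i ^+ k.-1 * (eps i * eps i - eps i).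
      rewrite /z exprMn; case: (k) k0 => // m _ /=; rewrite !exprS.
      by move: (x ^+ m) (eps i ^+ m) => p q; ring.
    apply: (@ltM (g *+ k) 0); rewrite ?addr0 //; apply: (@leM (g *+ k) 0); rewrite ?addr0 //.
      by rewrite power_multiplicative xg FinMn.
    by rewrite power_multiplicative a0 mul0rn.
  suff : Fin (g *+ k) < a (z ^+ k) by rewrite zX ltxx.
  have -> : z ^+ k = z ^+ k * (f * eps i) - f * (z ^+ k * eps i - z ^+ k)
      - (z ^+ k * f - z ^+ k) by ring.
  apply: (ultra_ltB ua) => //; apply: (ultra_ltB ua).
    by apply: (ltM _ fe0); rewrite ?addr0 // zX.
  by apply: (ltM f_ge0 zk); rewrite add0r.
- have {}fe1 : Fin 0 < a (f * eps i - eps i).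
    by rewrite -[_ < _](cls_eq (beta := fil)) ?clsM0 // -cls_deg0_mul // -eE fe1 eE.
  (* What is left of f eps_i, with f = (x eps_i y)^k, once a factor x is removed. *)
  exists (eps i * y * (z * y) ^+ k.-1 * eps i); split; last first.
    have -> : x * (eps i * y * (z * y) ^+ k.-1 * eps i) = f * eps i; last by [].
    rewrite /f; case: (k) k0 => // m _ /=; rewrite exprS /z.
    by move: ((x * eps i * y) ^+ m) => p; ring.
  have zy0 : Fin 0 <= a (z * y) by apply: (leM _ yg (addrN g)); rewrite xeg.
  apply: (leM _ (eps0 i) (addr0 _)); apply: (leM _ _ (addr0 _)).
    by apply: (leM (eps0 i) yg); rewrite add0r.
  by have := surmX surK k.-1 zy0; rewrite mul0rn.
Qed.

End PowerMultiplicative.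

(** * Localization *)

Section Modules.
Variables (G : divOrderedGroupType) (K : fieldType) (a : K -> ext G).
Hypotheses (ua : ultra a) (a1 : a 1 = 0) (aM : forall x y, a x + a y <= a (x * y)).
Variables (n : nat) (eps : 'I_n -> K).
Hypothesis lift_eps : lifted_idempotents a eps.
Implicit Types (x y d : K) (i : 'I_n).

Let eps0 i : a (eps i) = 0. Proof. by case: lift_eps. Qed.
Let epsI i : Fin 0 < a (eps i * eps i - eps i). Proof. by case: lift_eps. Qed.
Let eps_sum : Fin 0 < a (1 - \sum_i eps i). Proof. by case: lift_eps. Qed.
Let eps_inv x g i : a x = Fin g -> a (x * eps i) = Fin g ->
  exists y, Fin (- g) <= a y /\ Fin 0 < a (x * y - eps i).
Proof. by case: lift_eps => _ _ _ _; apply. Qed.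

(* The complement in {a >= 0} of the maximal ideal attached to eps_i. *)
Definition loc_unit i d := (a d == 0) && (a (eps i * d) == 0).

Section Module.
Variables (V : lmodType K) (m : V -> ext G).
Hypotheses (um : ultra m) (mZ : forall x u, a x + m u <= m (x *: u)).
Implicit Types u w : V.

(* The class of u has a nonzero component in the i-th factor. *)
Definition good i u := (u != 0) && (m (eps i *: u) == m u).

Let ltZ g h k x u : Fin g <= a x -> Fin h < m u -> g + h = k -> Fin k < m (x *: u).
Proof. by move=> gx hu <-; apply: lt_le_trans (mZ _ _); apply: Fin_leltD. Qed.

Let Zlt g h k x u : Fin g < a x -> Fin h <= m u -> g + h = k -> Fin k < m (x *: u).
Proof. by move=> gx hu <-; apply: lt_le_trans (mZ _ _); apply: Fin_ltgeD. Qed.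

Lemma eps_ge i u : m u <= m (eps i *: u).
Proof. by have := mZ (eps i) u; rewrite eps0 add0r. Qed.

Lemma goodPn i u h : m u = Fin h -> ~~ good i u -> Fin h < m (eps i *: u).
Proof.
move=> uh; rewrite negb_and negbK -(ultra_eq_oo um) uh /= => ne.
by rewrite lt_def ne -uh eps_ge.
Qed.

Lemma good_fin i u : good i u -> exists h, m u = Fin h.
Proof. by case/andP=> nz _; apply: fin_of_neq_oo; rewrite (ultra_eq_oo um). Qed.

(** The class of x is invertible in the i-th component: were the value of eps_i x u too large,
    multiplication by the inverse would make that of eps_i u too large. *)
Lemma good_mul i x u : a x != oo -> a (eps i * x) = a x -> good i u ->
  m (x *: u) = a x + m u /\ good i (x *: u).
Proof.
case/fin_of_neq_oo=> g xg exg gu; have [h uh] := good_fin gu.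
have /andP[_ /eqP eu] := gu; rewrite xg in exg.
have [y [yg xy]] := eps_inv xg (etrans (congr1 a (mulrC _ _)) exg).
have nlt : ~~ (Fin (g + h) < m (eps i *: (x *: u))).
  apply/negP => lt; have := ltZ yg lt erefl; rewrite addKr => lt2.
  suff : Fin h < m (eps i *: u) by rewrite eu uh ltxx.
  have -> : eps i *: u = y *: (eps i *: (x *: u)) -
      ((eps i * (x * y - eps i)) *: u + (eps i * eps i - eps i) *: u).
    by rewrite !scalerA -scalerDl -scalerBl; congr (_ *: _); ring.
  apply: (ultra_ltB um) => //; apply: (ultra_ltD um).
    rewrite -scalerA; apply: (ltZ (g := 0)); rewrite ?eps0 //; last by rewrite add0r.
    by apply: (Zlt xy); rewrite ?add0r // uh.
  by apply: (Zlt (epsI i)); rewrite ?add0r // uh.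
have le1 : Fin (g + h) <= m (x *: u) by rewrite FinD -xg -uh mZ.
have le2 := eps_ge i (x *: u).
have e2 : m (eps i *: (x *: u)) = Fin (g + h).
  by apply/le_anti; rewrite leNgt nlt (le_trans le1).
have e1 : m (x *: u) = Fin (g + h) by apply/le_anti; rewrite le1 -e2 le2.
by rewrite e1 xg uh /good e1 e2 eqxx -(ultra_eq_oo um) e1.
Qed.

Lemma loc_unit_mul i d u : loc_unit i d -> good i u ->
  m (d *: u) = m u /\ good i (d *: u).
Proof.
case/andP=> /eqP d0 /eqP ed gu.
have [||-> ->] := good_mul (x := d) _ _ gu; rewrite ?d0 ?ed //.
by rewrite add0r.
Qed.

Lemma exists_good u : u != 0 -> exists i, good i u.
Proof.
move=> nzu; apply: NNPP => nex; have := ultra_eq_oo um u; rewrite (negPf nzu).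
move/negbT/fin_of_neq_oo => [h uh].
suff : Fin h < m u by rewrite uh ltxx.
have -> : u = (1 - \sum_i eps i) *: u + \sum_i eps i *: u.
  by rewrite -scaler_suml -scalerDl subrK scale1r.
apply: (ultra_ltD um); first by apply: (Zlt eps_sum); rewrite ?add0r // uh.
apply: (ultra_lt_sum um) => [|i _]; first exact: ext_lt_oo.
by apply: goodPn => //; apply/negP => gu; apply: nex; exists i.
Qed.

End Module.

Lemma loc_unit_good i d : loc_unit i d = (a d == 0) && good (a : K^o -> _) i d.
Proof.
rewrite /loc_unit /good; case: eqP => //= d0.
by rewrite -(ultra_eq_oo ua) d0.
Qed.

Let aZ x (y : K^o) : a x + a y <= a (x *: y). Proof. exact: aM. Qed.

Lemma loc_unitM i d d' : loc_unit i d -> loc_unit i d' -> loc_unit i (d * d').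
Proof.
move=> ud; rewrite !loc_unit_good => /andP[/eqP d'0 gd'].
have [||e g] := @loc_unit_mul K^o a _ _ i d d' ud gd'; [exact: ua | exact: aZ |].
by rewrite -/(d *: (d' : K^o)) e d'0 eqxx.
Qed.

Lemma loc_unit1 i : loc_unit i 1. Proof. by rewrite /loc_unit a1 mulr1 eps0 eqxx. Qed.

Lemma loc_unit_eps i : loc_unit i (eps i).
Proof.
rewrite /loc_unit eps0 eqxx /= (ultra_eqB ua (x := eps i)) ?eps0 //.
by rewrite (ultraC ua) epsI.
Qed.

Lemma loc_unitX i d k : loc_unit i d -> loc_unit i (d ^+ k).
Proof. by move=> ud; elim: k => [|k IH]; rewrite ?loc_unit1 // exprS loc_unitM. Qed.

End Modules.

Lemma Fin_npos_Mn (G : divOrderedGroupType) (g : G) i m : Fin g <= 0 -> (i <= m)%N ->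
  Fin (g *+ m) <= Fin (g *+ i).
Proof.
move=> g0 /subnKC <-; rewrite mulrnDr FinD -[leRHS]addr0 Fin_leD2l FinMn.
by have := ext_leMn (m - i) g0; rewrite mul0rn.
Qed.

(** * The Pruefer argument on the center *)

Section Prufer.
Variables (G : divOrderedGroupType) (F : fieldType) (v : valuation G F).
Variables (K : fieldExtType F) (a : K -> ext G).
Hypotheses (valK : value_function v a) (surK : surmultiplicative a).
Hypothesis a_sqr : forall x, a (x * x) = a x + a x.
Variables (n : nat) (eps : 'I_n -> K).
Hypothesis lift_eps : lifted_idempotents a eps.
Implicit Types x y z d : K.

Let sa : scaled v a := (value_function_scaled v a).1 valK.
Let ua : ultra a := sa.1.
Let aZ c x : a (c *: x) = a x + v c. Proof. exact: sa.2. Qed.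
Let vu := valuation_ultra v.
Let aM := surK.2.
Let a1 := surm1 surK.
Let aX x k : a (x ^+ k) = a x *+ k. Proof. exact: (power_multiplicative valK surK a_sqr). Qed.

Let leM0 x y : Fin 0 <= a x -> Fin 0 <= a y -> Fin 0 <= a (x * y).
Proof. by move=> x0 y0; have := surmM surK x0 y0; rewrite -FinD addr0. Qed.

Lemma power_relation x : exists (c : nat -> F) N i0,
  [/\ \sum_(i < N) c i *: x ^+ i = 0, (i0 < N)%N, c i0 = 1
    & forall i, (i < N)%N -> Fin 0 <= v (c i)].
Proof.
pose N := (\dim {: K}).+1; pose s := mkseq (fun i => x ^+ i) N.
have sz : size s = N by rewrite size_mkseq.
have [|c [c0 [i lti nzi]]] := @linear_relation _ _ s; first by rewrite sz.
rewrite sz in c0 lti.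
have [i0 [lt0 min0]] := min_index (fun i => v (c i)) (isT : (0 < N)%N).
have nz0 : c i0 != 0.
  rewrite -(valuation_neq_oo v); have := min0 _ lti.
  by apply: contraTneq => ->; apply: contraNN nzi => /oo_le/eqP; rewrite (ultra_eq_oo vu).
exists (fun i => c i / c i0), N, i0; split=> // [||j ltj]; last 1 first.
- have -> : Fin 0 = v (c i0) + v (c i0)^-1 by rewrite valuationV.
  by rewrite valuationM ext_leD // min0.
- transitivity ((c i0)^-1 *: (\sum_(j < N) c j *: s`_j)); last by rewrite c0 scaler0.
  rewrite scaler_sumr; apply: eq_bigr => j _; rewrite scalerA mulrC.
  by rewrite nth_mkseq.
- by rewrite mulfV.
Qed.

(** The tails u_k = sum_(i >= k) c_i x^(i-k) of a relation with c_i0 = 1 satisfy u_k = c_k + x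
    u_(k+1). By descending induction u_k and x u_k have values >= 0; at k = i0 the recursion is the
    claim. *)
Lemma prufer_split x : exists y z, [/\ Fin 0 <= a y, Fin 0 <= a (x * y),
  Fin 0 <= a z, Fin 0 <= a (x * z) & 1 = y - x * z].
Proof.
have [c [N [i0 [sum0 lti0 c1 c_ge0]]]] := power_relation x.
pose u k := \sum_(i < N | (k <= i)%N) c i *: x ^+ (i - k).
have uS k : (k < N)%N -> u k = (c k)%:A + x * u k.+1.
  move=> ltk; rewrite /u (bigD1 (Ordinal ltk)) //= subnn expr0; congr (_ + _).
  rewrite mulr_sumr (eq_bigl (fun i : 'I_N => (k < i)%N)) => [|i]; last first.
    by rewrite andbC ltn_neqAle eq_sym.
  by apply: eq_bigr => i ltki; rewrite -scalerAr -exprS -subSn // subSS.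
have uN : u N = 0 by rewrite /u big1 // => i; rewrite leqNgt ltn_ord.
have xu k : x ^+ k * u k = - \sum_(i < N | (i < k)%N) c i *: x ^+ i.
  apply/eqP; rewrite -addr_eq0 addrC -[X in _ == X]sum0 [eqbRHS](bigID (fun i : 'I_N => (i < k)%N)) /=.
  apply/eqP; congr (_ + _); rewrite mulr_sumr; apply: eq_big => [i|i leki]; first by rewrite leqNgt.
  by rewrite -scalerAr -exprD subnKC.
have xu_ge0 k : Fin 0 <= a (u k) -> Fin 0 <= a (x * u k).
  case: k => [|k] uk0.
    have := xu 0%N; rewrite expr0 mul1r big1 // oppr0 => ->.
    by rewrite mulr0 (ultra0 ua) le_oo.
  set y := x * u k.+1; rewrite leNgt; apply/negP => y0.
  have [g yg] := fin_of_lt y0; rewrite yg in y0.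
  (* y = x u_(k+1) satisfies a monic equation of degree k + 1 whose coefficients have values >= 0.
     For g < 0 this bound contradicts a (y^(k+1)) = (k + 1) g. *)
  have : Fin (g *+ k) <= a (y ^+ k.+1).
    have -> : y ^+ k.+1 = - \sum_(i < N | (i < k.+1)%N) c i *: (y ^+ i * u k.+1 ^+ (k - i)).
      rewrite /y exprMn [u _ ^+ _]exprS mulrA xu mulNr mulr_suml.
      congr (- _); apply: eq_bigr => i; rewrite ltnS => leik.
      by rewrite -scalerAl exprMn -mulrA -exprD subnKC.
    rewrite (ultraN ua); apply: (ultra_le_sum ua) => i; rewrite ltnS => leik.
    rewrite aZ -[leLHS]addr0 ext_leD ?c_ge0 // -[leLHS]addr0.
    apply: surmM => //; last first.
      by have := surmX surK (k - i) uk0; rewrite mul0rn.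
    by rewrite aX yg -FinMn; apply: Fin_npos_Mn => //; apply: ltW.
  rewrite aX yg mulrS -FinMn -[leLHS]add0r leNgt.
  by rewrite ext_lt_leD.
have u_ge0 j : forall k, (N - k <= j)%N -> Fin 0 <= a (u k).
  elim: j => [|j IH] k.
    rewrite leqn0 subn_eq0 => leNk; rewrite /u big1 ?(ultra0 ua) ?le_oo // => i leki.
    by have := ltn_ord i; rewrite ltnNge (leq_trans leNk leki).
  have [leNk _|ltkN le] := leqP N k; first by apply: IH; rewrite (eqP leNk).
  rewrite uS //; apply: (ultra_leD ua).
    by rewrite aZ a1 add0r c_ge0.
  by apply/xu_ge0/IH; rewrite -ltnS subnSK.
have uk k : Fin 0 <= a (u k) by apply: (u_ge0 N); apply: leq_subr.
exists (u i0), (u i0.+1); split; rewrite ?xu_ge0 //.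
by rewrite uS // c1 scale1r addrK.
Qed.

Lemma loc_unitI i d : Fin 0 <= a d -> ~~ (Fin 0 < a (eps i * d)) -> loc_unit a eps i d.
Proof.
move=> d0 ned; have eps0 : a (eps i) = 0 by case: lift_eps.
have ed0 : a d <= a (eps i * d) by have := aM (eps i) d; rewrite eps0 add0r.
have e2 : a (eps i * d) = 0 by apply/le_anti; rewrite leNgt ned (le_trans d0).
by rewrite /loc_unit e2 eqxx andbT; apply/eqP/le_anti; rewrite d0 -e2 ed0.
Qed.

(** In 1 = y - x z, one of y and x z lies outside the maximal ideal attached to eps_i, and it serves
    as d. *)
Lemma valuation_alternative i x : x != 0 ->
  (exists2 d, loc_unit a eps i d & Fin 0 <= a (d * x)) \/
  (exists2 d, loc_unit a eps i d & Fin 0 <= a (d / x)).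
Proof.
move=> nzx; have [y [z [y0 xy0 z0 xz0 yz]]] := prufer_split x.
have eps0 : a (eps i) = 0 by case: lift_eps.
have [lty|nlty] := boolP (Fin 0 < a (eps i * y)).
  right; exists (x * z); last by rewrite mulrAC mulfV // mul1r.
  apply: loc_unitI => //; apply/negP => ltz.
  suff : Fin 0 < a (eps i) by rewrite eps0 ltxx.
  by rewrite -[eps i]mulr1 yz mulrBr ultra_ltB.
by left; exists y; [apply: loc_unitI | rewrite mulrC].
Qed.

Let uM := loc_unitM ua aM lift_eps.

(** Divisibility is total in the localization at i; t divides all members of s there, with a common
    denominator d. *)
Lemma loc_min_term i (s : seq K) : 0 \notin s -> s != [::] ->
  exists t d, [/\ t \in s, loc_unit a eps i d & forall z, z \in s -> Fin 0 <= a (d * (z / t))].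
Proof.
elim: s => // x s IH; rewrite inE negb_or eq_sym => /andP[nzx s0] _.
have [->|nes] := eqVneq s [::].
  exists x, 1; split; rewrite ?mem_head ?(loc_unit1 a1 lift_eps) // => z; rewrite inE => /eqP->.
  by rewrite mulfV // mulr1 a1.
have [t [d [ts ud min]]] := IH s0 nes.
have nzt : t != 0 by apply: contraNneq s0 => <-.
have d0 e : loc_unit a eps i e -> Fin 0 <= a e by case/andP=> /eqP->.
have [|[e ue le]|[e ue le]] := @valuation_alternative i (x / t).
- by rewrite mulf_neq0 ?invr_eq0.
- exists t, (e * d); split; [by rewrite inE ts orbT | exact: uM |].
  move=> z; rewrite inE => /orP[/eqP->|zs].
    by rewrite [e * d * _]mulrAC; apply: leM0 => //; apply: d0.
  by rewrite -mulrA; apply: leM0; [apply: d0 | apply: min].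
- exists x, (e * d); split; [by rewrite mem_head | exact: uM |].
  move=> z; rewrite inE => /orP[/eqP->|zs].
    by rewrite mulfV // mulr1; apply/d0/uM.
  have -> : e * d * (z / x) = (e / (x / t)) * (d * (z / t)) by field; rewrite ?nzx ?nzt.
  by apply: leM0 => //; apply: min.
Qed.

(** A vanishing sum has two terms of least value at i. Applied to a polynomial relation for x, this
    makes the value of x torsion modulo the values of F. *)
Lemma loc_power_relation i x : x != 0 -> exists d d' (b : F) k,
  [/\ loc_unit a eps i d, loc_unit a eps i d', b != 0, (0 < k)%N & d * x ^+ k = b *: d'].
Proof.
move=> nzx; have [c [N [i0 [sum0 lti0 c1 _]]]] := power_relation x.
pose term j := c j *: x ^+ j.
have nzterm j : (term j != 0) = (c j != 0).
  by rewrite /term scaler_eq0 expf_eq0 (negPf nzx) andbF orbF.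
pose s := [seq term j | j <- iota 0 N & c j != 0].
have sP z : z \in s -> exists j, [/\ (j < N)%N, c j != 0 & z = term j].
  by case/mapP=> j; rewrite mem_filter mem_iota => /andP[nzj ltj] ->; exists j.
have sin j : (j < N)%N -> c j != 0 -> term j \in s.
  by move=> ltj nzj; apply/mapP; exists j; rewrite // mem_filter mem_iota nzj.
have [||t [d [/sP[j [ltj nzj ->]] ud min]]] := @loc_min_term i s.
- by apply/negP => /sP[j [_ nzj /esym/eqP]]; rewrite -(negbK (_ == 0)) nzterm nzj.
- have : term i0 \in s by apply: sin; rewrite // c1 oner_neq0.
  by case: (s).
have nzt : term j != 0 by rewrite nzterm.
have [k [ltk nek nzk uk]] : exists k, [/\ (k < N)%N, k != j, c k != 0
    & loc_unit a eps i (d * (term k / term j))].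
  apply: NNPP => nex.
  have eqd : d = - \sum_(k < N | k != Ordinal ltj) d * (term k / term j).
    have : \sum_(k < N) d * (term k / term j) = 0.
      by rewrite -mulr_sumr -mulr_suml [\sum_(k < N) _]sum0 mul0r mulr0.
    by rewrite (bigD1 (Ordinal ltj)) //= mulfV // mulr1 => /eqP; rewrite addr_eq0 => /eqP.
  have : Fin 0 < a (eps i * d).
    rewrite eqd mulrN (ultraN ua) mulr_sumr.
    apply: (ultra_lt_sum ua) => [|k nek]; first exact: ext_lt_oo.
    have [ck0|nzk] := eqVneq (c k) 0.
      by rewrite /term ck0 scale0r mul0r !mulr0 (ultra0 ua) ext_lt_oo.
    apply: contraT => nlt; case: nex; exists k; split=> //.
    by apply: loc_unitI => //; apply: min; apply: sin.
  by case/andP: ud => _ /eqP->; rewrite ltxx.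
set d' := d * _ in uk.
have E : c k *: (d * x ^+ k) = c j *: (d' * x ^+ j).
  rewrite !scalerAr -/(term k) -/(term j) /d' -!mulrA; congr (_ * _).
  by rewrite mulVf // mulr1.
have [ltjk|ltkj|ejk] := ltngtP j k; last by rewrite ejk eqxx in nek.
- exists d, d', (c j / c k), (k - j)%N; split; rewrite ?subn_gt0 ?mulf_neq0 ?invr_eq0 //.
  apply: (mulIf (expf_neq0 j nzx)); rewrite -mulrA -exprD subnK ?(ltnW ltjk) //.
  by rewrite -scalerAl [c j / _]mulrC -scalerA -E scalerA mulVf ?scale1r.
- exists d', d, (c k / c j), (j - k)%N; split; rewrite ?subn_gt0 ?mulf_neq0 ?invr_eq0 //.
  apply: (mulIf (expf_neq0 k nzx)); rewrite -mulrA -exprD subnK ?(ltnW ltkj) //.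
  by rewrite -scalerAl [c k / _]mulrC -scalerA E scalerA mulVf ?scale1r.
Qed.

(** With d x^k = b d', the k-th powers of d x and of eps_i d x are both b times a unit at i, so they
    have the same value v b. By power-multiplicativity d x and eps_i d x have the same value. *)
Lemma loc_attained i x : x != 0 ->
  exists2 d, loc_unit a eps i d & good eps (a : K^o -> _) i (d * x).
Proof.
move=> nzx; have [d [d' [b [k [ud ud' nzb k0 E]]]]] := loc_power_relation i nzx.
have nzd : d != 0 by case/andP: ud => /eqP d0 _; rewrite -(ultra_eq_oo ua) d0.
have nzdx : d * x != 0 by rewrite mulf_neq0.
have [h dxh] := surm_neq_oo sa nzdx.
have dxk : (d * x) ^+ k = b *: (d ^+ k.-1 * d').
  by rewrite exprMn -(prednK k0) exprSr -mulrA (prednK k0) E -scalerAr.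
have uX : loc_unit a eps i (d ^+ k.-1 * d').
  by apply: uM => //; apply: (loc_unitX ua a1 aM lift_eps).
have uEX : loc_unit a eps i (eps i ^+ k * (d ^+ k.-1 * d')).
  by apply: uM => //; apply/(loc_unitX ua a1 aM lift_eps)/loc_unit_eps.
exists d => //; apply: contraT => ng.
have lt : a (d * x) < a (eps i * (d * x)).
  by rewrite dxh; apply: (@goodPn _ K a _ _ lift_eps K^o a ua aM i _ _ dxh).
have := ext_ltMn k.-1 lt; rewrite (prednK k0) -!aX [(eps i * _) ^+ k]exprMn dxk -scalerAr !aZ.
by case/andP: uX => /eqP-> _; case/andP: uEX => /eqP-> _; rewrite ltxx.
Qed.

End Prufer.

(** * The localized value functions *)

Section Localization.
Variables (G : divOrderedGroupType) (K : fieldType) (a : K -> ext G).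
Hypotheses (ua : ultra a) (a1 : a 1 = 0) (aM : forall x y, a x + a y <= a (x * y)).
Variables (n : nat) (eps : 'I_n -> K).
Hypothesis lift_eps : lifted_idempotents a eps.
Implicit Types (x y d : K) (i : 'I_n).

Let eps0 i : a (eps i) = 0. Proof. by case: lift_eps. Qed.

(** A good multiple d u is one of maximal value: by [loc_unit_mul], further units at i do not change
    the value of d u. *)
Definition attained (V : lmodType K) (m : V -> ext G) :=
  forall i u, u != 0 -> exists2 d, loc_unit a eps i d & good eps m i (d *: u).

Section Module.
Variables (V : lmodType K) (m : V -> ext G).
Hypotheses (um : ultra m) (mZ : forall x u, a x + m u <= m (x *: u)).
Hypothesis att : attained m.
Implicit Types u w : V.

(** The case u = 0 is included so that [xchoose] applies to all u. *)
Fact loc_exists i u : exists d, (u == 0) || loc_unit a eps i d && good eps m i (d *: u).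
Proof.
have [->|nzu] := eqVneq u 0; first by exists 0.
by have [d ud gd] := att i nzu; exists d; rewrite ud gd.
Qed.

(* The largest value of m on the multiples of u by units at i. *)
Definition loc i u : ext G := if u == 0 then oo else m (xchoose (loc_exists i u) *: u).

Lemma loc_eq i u d : loc_unit a eps i d -> good eps m i (d *: u) -> loc i u = m (d *: u).
Proof.
move=> ud gd; have nzu : u != 0.
  by apply: contraTneq gd => ->; rewrite scaler0 /good eqxx.
rewrite /loc ifN //; move: (xchooseP (loc_exists i u)); move: (xchoose _) => d'.
rewrite (negPf nzu) => /andP[ud' gd'].
have [e1 _] := loc_unit_mul lift_eps um mZ ud gd'.
have [e2 _] := loc_unit_mul lift_eps um mZ ud' gd.
by rewrite -e1 -e2 !scalerA mulrC.
Qed.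

Lemma loc0 i : loc i 0 = oo. Proof. by rewrite /loc ifT. Qed.

Lemma loc_ex i u : u != 0 -> exists d,
  [/\ loc_unit a eps i d, good eps m i (d *: u) & loc i u = m (d *: u)].
Proof. by move=> /(att i)[d ud gd]; exists d; split=> //; apply: loc_eq. Qed.

Lemma loc_ge_unit i u d : loc_unit a eps i d -> m (d *: u) <= loc i u.
Proof.
move=> ud; have [->|nzu] := eqVneq u 0; first by rewrite loc0 le_oo.
have [d' [ud' gd' ->]] := loc_ex i nzu.
have [<- _] := loc_unit_mul lift_eps um mZ ud gd'.
rewrite scalerA mulrC -scalerA; have := mZ d' (d *: u).
by case/andP: ud' => /eqP-> _; rewrite add0r.
Qed.

Lemma loc_ge i u : m u <= loc i u.
Proof. by have := loc_ge_unit u (loc_unit1 a1 lift_eps i); rewrite scale1r. Qed.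

Lemma loc_good i u : good eps m i u -> loc i u = m u.
Proof.
by move=> gu; rewrite (loc_eq (loc_unit1 a1 lift_eps i)) scale1r.
Qed.

Lemma loc_oo i u : loc i u = oo <-> u = 0.
Proof.
split=> [e|->]; last exact: loc0.
apply/eqP; apply: contraT => nzu; have [d [_ /(good_fin um)[h hE] le]] := loc_ex i nzu.
by rewrite e hE in le.
Qed.

(** The product of two units, one for u and one for w, attains both maxima; with a common d,
    properties of m pass to [loc]. *)
Lemma loc_min i u w : exists d, [/\ loc_unit a eps i d,
  loc i u = m (d *: u) & loc i w = m (d *: w)].
Proof.
have [->|nzu] := eqVneq u 0; have [->|nzw] := eqVneq w 0.
- by exists 1; rewrite (loc_unit1 a1 lift_eps) scaler0 loc0 (ultra0 um).
- by have [d [ud _ e]] := loc_ex i nzw; exists d; rewrite scaler0 loc0 (ultra0 um).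
- by have [d [ud _ e]] := loc_ex i nzu; exists d; rewrite scaler0 loc0 (ultra0 um).
have [d [ud gd _]] := loc_ex i nzu; have [d' [ud' gd' _]] := loc_ex i nzw.
exists (d * d'); have udd := loc_unitM ua aM lift_eps ud ud'.
split=> //; apply: loc_eq => //.
  by rewrite mulrC -scalerA; have [] := loc_unit_mul lift_eps um mZ ud' gd.
by rewrite -scalerA; have [] := loc_unit_mul lift_eps um mZ ud gd'.
Qed.

Lemma loc_ultra i : ultra (loc i).
Proof.
split=> [u|u|u w]; first exact: loc_oo.
  have [->|nzu] := eqVneq u 0; first by rewrite oppr0.
  have [d [ud /andP[nzd eu] ->]] := loc_ex i nzu.
  rewrite (loc_eq ud) ?scalerN ?(ultraN um) //.
  by rewrite /good ?scalerN oppr_eq0 nzd ?scalerN !(ultraN um).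
have [d [ud -> ->]] := loc_min i u w.
by apply: le_trans (loc_ge_unit _ ud); rewrite scalerDr ultraD.
Qed.

Lemma loc_le u h : (forall i, Fin h < loc i u) -> Fin h < m u.
Proof.
move=> lt; have [->|nzu] := eqVneq u 0; first by rewrite (ultra0 um) ext_lt_oo.
by have [i gi] := exists_good lift_eps um mZ nzu; rewrite -(loc_good gi).
Qed.

End Module.

Hypothesis attK : attained (a : K^o -> ext G).

Definition locK i x := loc attK i (x : K^o).

Let mK x (y : K^o) : a x + a y <= a (x *: y). Proof. exact: aM. Qed.

Lemma locK_unit i d : loc_unit a eps i d -> locK i d = 0.
Proof.
rewrite (loc_unit_good ua) => /andP[/eqP d0 gd].
by rewrite /locK (loc_good (V := K^o) ua mK attK gd).
Qed.

Section ModuleK.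
Variables (V : lmodType K) (m : V -> ext G).
Hypotheses (um : ultra m) (mZ : forall x u, a x + m u <= m (x *: u)).
Hypothesis att : attained m.

Lemma locZ i x (u : V) : loc att i (x *: u) = locK i x + loc att i u.
Proof.
have [->|nzx] := eqVneq x 0.
  by rewrite scale0r /locK (loc0 att) (loc0 attK i) addoox.
have [->|nzu] := eqVneq u 0; first by rewrite scaler0 !(loc0 att) addoo.
have [d [ud gd e]] := loc_ex (V := K^o) ua mK attK i nzx.
have [d' [ud' gd' ->]] := loc_ex um mZ att i nzu.
have [h hE] := good_fin (V := K^o) ua gd.
have /andP[_ /eqP ed] := gd.
have fin : a (d * x) != oo by move: (hE : a (d * x) = Fin h) => ->.
have [e1 g1] := good_mul lift_eps um mZ fin ed gd'.
rewrite /locK e -[RHS]e1; have E : (d * x) *: (d' *: u) = (d' * d) *: (x *: u).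
  by rewrite !scalerA; congr (_ *: _); ring.
by rewrite E; apply: loc_eq => //; [apply: (loc_unitM ua aM lift_eps) | rewrite -E].
Qed.

Lemma loc_unitZ i d (u : V) : loc_unit a eps i d -> loc att i (d *: u) = loc att i u.
Proof. by move=> ud; rewrite locZ locK_unit // add0r. Qed.

End ModuleK.

Lemma locK_mul i x y : locK i (x * y) = locK i x + locK i y.
Proof. exact: (locZ (V := K^o) ua mK attK). Qed.

Lemma locK_eps_neq i j : i != j -> Fin 0 < locK j (eps i).
Proof.
move=> ne; have lt : Fin 0 < a (eps j * eps i).
  by case: lift_eps => _ _ h _ _; apply: h; rewrite eq_sym.
apply: lt_le_trans lt _; have := loc_ge (V := K^o) ua mK attK j (eps j * eps i).
by rewrite -/(locK _ _) locK_mul locK_unit ?add0r // (loc_unit_eps ua lift_eps).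
Qed.

Definition loc_valuation i : valuation G K :=
  Valuation (fun x => loc_oo (V := K^o) ua mK attK i x) (locK_mul i)
    (ultraD (loc_ultra (V := K^o) ua mK attK i)).

Lemma loc_valuation_inj i j : loc_valuation i =1 loc_valuation j -> i = j.
Proof.
move=> e; apply/eqP; apply: contraT => /locK_eps_neq.
rewrite -[locK j _]/(loc_valuation j _) -e -[loc_valuation i _]/(locK i _).
rewrite locK_unit ?ltxx //.
exact: (loc_unit_eps ua lift_eps).
Qed.

Section Approximation.
Variables (V : lmodType K) (m : V -> ext G).
Hypotheses (um : ultra m) (mZ : forall x u, a x + m u <= m (x *: u)).
Hypothesis att : attained m.

(** w = eps_i y d u, where d u realizes the value of u at i and y inverts d in the i-th component.
    There w has the class of u; the factor eps_i kills it at every other j. *)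
Lemma loc_approx i u g : Fin g <= loc att i u -> exists w,
  [/\ Fin g <= m w, Fin g < loc att i (w - u) & forall j, j != i -> Fin g < loc att j w].
Proof.
have [->|nzu] := eqVneq u 0.
  by exists 0; split=> *; rewrite ?subr0 ?(ultra0 um) ?loc0 ?le_oo ?ext_lt_oo.
move=> le_gl; have [d [ud gd e]] := loc_ex um mZ att i nzu.
have le_g : Fin g <= m (d *: u) by rewrite -e.
have [/eqP d0 /eqP ed] := andP ud.
have [_ _ _ _ inv] := lift_eps.
have [y [y0 dy]] := inv d 0 i d0 (etrans (congr1 a (mulrC _ _)) ed).
rewrite oppr0 in y0.
have le_ydu : Fin g <= m (y *: (d *: u)).
  by rewrite -[Fin g]add0r; apply: le_trans (mZ _ _); apply: ext_leD.
exists (eps i *: (y *: (d *: u))); split.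
- by apply: le_trans le_ydu _; exact: (eps_ge lift_eps mZ).
- have -> : eps i *: (y *: (d *: u)) - u = (eps i * (y * d) - 1) *: u.
    by rewrite !scalerA scalerBl scale1r !mulrA.
  rewrite (locZ um mZ att) -[g]add0r FinD.
  apply: ext_lt_leD => //.
  have lt : Fin 0 < a (eps i * (eps i * (y * d) - 1)).
      have -> : eps i * (eps i * (y * d) - 1) = eps i * eps i * (d * y - eps i)
          + eps i * (eps i * eps i - eps i) + (eps i * eps i - eps i) by ring.
      have epsI : Fin 0 < a (eps i * eps i - eps i) by case: lift_eps.
      apply: (ultra_ltD ua) => //; apply: (ultra_ltD ua).
        rewrite -mulrA; do 2!(apply: lt_le_trans (aM _ _); rewrite eps0 add0r).
        exact: dy.
      by apply: lt_le_trans (aM _ _); rewrite eps0 add0r.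
    apply: lt_le_trans lt _; have := loc_ge (V := K^o) ua mK attK i (eps i * (eps i * (y * d) - 1)).
    by rewrite -/(locK _ _) locK_mul locK_unit ?add0r // (loc_unit_eps ua lift_eps).
- move=> j ne; rewrite (locZ um mZ att) -[g]add0r FinD.
  apply: ext_lt_leD => //; first by apply: locK_eps_neq; rewrite eq_sym.
  exact: le_trans le_ydu (loc_ge um mZ att _ _).
Qed.

End Approximation.
End Localization.

(** * Gauges *)

Section HomogeneousIdeals.
Variables (G : divOrderedGroupType) (B : gradedRing G) (I : forall g, B g -> Prop).
Hypothesis hI : homogeneous_ideal I.

Lemma gmul0r g h k (e : g + h = k) (x : B g) : gmul B e x 0 = 0.
Proof. by apply: (addrI (gmul B e x 0)); rewrite -gmulDr !addr0. Qed.

Lemma gmul0l g h k (e : g + h = k) (x : B h) : gmul B e 0 x = 0.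
Proof. by apply: (addrI (gmul B e 0 x)); rewrite -gmulDl !addr0. Qed.

Lemma nilpotent_hideal2 :
  (forall g h k (e : g + h = k) (x : B g) (y : B h), I x -> I y -> gmul B e x y = 0) ->
  nilpotent_hideal I.
Proof.
move=> I2; exists 2%N => g x p.
have key n k (z : B k) : hideal_prod I n z ->
    match n with 0%N => True | 1%N => I z | _ => z = 0 end.
  elim=> // -[|[|m]] h l j e y t Iy _ => [_|It|->]; last exact: gmul0r.
    exact: hidealMr.
  exact: I2.
exact: key p.
Qed.

Lemma hideal_prodMl n g h k (e : g + h = k) (s : B g) (x : B h) :
  hideal_prod I n.+1 x -> hideal_prod I n.+1 (gmul B e s x).
Proof.
have key m j (z : B j) : hideal_prod I m z -> (0 < m)%N ->
    forall i l (e' : i + j = l) t, hideal_prod I m (gmul B e' t z).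
  elim=> // {}m i j' l e1 y z' Iy pz _ _ i' k' e' t.
  have e2 : (i' + i) + j' = k' by rewrite -addrA e1.
  rewrite -(gmulA (erefl (i' + i)) e2); apply: HProdS => //.
  exact: hidealMl.
by move=> p; apply: key.
Qed.

Lemma hideal_prod1 g (x : B g) : I x -> hideal_prod I 1 x.
Proof. by move=> Ix; rewrite -(gmul1r (addr0 g) x); apply: HProdS => //; apply: HProd0. Qed.

End HomogeneousIdeals.

Section Semiprimality.
Variables (G : divOrderedGroupType) (F : fieldType) (v : valuation G F).
Variables (A : falgType F) (a : A -> ext G).
Hypotheses (valA : value_function v a) (surA : surmultiplicative a).

Let fil := surm_filtration valA surA.
Let sa : scaled v a := (value_function_scaled v a).1 valA.
Let ua : ultra a := sa.1.

Let ltM g h k x y : Fin g <= a x -> Fin h < a y -> g + h = k -> Fin k < a (x * y).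
Proof. by move=> ? ? <-; apply: surm_ltM. Qed.
Let Mlt g h k x y : Fin g < a x -> Fin h <= a y -> g + h = k -> Fin k < a (x * y).
Proof. by move=> ? ? <-; apply: surm_Mlt. Qed.
Let leM g h k x y : Fin g <= a x -> Fin h <= a y -> g + h = k -> Fin k <= a (x * y).
Proof. by move=> ? ? <-; rewrite FinD; apply: surmM. Qed.

(** Suppose x gr(A) x = 0. Let N be the set of t with x gr(A) t = 0 ([R1]), and let I consist of the
    b in N with b gr(A) N = 0 ([R2]). Then I is an ideal of square 0 that contains x. Defined by
    annihilators, I involves no sums of products, which the ideal generated by x would. *)
Lemma graded_semisimple_semiprime : graded_semisimple (gr fil) -> gr_semiprime a.
Proof.
move=> ss x nzx; apply: NNPP => nex; have [c xc] := surm_neq_oo sa nzx.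
have xyx h y : Fin h <= a y -> Fin (c + h + c) < a (x * y * x).
  move=> hy; rewrite ltNge; apply/negP => le; apply: nex; exists y.
    by apply: contraTneq le => ->; rewrite mulr0 mul0r (ultra0 ua) -ltNge ext_lt_oo.
  apply/le_anti/andP; split; last by do 2!(apply: (surmM surA) => //).
  by apply: le_trans le _; rewrite !FinD xc; do 2!(apply: ext_leD => //).
pose R1 k b := forall h y, Fin h <= a y -> Fin (c + h + k) < a (x * y * b).
pose R2 k b := forall h l y t, Fin h <= a y -> Fin l <= a t -> R1 l t ->
  Fin (k + h + l) < a (b * y * t).
pose I g (u : gr fil g) := exists b, [/\ Fin g <= a b, u = cls fil g b, R1 g b & R2 g b].
have hI : @homogeneous_ideal _ (gr fil) I.
  split=> [g|g _ _ [b [gb -> b1 b2]] [b' [gb' -> b1' b2']]|g h k e s _ [b [hb -> b1 b2]]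
          |g h k e _ s [b [gb -> b1 b2]]].
  - exists 0; rewrite cls0 (ultra0 ua) le_oo; split=> // [h y _|h l y t _ _ _].
      by rewrite mulr0 (ultra0 ua) ext_lt_oo.
    by rewrite !mul0r (ultra0 ua) ext_lt_oo.
  - exists (b - b'); rewrite clsB //; split=> // [|h y hy|h l y t hy lt Rt].
    + exact: (ultra_leB ua).
    + by rewrite mulrBr; apply: (ultra_ltB ua); [apply: b1 | apply: b1'].
    + by rewrite !mulrBl; apply: (ultra_ltB ua); [apply: b2 | apply: b2'].
  - have [z gz ->] := cls_ex s; exists (z * b); rewrite cls_mul //.
    split=> // [|i y iy|i l y t iy lt Rt].
    + by apply: leM e.
    + rewrite mulrA -[x * y * z]mulrA -e addrA -[c + i + g]addrA; apply: b1.
      exact: (leM iy gz).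
    + by rewrite -!mulrA -e -!addrA; apply: (ltM gz) => //; rewrite mulrA !addrA; apply: b2.
  - have [z hz ->] := cls_ex s; exists (b * z); rewrite cls_mul //.
    split=> // [|i y iy|i l y t iy lt Rt].
    + by apply: leM e.
    + by rewrite mulrA -e addrA; apply: (Mlt _ hz) => //; apply: b1.
    + rewrite -[b * z * y]mulrA -e -[g + h + i]addrA; apply: b2 => //.
      exact: (leM hz iy).
have : cls fil c x = 0.
  apply: (ss I hI); last first.
    exists x; split=> //; first by rewrite xc.
    by move=> h l y t hy lt Rt; apply: Rt.
  apply: nilpotent_hideal2 => // g h k e _ _ [b [gb -> b1 b2]] [b' [hb' -> b1' b2']].
  rewrite cls_mul //; apply: cls_lt => /=; rewrite -e -[g]addr0.
  rewrite -[b]mulr1; apply: b2 => //; first by rewrite surA.1.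
by move/eqP; rewrite cls_eq0 /= xc ?ltxx.
Qed.

(** From u != 0 in I, repeatedly replacing z by some z s z != 0 leads to nonzero elements of
    arbitrarily high powers of I. *)
Lemma semiprime_graded_semisimple : gr_semiprime a -> graded_semisimple (gr fil).
Proof.
move=> sp I hI [n nilI] g u Iu; apply/eqP; apply: contraT => nzu.
have step m : exists k (z : gr fil k), [/\ I k z, hideal_prod I m.+1 z & z != 0].
  elim: m => [|m [k [z [Iz pz nzz]]]]; first by exists g, u; split=> //; apply: hideal_prod1.
  have [x kx zE] := cls_ex z; rewrite zE cls_eq0 // in nzz.
  have xk : a x = Fin k by apply/le_anti; rewrite kx leNgt nzz.
  have [s nzs xsx] := sp _ (surm_neq0 sa xk); have [h sh] := surm_neq_oo sa nzs.
  exists (k + (h + k)), (gmul (gr fil) erefl z (gmul (gr fil) erefl (cls fil h s) z)); split.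
  - exact: hidealMr.
  - by apply: HProdS => //; apply: (hideal_prodMl hI).
  have hs : Fin h <= a s by rewrite sh.
  have hsx : Fin (h + k) <= a (s * x) by apply: leM hs kx _.
  rewrite zE (cls_mul (beta := fil) erefl hs kx) (cls_mul (beta := fil) erefl kx hsx).
  by rewrite cls_eq0 /= mulrA xsx xk sh -!FinD addrA ?ltxx.
case: n nilI => [|n] nilI.
  rewrite -(gmul1r (addr0 g) u) (nilI _ _ (HProd0 _)) gmul0r eqxx in nzu.
  by [].
by have [k [z [_ pz]]] := step n; rewrite (nilI _ _ pz) eqxx.
Qed.

End Semiprimality.

Section NormTower.
Variables (G : divOrderedGroupType) (F : fieldType) (v : valuation G F).
Variables (A : falgType F) (a : A -> ext G).

Lemma tower_of_coord (s : seq A) : 0 \notin s ->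
  (forall (c : nat -> F) i, (i < size s)%N ->
    a (\sum_(j < size s) c j *: s`_j) <= a s`_i + v (c i)) ->
  tower a (fun x => x = 0) s.
Proof.
elim: s => //= y s IH; rewrite inE negb_or eq_sym => /andP[nzy s0] le_c.
split=> // [u t -> /span_coord[c ->]|].
  have := le_c (fun i => if i is j.+1 then c j else 1) 0%N isT.
  by rewrite big_ord_recl /= scale1r valuation1 addr0 add0r addrC.
apply: IH => // c i lti; have := le_c (fun i => if i is j.+1 then c j else 0) i.+1 lti.
by rewrite big_ord_recl /= scale0r add0r.
Qed.

Lemma norm_tower : norm v a -> exists s,
  tower a (fun x => x = 0) s /\ <<s>>%VS = {: A}%VS.
Proof.
case=> valA [X bX eX]; have fX := basis_free bX; exists X; split; last exact: span_basis.
have sz := size_tuple X.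
apply: tower_of_coord; first by apply/negP => /(free_not0 fX); rewrite eqxx.
rewrite sz => c i lti; rewrite (eX (fun j => c j)).
exact: (bigmin_le _ (Ordinal lti)).
Qed.

Lemma tower_norm (s : seq A) : value_function v a ->
  tower a (fun x => x = 0) s -> <<s>>%VS = {: A}%VS -> norm v a.
Proof.
move=> valA ts sf; split=> //.
have sa := (value_function_scaled v a).1 valA; have ua := sa.1.
have fs := tower_free sa (U := fun x : A => x = 0) erefl ts.
have sz : size s == \dim {: A} by rewrite -sf; move/eqP: fs => ->.
exists (Tuple sz); first by rewrite basisEfree fs /= (eqP sz) leqnn sf subvv.
move=> c; apply/le_anti/andP; split.
  apply/bigmin_geP; split=> [|i _]; first exact: le_oo.
  pose c' k := if insub k is Some j then c j else 0.
  have c'E (j : 'I_(\dim {: A})) : c' j = c j by rewrite /c' valK.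
  have lti : (i < size s)%N by rewrite (eqP sz).
  have := @tower_coord _ _ v _ _ sa _ s 0 c' i (subsp0 _) ts erefl lti.
  rewrite add0r c'E (eqP sz); under eq_bigr do rewrite c'E; exact.
apply: (ultra_le_sum ua) => i _; rewrite (sa.2); exact: bigmin_le.
Qed.

End NormTower.

(** * The center, and attained maxima on A *)

Section AttainedOfGood.
Variables (G : divOrderedGroupType) (K : fieldType) (a : K -> ext G).
Hypotheses (ua : ultra a) (aM : forall x y, a x + a y <= a (x * y)).
Variables (n : nat) (eps : 'I_n -> K).
Hypothesis lift_eps : lifted_idempotents a eps.
Hypothesis attK : attained a eps (a : K^o -> ext G).
Variables (V : lmodType K) (m : V -> ext G).
Hypotheses (um : ultra m) (mZ : forall x u, a x + m u <= m (x *: u)).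

(** A scalar c with c u good need not be a unit at i. But some unit d makes d c good, d c has an
    inverse f in the i-th component, and f d c is a unit for which (f d c) u is good. *)
Lemma attained_of_good :
  (forall i u, u != 0 -> exists c, good eps m i (c *: u)) -> attained a eps m.
Proof.
move=> hgood i u nzu; have [c gc] := hgood i u nzu.
have nzc : c != 0 by apply: contraTneq gc => ->; rewrite /good scale0r eqxx.
have [d ud gd] := attK i nzc.
have [g dcg] := good_fin (V := K^o) ua gd; rewrite -/(a _) in dcg.
have /andP[_ /eqP edc] := gd.
have {}edc : a (d * c * eps i) = Fin g by rewrite mulrC -dcg -edc.
have [_ epsI _ _ inv] := lift_eps.
have [f [fg lt]] := inv _ _ _ dcg edc.
have eps0 : a (eps i) = 0 by case: lift_eps.
have efdc : a (eps i * (f * (d * c))) = 0.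
  rewrite (ultra_eqB ua (x := eps i)) ?eps0 // (ultraC ua).
  have -> : eps i * (f * (d * c)) - eps i =
      eps i * (d * c * f - eps i) + (eps i * eps i - eps i) by ring.
  apply: (ultra_ltD ua) => //; apply: lt_le_trans (aM _ _).
  by rewrite eps0 add0r.
have le_fdc : Fin (- g) + Fin g <= a (f * (d * c)).
  by apply: le_trans (aM _ _); apply: ext_leD => //; rewrite dcg.
have eps_le x : a x <= a (eps i * x) by have := aM (eps i) x; rewrite eps0 add0r.
have fdc : a (f * (d * c)) = 0.
  apply/le_anti; rewrite -{1}efdc eps_le /=.
  by move: le_fdc; rewrite Fin_addNr.
have le_ef : a (eps i * f) <= Fin (- g).
  rewrite -(Fin_leD2l g) Fin_addrN -efdc -dcg addrC mulrA; exact: aM.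
have fE : a f = Fin (- g) by apply/le_anti; rewrite fg (le_trans (eps_le f)).
have efE : a (eps i * f) = a f by apply/le_anti; rewrite eps_le fE le_ef.
exists (f * (d * c)); first by rewrite /loc_unit fdc efdc eqxx.
have [_ gdc] := loc_unit_mul lift_eps um mZ ud gc.
have fin : a f != oo by rewrite fE.
by have [_] := good_mul lift_eps um mZ fin efE gdc; rewrite !scalerA mulrA.
Qed.

End AttainedOfGood.

Section Center.
Variables (G : divOrderedGroupType) (F : fieldType) (v : valuation G F).
Variables (A : falgType F) (hA : simple_algebra A) (alpha : gauge v A).
Local Notation K := (center hA).
Local Notation AK := (over_center hA).
Local Notation cv := (@center_val F A hA).

Let valA := (gauge_norm alpha).1.
Let surA := gauge_surm alpha.
Let sa : scaled v alpha := (value_function_scaled v alpha).1 valA.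
Let ua : ultra alpha := sa.1.

Definition center_fun (z : K) : ext G := alpha (cv z).
Local Notation aK := center_fun.

Lemma gauge_semiprime : gr_semiprime alpha.
Proof.
exact: (@graded_semisimple_semiprime _ _ _ _ _ valA surA (gauge_semisimple (g := alpha))).
Qed.

Lemma center_valZ (c : F) (z : K) : cv (c *: z) = c *: cv z.
Proof. by rewrite /center_val linearZ. Qed.

Lemma center_val_eq0 (z : K) : (cv z == 0) = (z == 0).
Proof. by rewrite -(inj_eq (@center_val_inj _ _ hA)) raddf0. Qed.

Lemma center_value_function : value_function v aK.
Proof.
case: valA => oo_iff geD geZ; split.
- move=> z; rewrite /center_fun oo_iff; split=> [/eqP|->]; last exact: raddf0.
  by rewrite center_val_eq0 => /eqP.
- by move=> x y; rewrite /center_fun rmorphD.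
- by move=> x c; rewrite /center_fun center_valZ.
Qed.

Lemma center_surmultiplicative : surmultiplicative aK.
Proof.
split; first by rewrite /center_fun rmorph1 surA.1.
by move=> x y; rewrite /center_fun rmorphM surA.2.
Qed.

(** Semiprimeness gives y with alpha (x y x) = 2 alpha x + alpha y. As x is central, x y x = x^2 y,
    so alpha (x^2) cannot exceed 2 alpha x. *)
Lemma center_sqr x : aK (x * x) = aK x + aK x.
Proof.
have [->|nzx] := eqVneq x 0.
  by rewrite mul0r /center_fun raddf0 (ultra0 ua) addoo.
have nz : cv x != 0 by rewrite center_val_eq0.
have [y nzy e] := gauge_semiprime nz.
have [h yh] := surm_neq_oo sa nzy.
apply/le_anti/andP; split; last exact: center_surmultiplicative.2.
have : aK (x * x) + alpha y <= alpha (cv x * y * cv x).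
  by rewrite -mulrA -center_comm mulrA -rmorphM; apply: surA.2.
by rewrite e yh addrAC -/(aK x) ![_ + Fin h]addrC Fin_leD2l.
Qed.

Lemma center_scale_ge x (u : AK) : aK x + alpha u <= alpha (x *: u).
Proof. exact: surA.2. Qed.

End Center.

Lemma tower_notin (G : divOrderedGroupType) (F : fieldType) (v : valuation G F)
    (V : vectType F) (a : V -> ext G) (U : V -> Prop) s y :
  scaled v a -> subsp U -> tower a U s -> y \in s -> ~ U y.
Proof.
move=> sa sU; elim: s => //= x s IH [nzx best ts]; rewrite inE => /orP[/eqP-> Ux|/IH]; last exact.
have := best (- x) 0 (subspN sU Ux) (mem0v _).
by rewrite addr0 addNr (ultra0 sa.1) => /oo_le/eqP; rewrite (ultra_eq_oo sa.1) (negPf nzx).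
Qed.

Section CenterLocal.
Variables (G : divOrderedGroupType) (F : fieldType) (v : valuation G F).
Variables (A : falgType F) (hA : simple_algebra A) (alpha : gauge v A).
Local Notation K := (center hA).
Local Notation AK := (over_center hA).
Local Notation cv := (@center_val F A hA).
Local Notation aK := (@center_fun _ _ _ _ hA alpha).

Let valA := (gauge_norm alpha).1.
Let sa : scaled v alpha := (value_function_scaled v alpha).1 valA.
Let ua : ultra alpha := sa.1.
Let valK : value_function v aK := center_value_function hA alpha.
Let surK : surmultiplicative aK := center_surmultiplicative hA alpha.
Let uaK : ultra aK := ((value_function_scaled v aK).1 valK).1.

Variables (n : nat) (eps : 'I_n -> K).
Hypothesis lift_eps : lifted_idempotents aK eps.

(** If multiplication by eps_i raised all values on an orthogonal complement of U in W, its
    characteristic polynomial would give p in K, congruent to a power of eps_i and hence nonzero,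
    with p W inside U. Since K is a field, W would lie in U. *)
Lemma center_nonincreasing i (U W : A -> Prop) : subsp U -> subsp W ->
  (forall z u, U u -> U (cv z * u)) -> (forall z u, W u -> W (cv z * u)) ->
  (forall u, U u -> W u) -> (exists x, W x /\ ~ U x) ->
  exists x, [/\ W x, ~ U x & forall u, U u -> alpha (cv (eps i) * x + u) <= alpha x].
Proof.
move=> sU sW KU KW UW [x0 [Wx0 nUx0]].
have [s [ts sf]] := norm_tower (gauge_norm alpha).
have [t [tt Wt WUt]] := complement_tower sa ts sf sU sW UW.
apply: NNPP => nex.
have inc y : y \in t -> exists u', U u' /\ alpha y < alpha (cv (eps i) * y + u').
  move=> ty; apply: NNPP => nex'; apply: nex; exists y; split.
  - exact: Wt.
  - exact: tower_notin sa sU tt ty.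
  - by move=> u Uu; rewrite leNgt; apply/negP => lt; apply: nex'; exists u.
pose T : 'End(A) := amull (cv (eps i)).
have TE k y : iter k T y = cv (eps i ^+ k) * y.
  elim: k => [|k IH]; first by rewrite expr0 rmorph1 mul1r.
  by rewrite iterS IH /T /amull lfunE /= exprS rmorphM mulrA.
have T1 y : (T : {linear A -> A}) y = cv (eps i) * y
    by exact: etrans (TE 1%N y) (congr1 (fun z => cv z * y) (expr1 _)).
have t0 : (0 < size t)%N.
  case: t tt Wt WUt inc => // _ _ WU _; have [u [Uu]] := WU _ Wx0.
  by rewrite span_nil memv0 subr_eq0 => /eqP e; case: nUx0; rewrite e.
have [||c [c1 c_gt cU]] := increasing_char_poly sa (T := T) sU _ tt t0.
- by move=> u Uu; rewrite T1; apply: KU.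
- move=> y ty; have WTy : W ((T : {linear A -> A}) y) by rewrite T1; apply/KW/Wt.
  have [u [Uu tu]] := WUt _ WTy; exists u; split=> //.
  by rewrite T1; apply: inc.
pose p : K := \sum_(k < (size t).+1) c k *: eps i ^+ k.
have pE y : cv p * y = \sum_(k < (size t).+1) c k *: iter k T y.
  rewrite /p rmorph_sum mulr_suml; apply: eq_bigr => k _.
  transitivity (cv (c k *: eps i ^+ k) * y); first by [].
  by rewrite center_valZ -scalerAl; congr (_ *: _); exact: (esym (TE k y)).
have pU y : W y -> U (cv p * y).
  move=> /WUt[u [Uu tu]]; rewrite -[y](subrK u) mulrDr.
  apply: (subspD sU); last exact: KU.
  have /= := @subsp_span _ _ (fun z => U (cv p * z)) _ t (y - u); apply=> //.
    split; first by rewrite mulr0; case: sU.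
    by move=> b y1 y2 h1 h2; rewrite mulrDr -scalerAr; case: sU => _; apply.
  by move=> z tz; rewrite pE; apply: cU.
have unit_epsX k : aK (eps i ^+ k) = 0.
  have := loc_unitX uaK (surm1 surK) surK.2 lift_eps k (loc_unit_eps uaK lift_eps i).
  by case/andP=> /eqP.
have ap : aK p = 0.
  rewrite /p big_ord_recr /= c1 scale1r addrC.
  rewrite -(unit_epsX (size t)); apply: (ultra_eq_l uaK); rewrite unit_epsX.
  apply: (ultra_lt_sum uaK) => [|k _]; first exact: ext_lt_oo.
  rewrite (((value_function_scaled v aK).1 valK).2) unit_epsX add0r.
  exact: c_gt.
have nzp : p != 0 by rewrite -(ultra_eq_oo uaK) ap.
apply: nUx0; rewrite -[x0]mul1r -(rmorph1 cv) -(mulVf nzp) rmorphM -mulrA.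
by apply/KU/pU.
Qed.

Lemma gauge_ultra : ultra (alpha : AK -> ext G). Proof. exact: ua. Qed.

Lemma gauge_exists_good i (u : AK) : u != 0 ->
  exists c, good eps (alpha : AK -> ext G) i (c *: u).
Proof.
move=> nzu; pose W x := exists z, x = cv z * u.
have sW : subsp W.
  split; first by exists 0; rewrite raddf0 mul0r.
  move=> b _ _ [z ->] [z' ->]; exists (b *: z + z').
  have -> : cv (b *: z + z') = b *: cv z + cv z' by rewrite -center_valZ; apply: rmorphD.
  by rewrite mulrDl scalerAl.
have [||||x [[c ->] nz le]] := center_nonincreasing i (subsp0 A) sW.
- by move=> z _ ->; rewrite mulr0.
- by move=> z _ [z' ->]; exists (z * z'); rewrite rmorphM mulrA.
- by move=> _ ->; exists 0; rewrite raddf0 mul0r.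
- exists u; split; last exact/eqP.
  by exists 1; rewrite rmorph1 mul1r.
exists c; rewrite /good; apply/andP; split; first exact/eqP.
apply/eqP/le_anti; have := le 0 erefl; rewrite addr0 => le'.
apply/andP; split; first exact: le'.
have := @center_scale_ge _ _ _ _ hA alpha (eps i) (c *: u).
by case: lift_eps => -> _ _ _ _; rewrite add0r.
Qed.

Let attK : attained aK eps (aK : K^o -> ext G).
Proof. exact: (loc_attained valK surK (center_sqr alpha) lift_eps). Qed.

Let mZ := @center_scale_ge _ _ _ _ hA alpha.

Lemma gauge_attained : attained aK eps (alpha : AK -> ext G).
Proof.
exact: (attained_of_good uaK surK.2 lift_eps attK gauge_ultra mZ gauge_exists_good).
Qed.

End CenterLocal.

(** * Extensions of the valuation to the center *)

Section Integrality.
Variables (G : divOrderedGroupType) (F : fieldType) (v : valuation G F).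
Variables (A : falgType F) (a : A -> ext G).
Hypotheses (normA : norm v a) (surA : surmultiplicative a).
Let sa : scaled v a := (value_function_scaled v a).1 normA.1.

(** The characteristic polynomial of left multiplication by x, in an orthogonal base weighted by the
    values of its members. *)
Lemma integral_relation x g : Fin g <= a x -> exists m (c : nat -> F),
  [/\ c m = 1, forall k, (k <= m)%N -> Fin (g *+ (m - k)) <= v (c k)
    & \sum_(k < m.+1) c k *: x ^+ k = 0].
Proof.
move=> gx; have [s [ts sf]] := norm_tower normA.
have s0 := tower_notin0 sa (U := fun x : A => x = 0) erefl ts.
case sz : (size s) => [|m].
  have : 1 \in <<s>>%VS by rewrite sf memvf.
  by rewrite (size0nil sz) span_nil memv0 oner_eq0.
pose y (i : 'I_m.+1) := s`_i.
have [d dE] : exists d : 'I_m.+1 -> G, forall i, a (y i) = Fin (d i).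
  by have := scaled_fin sa s0; rewrite sz.
have hM (l : 'I_m.+1) : exists r : {ffun 'I_m.+1 -> F},
    x * y l = \sum_i r i *: y i /\
    (forall i, Fin (g + d l) <= v (r i) + Fin (d i)).
  have [c cE] : exists c : nat -> F, x * y l = \sum_(i < size s) c i *: s`_i.
    by apply: span_coord; rewrite sf memvf.
  rewrite sz in cE.
  exists [ffun i : 'I_m.+1 => c i]; under eq_bigr do rewrite ffunE.
  split=> // i; rewrite ffunE -dE [leRHS]addrC.
  have := @tower_coord _ _ v _ _ sa _ s 0 c i (subsp0 A) ts erefl.
  rewrite sz -cE add0r => /(_ (ltn_ord i)); apply: le_trans.
  by rewrite FinD; apply: (surmM surA) => //; rewrite dE.
have [r /all_and2[rE rle]] := fin_all_exists hM.
pose M : 'M[F]_m.+1 := \matrix_(i, l) r l i.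
have Mle i l : Fin (g + d l) <= v (M i l) + Fin (d i) by rewrite mxE.
pose T : 'End(A) := amull x.
have TE k z : iter k T z = x ^+ k * z.
  elim: k => [|k IH]; first by rewrite expr0 mul1r.
  by rewrite iterS IH /T /amull lfunE /= exprS mulrA.
have T1 z : (T : {linear A -> A}) z = x * z.
  exact: etrans (TE 1%N z) (congr1 (fun u => u * z) (expr1 _)).
have TM l : (T : {linear A -> A}) (y l) - \sum_i M i l *: y i = 0.
  under eq_bigr do rewrite mxE.
  by rewrite T1 rE subrr.
have CH l : \sum_(k < m.+2) (char_poly M)`_k *: iter k (T : {linear A -> A}) (y l) = 0.
  apply: (Cayley_Hamilton_mod (T := (T : {linear A -> A})) (subsp0 A) _ TM).
  by move=> u ->; rewrite linear0.
exists m.+1, (fun k => (char_poly M)`_k); split.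
- exact: char_poly_monicE.
- by move=> k lek; apply: char_poly_coef_ge Mle lek.
set p := \sum_(k < _) _.
have pz z : z \in <<s>>%VS -> p * z = 0.
  apply: (@subsp_span _ _ (fun z => p * z = 0)).
    by split=> [|b z1 z2 h1 h2]; rewrite ?mulr0 // mulrDr -scalerAr h1 h2 scaler0 addr0.
  move=> {}z zs; have lt : (index z s < m.+1)%N by rewrite -sz index_mem.
  have <- : y (Ordinal lt) = z by rewrite /y /= nth_index.
  rewrite -(CH (Ordinal lt)) /p mulr_suml; apply: eq_bigr => k _.
  rewrite -scalerAl; congr (_ *: _); exact: (esym (TE k _)).
by rewrite -[p]mulr1 pz // sf memvf.
Qed.

End Integrality.

Section CenterValuations.
Variables (G : divOrderedGroupType) (F : fieldType) (v : valuation G F).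
Variables (A : falgType F) (hA : simple_algebra A) (alpha : gauge v A).
Local Notation K := (center hA).
Local Notation cv := (@center_val F A hA).
Local Notation aK := (@center_fun _ _ _ _ hA alpha).

Let valK : value_function v aK := center_value_function hA alpha.
Let surK : surmultiplicative aK := center_surmultiplicative hA alpha.
Let uaK : ultra aK := ((value_function_scaled v aK).1 valK).1.

Lemma extension_ge (u : valuation G K) : extends v u -> forall x, aK x <= u x.
Proof.
move=> ext_u x; have uu := valuation_ultra u.
have [->|nzx] := eqVneq x 0; first by rewrite (ultra0 uu) le_oo.
have [g xg] : exists g, aK x = Fin g by apply: fin_of_neq_oo; rewrite (ultra_eq_oo uaK).
rewrite xg leNgt; apply/negP => lt; have [h uh] := fin_of_lt lt; rewrite uh in lt.
have gx : Fin g <= alpha (cv x) by rewrite -xg.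
have [m [c [c1 c_ge sum0]]] := integral_relation (gauge_norm alpha) (gauge_surm alpha) gx.
have {}sum0 : \sum_(k < m.+1) c k *: x ^+ k = 0.
  apply: (@center_val_inj _ _ hA); rewrite raddf0 -sum0 [LHS]raddf_sum.
  apply: eq_bigr => k _; transitivity (cv (c k *: x ^+ k)); first by [].
  by rewrite center_valZ; congr (_ *: _); apply: rmorphXn.
have uZ (b : F) z : u (b *: z) = v b + u z.
  by rewrite -ext_u -valuationM -scalerAl mul1r.
have : Fin (h *+ m) < u (x ^+ m).
  move/eqP: sum0; rewrite big_ord_recr /= c1 scale1r addrC addr_eq0 => /eqP->.
  rewrite (ultraN uu); apply: (ultra_lt_sum uu) => [|k _]; first exact: ext_lt_oo.
  rewrite uZ valuationX uh -FinMn -{1}(subnK (ltnW (ltn_ord k))) mulrnDr FinD.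
  apply: ext_lt_leD => //; apply: lt_le_trans (c_ge _ (ltnW (ltn_ord k))).
  have : (0 < m - k)%N by rewrite subn_gt0.
  by case: (m - k)%N => // j _; rewrite !FinMn; apply: ext_ltMn.
by rewrite valuationX uh FinMn ltxx.
Qed.

Variables (n : nat) (eps : 'I_n -> K).
Hypothesis lift_eps : lifted_idempotents aK eps.

Hypothesis attK : attained aK eps (aK : K^o -> ext G).

(** Let d x be good of value g, with inverse f in the i-th component. Then u (d x) >= g and u f >= -
    g, while u (d x f) = u (eps_i) = 0; so both are equalities. *)
Lemma valuation_is_loc (u : valuation G K) i : (forall x, aK x <= u x) ->
  (forall d, loc_unit aK eps i d -> u d = 0) -> u =1 locK attK i.
Proof.
move=> le_u u_unit x; have uu := valuation_ultra u.
have [->|nzx] := eqVneq x 0; first by rewrite (ultra0 uu) /locK (loc0 attK).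
have [d [ud gd e]] := loc_ex lift_eps (V := K^o) uaK surK.2 attK i nzx.
have [g dxg] := good_fin (V := K^o) uaK gd.
have {}dxg : aK (d * x) = Fin g := dxg.
have /andP[_ /eqP edx] := gd.
have edxg : aK (d * x * eps i) = Fin g by rewrite mulrC -dxg -edx.
have [_ _ _ _ inv] := lift_eps; have [f [fg lt]] := inv _ _ _ dxg edxg.
rewrite /locK e -[aK _]/(aK (d * x)) dxg.
have ue := u_unit _ (loc_unit_eps uaK lift_eps i).
have udxf : u (d * x * f) = 0.
  rewrite (ultra_eqB uu (x := eps i)) ?ue // (ultraC uu).
  exact: lt_le_trans lt (le_u _).
have -> : u x = u (d * x) by rewrite valuationM (u_unit d ud) add0r.
apply/le_anti/andP; split; last by rewrite -dxg.
rewrite -(Fin_leD2l (- g)) Fin_addNr -udxf [u (d * x * f)]valuationM [leLHS]addrC.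
by apply: ext_leD => //; apply: le_trans fg (le_u _).
Qed.

(** Since 1 is congruent to the sum of the eps_i, some u (eps_i) is 0. A unit d at this i has an
    inverse modulo eps_i, and the values of d and of the inverse are >= 0 with sum 0. *)
Lemma extension_center (u : valuation G K) : (forall x, aK x <= u x) ->
  exists i, forall d, loc_unit aK eps i d -> u d = 0.
Proof.
move=> le_u; have uu := valuation_ultra u.
have [eps0 _ _ eps_sum inv] := lift_eps.
have u0 d : aK d = 0 -> Fin 0 <= u d by move=> e; rewrite -[Fin 0]e.
have [i ui] : exists i, u (eps i) = 0.
  apply: NNPP => nex; suff : Fin 0 < u 1 by rewrite valuation1 ltxx.
  rewrite -(subrK (\sum_i eps i) 1); apply: (ultra_ltD uu).
    exact: lt_le_trans eps_sum (le_u _).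
  apply: (ultra_lt_sum uu) => [|i _]; first exact: ext_lt_oo.
  rewrite lt_def u0 // andbT; apply/eqP => e; apply: nex; exists i.
  exact: e.
exists i => d ud; have [/eqP d0 /eqP ed] := andP ud.
have [f [f0 lt]] := inv d 0 i d0 (etrans (congr1 aK (mulrC _ _)) ed).
have udf : u (d * f) = 0.
  rewrite (ultra_eqB uu (x := eps i)) ?ui // (ultraC uu).
  exact: lt_le_trans lt (le_u _).
rewrite oppr0 in f0; apply/le_anti/andP; split; last exact: u0.
rewrite -udf valuationM -[leLHS]addr0 ext_leD //.
exact: le_trans f0 (le_u _).
Qed.

Lemma loc_extends i : extends v (loc_valuation uaK (surm1 surK) surK.2 lift_eps attK i).
Proof.
move=> c /=; have [_ _ kZ] := valK.
have ac (z : K) : aK (c *: z) = aK z + v c by apply: kZ.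
have [->|nzc] := eqVneq c 0.
  rewrite scale0r /locK (loc0 attK) (ultra0 (valuation_ultra v)) //.
rewrite /locK (loc_good (surm1 surK) lift_eps (V := K^o) uaK surK.2 attK).
  by rewrite -[LHS]/(aK (c *: 1)) ac (surm1 surK) add0r.
apply/andP; split; first by change (c *: (1 : K) != 0); rewrite scaler_eq0 (negPf nzc) oner_eq0.
change (aK (eps i * (c *: 1)) == aK (c *: 1)).
rewrite -scalerAr mulr1 !ac (surm1 surK).
by case: lift_eps => ->.
Qed.

End CenterValuations.

Section Matching.
Variables (G : divOrderedGroupType) (F : fieldType) (v : valuation G F).
Variables (A : falgType F) (hA : simple_algebra A) (alpha : gauge v A).
Local Notation K := (center hA).
Local Notation aK := (@center_fun _ _ _ _ hA alpha).
Variables (r : nat) (w : 'I_r -> valuation G K).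
Hypotheses (w_ext : forall i, extends v (w i)).
Hypothesis w_inj : forall i j, w i =1 w j -> i = j.
Hypothesis w_all : forall u : valuation G K, extends v u -> exists i, u =1 w i.

Let valK : value_function v aK := center_value_function hA alpha.
Let surK : surmultiplicative aK := center_surmultiplicative hA alpha.
Let uaK : ultra aK := ((value_function_scaled v aK).1 valK).1.

(** The w i and the localizations both list the extensions of v without repetition; the lifted
    idempotents are re-indexed along the resulting bijection s. *)
Lemma center_valuations : exists2 eps : 'I_r -> K, lifted_idempotents aK eps
  & forall i d, loc_unit aK eps i d -> w i d = 0.
Proof.
have [n [eps lift_eps]] := lift_idempotents valK surK (center_sqr alpha).
have attK : attained aK eps (aK : K^o -> ext G).
  exact: (loc_attained valK surK (center_sqr alpha) lift_eps).
have w_ge i x : aK x <= w i x by apply: extension_ge.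
have [s sP] := fin_all_exists (fun i => extension_center lift_eps (w_ge i)).
have wE i : w i =1 locK attK (s i).
  exact: (valuation_is_loc lift_eps attK (w_ge i) (sP i)).
have s_inj : injective s.
  by move=> i j e; apply: w_inj => x; rewrite !wE e.
have s_surj j : exists i, s i = j.
  have [i wi] := w_all (loc_extends lift_eps attK j).
  exists i; apply/esym.
  have := @loc_valuation_inj _ _ _ uaK (surm1 surK) surK.2 _ _ lift_eps attK j (s i).
  by apply=> x; rewrite wi wE.
have [s' s'P] := fin_all_exists s_surj.
have s_bij : bijective s by exists s' => // i; apply: s_inj.
exists (eps \o s); last by move=> i d; apply: sP.
case: lift_eps => e0 eI eO e1 inv; split=> [i|i|i j ne||x g i xg].
- exact: e0.
- exact: eI.
- by apply: eO; rewrite (inj_eq s_inj).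
- by move: e1; rewrite (reindex s) //; apply: onW_bij.
- exact: inv.
Qed.

End Matching.

(** * The local gauges *)

Section LocalGauges.
Variables (G : divOrderedGroupType) (F : fieldType) (v : valuation G F).
Variables (A : falgType F) (hA : simple_algebra A) (alpha : gauge v A).
Local Notation K := (center hA).
Local Notation AK := (over_center hA).
Local Notation cv := (@center_val F A hA).
Local Notation aK := (@center_fun _ _ _ _ hA alpha).
Local Notation al := (alpha : AK -> ext G).
Variables (r : nat) (w : 'I_r -> valuation G K) (eps : 'I_r -> K).
Hypotheses (w_ext : forall i, extends v (w i)).
Hypothesis lift_eps : lifted_idempotents aK eps.
Hypothesis w_unit : forall i d, loc_unit aK eps i d -> w i d = 0.

Let valA := (gauge_norm alpha).1.
Let surA := gauge_surm alpha.
Let sa : scaled v alpha := (value_function_scaled v alpha).1 valA.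
Let ua : ultra al := sa.1.
Let valK : value_function v aK := center_value_function hA alpha.
Let surK : surmultiplicative aK := center_surmultiplicative hA alpha.
Let uaK : ultra aK := ((value_function_scaled v aK).1 valK).1.
Let aM := surK.2.
Let a1 := surm1 surK.
Let mZ : forall x (u : AK), aK x + al u <= al (x *: u) := @center_scale_ge _ _ _ _ hA alpha.

Let attK : attained aK eps (aK : K^o -> ext G).
Proof. exact: (loc_attained valK surK (center_sqr alpha) lift_eps). Qed.

Let att : attained aK eps al := gauge_attained lift_eps.

Definition local_fun i : AK -> ext G := loc att i.

Let eps0 i : aK (eps i) = 0. Proof. by case: lift_eps. Qed.

Let wE i : w i =1 locK attK i.
Proof.
have le_w x : aK x <= w i x by apply: extension_ge.
exact: (valuation_is_loc lift_eps attK le_w (@w_unit i)).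
Qed.

Lemma local_value_function i : value_function (w i) (local_fun i).
Proof.
have [l0 lN lD] := loc_ultra uaK a1 aM lift_eps ua mZ att i.
split=> // x c; rewrite wE addrC.
exact: (locZ uaK aM lift_eps attK ua mZ att).
Qed.

Lemma local_ge i (u : AK) : alpha u <= local_fun i u.
Proof. exact: (loc_ge a1 lift_eps ua mZ att). Qed.

Lemma local_surmultiplicative i : surmultiplicative (local_fun i).
Proof.
have l1 : al 1 = 0 by apply: surA.1.
split.
  rewrite /local_fun (loc_good a1 lift_eps ua mZ att) ?l1 // /good oner_neq0 /=.
  rewrite l1 -(eps0 i); apply/eqP; rewrite /center_fun.
  by congr (alpha _); rewrite -[LHS]/(cv (eps i) * 1) mulr1.
move=> x y; have [d [ud]] := loc_min uaK a1 aM lift_eps ua mZ att i x y.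
rewrite /local_fun => -> ->.
have udd := loc_unitM uaK aM lift_eps ud ud.
apply: le_trans (loc_ge_unit lift_eps ua mZ att (x * y) udd).
have -> : (d * d) *: (x * y) = (d *: x) * (d *: y) by rewrite -scalerAl -scalerAr scalerA.
exact: surA.2.
Qed.

Let sl i : scaled (w i) (local_fun i) :=
  (value_function_scaled (w i) (local_fun i)).1 (local_value_function i).

Lemma unit_inverse i d : loc_unit aK eps i d ->
  exists y, Fin 0 <= aK y /\ Fin 0 < aK (d * y - eps i).
Proof.
case/andP=> /eqP d0 /eqP ed; have [_ _ _ _ inv] := lift_eps.
have [y []] := inv d 0 i d0 (etrans (congr1 aK (mulrC _ _)) ed).
by rewrite oppr0; exists y.
Qed.

(** A longest tower over K spans A. Otherwise [center_nonincreasing], for the span U seen as an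
    F-space, gives x outside U with alpha (eps_i x + u) <= alpha x for all u in U. This x is good at
    i and, denominators cleared, orthogonal to U for [local_fun]. *)
Lemma local_norm i : norm (w i) (local_fun i).
Proof.
pose zero (x : AK) := x = 0.
pose P n := exists s : seq AK, size s = n /\ tower (local_fun i) zero s.
have [||n [[s [sz ts]] max]] := @ex_max P 0%N (\dim {: AK}).
- by exists [::].
- by move=> n [s [<- ts]]; apply: (tower_size (sl i) _ ts).
apply: (tower_norm (s := s) (local_value_function i) ts).
apply/eqP; rewrite eqEsubv subvf /=; apply: contraT => /subvPn[x0 _ nx0].
pose U (x : A) := (x : AK) \in <<s>>%VS.
have KU z u : U u -> U (cv z * u) by move=> Uu; apply: (memvZ z Uu).
have FE (c : F) (x : A) : c *: x = cv c%:A * x.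
  by rewrite center_valZ rmorph1 -scalerAl mul1r.
have sU : subsp U.
  split; first exact: (mem0v <<s>>%VS).
  by move=> c x y Ux Uy; rewrite FE; apply: (memvD (KU c%:A _ Ux) Uy).
have sT : subsp (fun _ : A => True) by [].
have ex0 : exists x, True /\ ~ U x by exists x0; split=> //; apply/negP.
have [x [_ nUx le_x]] := center_nonincreasing lift_eps i sU sT KU
  (fun _ _ _ => I) (fun _ _ => I) ex0.
have nzx : x != 0 by apply/eqP => x0E; apply: nUx; rewrite x0E; case: sU.
have le0 : al (eps i *: (x : AK)) <= al x.
  by have := le_x 0 sU.1; rewrite addr0.
have gx : good eps al i x.
  rewrite /good nzx /=; apply/eqP/le_anti; rewrite le0 /=.
  by have := mZ (eps i) x; rewrite eps0 add0r.
have bx : local_fun i x = alpha x by apply: (loc_good a1 lift_eps ua mZ att gx).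
suff : P n.+1 by move/max; rewrite ltnn.
exists ((x : AK) :: s); split; first by rewrite /= sz.
split=> // _ t -> st; rewrite add0r bx leNgt; apply/negP => lt.
have nztx : t + (x : AK) != 0.
  apply: contra_notN nUx; rewrite addrC addr_eq0 => /eqP e.
  by rewrite /U e rpredN.
have [h xh] := surm_neq_oo sa nzx; rewrite xh in lt.
have [d [ud gd e]] := loc_ex lift_eps ua mZ att i nztx.
have [y [y0 dy]] := unit_inverse ud.
have {lt e} lt : Fin h < al (y *: (d *: (t + (x : AK)))).
  apply: lt_le_trans (mZ _ _); rewrite -[Fin h]add0r.
  apply: ext_le_ltD => //; rewrite -e; exact: lt.
suff : Fin h < alpha (cv (eps i) * x + cv y * (cv d * t)).
  by rewrite ltNge -xh le_x //; apply/KU/KU.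
(* As d y is close to eps_i, a value of t + x at i larger than alpha x would carry over to eps_i x +
   u, with u = y d t in U. *)
have -> : cv (eps i) * x + cv y * (cv d * t) =
    y *: (d *: (t + (x : AK))) - (d * y - eps i) *: (x : AK).
  rewrite !scalerDr scalerBl opprB !scalerA [d * y]mulrC [RHS]addrC [_ *: t + _]addrC.
  by rewrite addrA subrK -scalerA.
apply: (ultra_ltB ua) => //; apply: lt_le_trans (mZ _ _).
by rewrite -[Fin h]add0r xh; apply: ext_lt_leD.
Qed.

(** y = eps_i d x has the value of x at i for alpha and no other component. If y z y != 0 in
    gr_alpha(A), then y z y is good at i, and its value at i is that of x z x, because eps_i d is a
    unit at i. *)
Lemma local_semiprime i : gr_semiprime (local_fun i).
Proof.
move=> x nzx; have [d [ud gd e]] := loc_ex lift_eps ua mZ att i nzx.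
have [h dxh] := good_fin ua gd; have /andP[_ /eqP edx] := gd.
have ued := loc_unitM uaK aM lift_eps (loc_unit_eps uaK lift_eps i) ud.
pose y : AK := (eps i * d) *: x.
have yh : al y = Fin h by rewrite /y -scalerA edx.
have [z nzz yzy] := gauge_semiprime alpha (surm_neq0 sa yh).
have [k zk] := surm_neq_oo sa nzz.
have le_y : Fin h < al (y - eps i *: y).
  have epsI : Fin 0 < aK (eps i * eps i - eps i) by case: lift_eps.
  have -> : y - eps i *: y = - ((eps i * eps i - eps i) *: (d *: x)).
    by rewrite /y scalerBl opprB -!scalerA.
  rewrite (ultraN ua); apply: lt_le_trans (mZ _ _).
  by rewrite -[Fin h]add0r dxh; apply: ext_lt_leD.
have yzyE : al (y * z * y) = Fin (h + k + h) by rewrite -/al yzy yh zk.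
have gyzy : good eps al i (y * z * y).
  apply/andP; split; first by rewrite -(ultra_eq_oo ua) yzyE.
  apply/eqP; apply: (ultra_eqB ua).
  have -> : y * z * y - eps i *: (y * z * y) = (y - eps i *: y) * z * y.
    by move: (y) => u; rewrite !mulrBl -!scalerAl.
  have zk' : Fin k <= alpha z by rewrite zk.
  have yh' : Fin h <= al y by rewrite yh.
  rewrite yzyE; exact: (surm_Mlt surA (surm_Mlt surA le_y zk') yh').
have bxzx : local_fun i (x * z * x) = Fin (h + k + h).
  rewrite -yzyE -(loc_good a1 lift_eps ua mZ att gyzy).
  have -> : y * z * y = (eps i * d * (eps i * d)) *: (x * z * x).
    by rewrite /y -scalerAr -!scalerAl scalerA.
  have udd := loc_unitM uaK aM lift_eps ued ued.
  by rewrite (loc_unitZ uaK a1 aM lift_eps attK ua mZ att _ udd).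
exists z => //; apply/le_anti/andP; split.
  rewrite bxzx !FinD /local_fun e -[m in m + _ + _]dxh -dxh.
  by do 2!(apply: ext_leD => //); rewrite -zk; apply: local_ge.
by do 2!(apply: (surmM (local_surmultiplicative i)) => //).
Qed.

Definition local_gauge i : gauge (w i) AK :=
  @Gauge _ _ (w i) AK (local_fun i) (local_norm i) (local_surmultiplicative i)
    (@semiprime_graded_semisimple _ _ _ _ _ (local_norm i).1 (local_surmultiplicative i)
      (@local_semiprime i)).

Lemma local_gauge_le (u : A) h : (forall i, Fin h < local_gauge i u) -> Fin h < alpha u.
Proof. by move=> lt; apply: (@loc_le _ _ _ a1 _ _ lift_eps AK al ua mZ att u h) => i; apply: lt. Qed.

Lemma local_gauge_approx i (u : A) g : Fin g <= local_gauge i u -> exists z : A,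
  [/\ Fin g <= alpha z, Fin g < local_gauge i (z - u)
    & forall j, j != i -> Fin g < local_gauge j z].
Proof.
exact: (@loc_approx _ _ _ uaK a1 aM _ _ lift_eps attK AK al ua mZ att i u g).
Qed.

Lemma local_gauge_min (u : A) : alpha u = \big[Num.min/oo]_i local_gauge i u.
Proof.
apply/le_anti/andP; split.
  by apply/bigmin_geP; split=> [|i _]; [apply: le_oo | apply: local_ge].
have [->|nzu] := eqVneq u 0; first by rewrite (ultra0 ua) le_oo.
have [i gi] := exists_good lift_eps ua mZ nzu.
rewrite -[leRHS](loc_good a1 lift_eps ua mZ att gi).
exact: bigmin_le.
Qed.

End LocalGauges.

(** * Graded simplicity *)

Section TensorSimplicity.
Variables (F : fieldType) (A : falgType F) (hA : simple_algebra A).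
Local Notation K := (center hA).
Local Notation AK := (over_center hA).
Local Notation cv := (@center_val F A hA).

Lemma prodv_ind (U V : {vspace A}) (Q : A -> Prop) : subsp Q ->
  (forall u v, u \in U -> v \in V -> Q (u * v)) -> forall x, x \in (U * V)%VS -> Q x.
Proof.
move=> sQ hQ x; rewrite unlock; apply: (subsp_span sQ) => y /allpairsP[[u u'] [uU uV ->]].
by apply: hQ; apply: vbasis_mem.
Qed.

Lemma simple_ideal_one (Q : A -> Prop) b : subsp Q ->
  (forall x y, Q y -> Q (x * y)) -> (forall x y, Q x -> Q (x * y)) -> b != 0 -> Q b -> Q 1.
Proof.
move=> sQ QMl QMr nzb Qb.
pose I := (fullv * <[b]> * fullv)%VS.
have bI : b \in I.
  rewrite -[b]mulr1 -[b]mul1r.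
  by apply: memv_mul; rewrite ?memvf // memv_mul ?memvf ?memv_line.
have [|I0|If] := hA (I := I).
- split; last by rewrite /I -prodvA; apply/prodvSr/subvf.
  by rewrite /I !prodvA; apply/prodvSl/prodvSl/subvf.
- by move: bI; rewrite I0 memv0 (negPf nzb).
apply: (@prodv_ind (fullv * <[b]>)%VS fullv) => //; last by rewrite -/I If memvf.
move=> u u' uU _; apply: QMr; move: uU; apply: prodv_ind => // t t' _ /vlineP[k ->].
by rewrite -scalerAr; apply: (subspZ sQ); apply: QMl.
Qed.

(* A (x)_K A^op acts faithfully on A. *)
Lemma tensor_faithful (s : seq AK) (Z : nat -> A) : free s ->
  (forall a : A, \sum_(l < size s) Z l * a * (s`_l : A) = 0) ->
  forall l, (l < size s)%N -> Z l = 0.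
Proof.
elim: s Z => // x s IH Z fs rel.
have fs' : free s by move: fs; rewrite free_cons => /andP[].
pose R (Z : nat -> A) := forall a : A, Z 0%N * a * (x : A) + \sum_(l < size s) Z l.+1 * a * (s`_l : A) = 0.
have RE (Z' : nat -> A) : (forall a : A, \sum_(l < (size s).+1) Z' l * a * ((x :: s)`_l : A) = 0) <-> R Z'.
  by split=> h a; have := h a; rewrite big_ord_recl.
have {rel} rel : R Z by apply/RE.
suff Z0 : Z 0%N = 0.
  case=> [|l] //= ltl; apply: (IH (fun l => Z l.+1)) => // a.
  by have := rel a; rewrite Z0 !mul0r add0r.
apply: NNPP => /eqP nz.
(* The leading coefficients of relations form a two-sided ideal of A; by simplicity it contains 1 as
   soon as it is nonzero. *)
pose Q b := exists2 Z', R Z' & Z' 0%N = b.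
have sQ : subsp Q.
  split; first by exists (fun=> 0) => // a; rewrite !mul0r big1 ?addr0 // => l _; rewrite !mul0r.
  move=> k b b' [Z1 R1 <-] [Z2 R2 <-]; exists (fun l => k *: Z1 l + Z2 l) => // a.
  have e (y : A) (b1 b2 : A) : (k *: b1 + b2) * a * y = k *: (b1 * a * y) + b2 * a * y.
    by rewrite !mulrDl -!scalerAl.
  under eq_bigr do rewrite e.
  rewrite e big_split /= addrACA R2 addr0 -scaler_sumr -scalerDr R1; exact: scaler0.
have QMl b b' : Q b' -> Q (b * b').
  move=> [Z1 R1 <-]; exists (fun l => b * Z1 l) => // a.
  have e (y b1 : A) : b * b1 * a * y = b * (b1 * a * y) by rewrite !mulrA.
  under eq_bigr do rewrite e.
  by rewrite e -mulr_sumr -mulrDr R1 mulr0.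
have QMr b b' : Q b -> Q (b * b').
  move=> [Z1 R1 <-]; exists (fun l => Z1 l * b') => // a.
  have e (y b1 : A) : b1 * b' * a * y = b1 * (b' * a) * y by rewrite !mulrA.
  under eq_bigr do rewrite e.
  by rewrite e R1.
have [Z1 R1 Z10] := simple_ideal_one sQ QMl QMr nz (ex_intro2 _ _ Z rel erefl).
(* With leading coefficient 1, b times the relation at a minus the relation at b a is a shorter
   relation, so the other coefficients commute with b. At a = 1 the relation then puts x into the
   K-span of s. *)
have Zcentral l : (l < size s)%N -> forall b, b * Z1 l.+1 = Z1 l.+1 * b.
  move=> ltl b; apply/eqP; rewrite -subr_eq0; apply/eqP.
  apply: (IH (fun l => b * Z1 l.+1 - Z1 l.+1 * b)) => // a.
  have e1 := R1 (b * a); have e2 := congr1 (fun y => b * y) (R1 a).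
  rewrite Z10 mul1r in e1; rewrite Z10 mul1r mulr0 mulrDr mulr_sumr mulrA in e2.
  transitivity (\sum_(l < size s) (b * (Z1 l.+1 * a * (s`_l : A)) -
      Z1 l.+1 * (b * a) * (s`_l : A))).
    by apply: eq_bigr => j _; rewrite !mulrBl !mulrA.
  rewrite sumrB; apply/eqP; rewrite subr_eq0; apply/eqP.
  by apply: (addrI (b * a * (x : A))); rewrite e2 e1.
have z_ex (l : 'I_(size s)) : exists z : K, cv z = Z1 l.+1.
  have Zl : Z1 l.+1 \in 'Z({: A})%AS.
    by rewrite memv_cap memvf; apply/centvP => y _; rewrite Zcentral.
  by exists (Subvs Zl : K).
have [z zE] := fin_all_exists z_ex.
have : (x : AK) \in <<s>>%VS.
  have := R1 1; rewrite Z10 mulr1 mul1r => /eqP; rewrite addr_eq0 => /eqP xE.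
  rewrite xE (rpredN (<<s>>%VS : {vspace AK})); apply: (@memv_suml _ AK) => l _.
  rewrite mulr1 -zE; apply: (memvZ (z l)).
  exact/memv_span/mem_nth.
by move: fs; rewrite free_cons => /andP[/negPf->].
Qed.

End TensorSimplicity.

Section IdentityOfIdeal.
Variables (G : divOrderedGroupType) (F : fieldType) (v : valuation G F).
Variables (A : falgType F) (beta : gauge v A).
Local Notation S := (gr (gauge_filtration beta)).
Let valA := (gauge_norm beta).1.
Let surA := gauge_surm beta.
Let sa : scaled v beta := (value_function_scaled v beta).1 valA.
Let sp : gr_semiprime beta := gauge_semiprime beta.

Lemma gr_semiprimeP g (u : S g) : u != 0 ->
  exists h k l (e1 : h + g = k) (e2 : g + k = l) (t : S h),
  gmul S e2 u (gmul S e1 t u) != 0.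
Proof.
have [x gx ->] := cls_ex u; rewrite cls_eq0 // => ngt.
have xg : beta x = Fin g by apply/le_anti; rewrite gx leNgt ngt.
have [y nzy yE] := sp (surm_neq0 sa xg); have [h yh] := surm_neq_oo sa nzy.
exists h, (h + g), (g + (h + g)), erefl, erefl, (cls _ h y).
have hy : Fin h <= beta y by rewrite yh.
have hyx : Fin (h + g) <= beta (y * x) by rewrite FinD; apply: (surmM surA).
rewrite (cls_mul (beta := gauge_filtration beta) erefl hy gx).
rewrite (cls_mul (beta := gauge_filtration beta) erefl gx hyx).
by rewrite cls_eq0 /= mulrA yE xg yh -!FinD addrA ?ltxx.
Qed.

(** e is a left identity of the degree-zero part of I. If y = u - e u != 0, then e y = 0, yet y has
    a nonzero idempotent multiple of degree 0 in I, which e fixes. If y = u - u e != 0, then y e =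
    0, yet y t y = y e t y != 0 for some t. Hence e u = e u e = u e. *)
Lemma ideal_identity (I : forall g, S g -> Prop) : homogeneous_ideal I ->
  exists e : S 0, [/\ @I 0 e, gmul S (addr0 0) e e = e,
    forall g (u : S g), @I g u -> gmul S (add0r g) e u = u
  & forall g (u : S g), gmul S (add0r g) e u = gmul S (addr0 g) u e].
Proof.
move=> hI; have bN : bounded_idempotents (deg0 S) _ := @deg0_bounded _ _ _ _ _ valA surA.
have IB g x y : @I g x -> @I g y -> @I g (x - y) by apply: hidealB.
have I0 g : @I g 0 by apply: hideal0.
have IN g x : @I g x -> @I g (- x) by move=> Ix; rewrite -sub0r; apply: IB.
have ID g x y : @I g x -> @I g y -> @I g (x + y).
  by move=> Ix Iy; rewrite -[y]opprK; apply/IB/IN.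
have IMr g h k (e : g + h = k) x y : @I g x -> I _ (gmul S e x y) by apply: hidealMr.
have IMl g h k (e : g + h = k) x y : @I h y -> I _ (gmul S e x y) by apply: hidealMl.
have [e [Ie ee el]] : exists e : deg0 S,
    [/\ @I 0 e, e * e = e & forall x : deg0 S, @I 0 x -> e * x = x].
  apply: (left_identity (J := fun x : deg0 S => @I 0 x) bN) => //.
  - by move=> x y; apply: ID.
  - by move=> x y; apply: IMr.
  - move=> x Ix nzx; have [q [nzf ff]] := deg0_idempotent sp (addr0 0) (nzx : (x : gr _ 0) != 0).
    by exists q.
have gmulBr g h k (p : g + h = k) (x : S g) (y z : S h) :
    gmul S p x (y - z) = gmul S p x y - gmul S p x z.
  by apply: (addIr (gmul S p x z)); rewrite -gmulDr !subrK.
have gmulBl g h k (p : g + h = k) (x y : S g) (z : S h) :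
    gmul S p (x - y) z = gmul S p x z - gmul S p y z.
  by apply: (addIr (gmul S p y z)); rewrite -gmulDl !subrK.
have eL g (u : S g) : @I g u -> gmul S (add0r g) e u = u.
  move=> Iu; apply/eqP; rewrite eq_sym -subr_eq0; apply: contraT => nz.
  set y := u - _ in nz.
  have Iy : I _ y by apply/IB/IMr.
  have ey : gmul S (add0r g) e y = 0.
    rewrite /y gmulBr -(gmulA (addr0 0) (add0r g)) [gmul S (addr0 0) e e]ee subrr //.
  have [q [nzf ff]] := deg0_idempotent sp (addrN g) nz; set f := gmul _ _ _ _ in nzf ff.
  suff f0 : f = 0 by rewrite f0 eqxx in nzf.
  rewrite -[f](el f (IMr _ _ _ _ _ _ Iy)).
  change (gmul S (addr0 0) e (gmul S (addrN g) y q) = 0).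
  by rewrite -(gmulA (add0r g) (addrN g)) ey gmul0l.
exists e; split=> //.
have eR g (u : S g) : @I g u -> gmul S (addr0 g) u e = u.
  move=> Iu; apply/eqP; rewrite eq_sym -subr_eq0; apply: contraT => nz.
  set y := u - _ in nz.
  have Iy : I _ y by apply/IB/IMr.
  have ye : gmul S (addr0 g) y e = 0.
    by rewrite /y gmulBl (gmulA (addr0 g) (addr0 g) (addr0 0) (addr0 g)) [gmul S (addr0 0) e e]ee subrr.
  have [h [k [l [e1 [e2 [t]]]]]] := gr_semiprimeP nz.
  rewrite -(eL _ (gmul S e1 t y)); last exact: IMl.
  by rewrite -(gmulA (addr0 g) e2) ye gmul0l eqxx.
move=> g u; rewrite -[LHS]eR; last exact: IMr.
rewrite -[RHS]eL; last exact: IMl.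
exact: gmulA.
Qed.

End IdentityOfIdeal.

Section GradedSimple.
Variables (G : divOrderedGroupType) (F : fieldType) (A : falgType F).
Variables (hA : simple_algebra A).
Local Notation K := (center hA).
Local Notation AK := (over_center hA).
Variables (w : valuation G K) (beta : gauge w AK).
Local Notation fil := (gauge_filtration beta).
Local Notation S := (gr fil).
Let valA := (gauge_norm beta).1.
Let surA := gauge_surm beta.
Let sa : scaled w beta := (value_function_scaled w beta).1 valA.
Let ua : ultra beta := sa.1.

(* z is congruent to an idempotent e of gr_0; if e is neither 0 nor 1, the
   operator a |-> z a (1 - z) does not increase all values. *)
Lemma increasing_corner (z : AK) : Fin 0 <= beta z ->
  (forall k, beta (z ^+ k) = 0) -> (forall k, beta ((1 - z) ^+ k) = 0) ->
  (forall x : AK, x != 0 -> beta x < beta (z * x * (1 - z))) -> False.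
Proof.
move=> z0 zX tX inc; pose t := 1 - z.
have [s [ts sf]] := norm_tower (gauge_norm beta).
have fs := tower_free sa (U := fun x : AK => x = 0) erefl ts.
have s0 := tower_notin0 sa (U := fun x : AK => x = 0) erefl ts.
have spos : (0 < size s)%N.
  case: (s) sf => // sf; have : (1 : AK) \in <<[::]>>%VS by rewrite sf memvf.
  by rewrite span_nil memv0 oner_eq0.
pose T : 'End(AK) := (amulr t \o amull z)%VF.
have T1 y : (T : {linear AK -> AK}) y = z * y * t.
  by rewrite /= comp_lfunE lfunE /= lfunE.
have TE k y : iter k (T : {linear AK -> AK}) y = z ^+ k * y * t ^+ k.
  elim: k => [|k IH]; first by rewrite !expr0 mul1r mulr1.
  by rewrite iterS IH T1 exprS exprSr !mulrA.
have [||c [cN c_gt c_rel]] := increasing_char_poly sa (T := T) (subsp0 AK) _ ts spos.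
- by move=> u ->; rewrite linear0.
- move=> y sy; exists 0; split=> //; first by rewrite subr0 sf memvf.
  exists 0; split=> //; rewrite addr0 T1; apply: inc.
  by apply: contraNneq s0 => <-.
set N := size s in cN c_gt c_rel.
have coordP (k : 'I_N.+1) : exists Y : nat -> K, t ^+ k = \sum_(l < N) Y l *: s`_l.
  by apply: span_coord; rewrite sf memvf.
(* Expanding each t^k in the base s brings the relation sum_k c_k z^k x t^k = 0 into the form of
   [tensor_faithful], with coefficients Z_l. *)
have [Y YE] := fin_all_exists coordP.
pose Z l : A := \sum_(k < N.+1) (c k * Y k l) *: (z ^+ k : AK).
have rel0 (x : AK) : \sum_(k < N.+1) c k *: (z ^+ k * x * t ^+ k) = 0.
  have : x \in <<s>>%VS by rewrite sf memvf.
  apply: (@subsp_span _ _ (fun x => \sum_(k < N.+1) c k *: (z ^+ k * x * t ^+ k) = 0)).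
    split=> [|b x1 x2 h1 h2].
      by rewrite big1 // => k _; rewrite mulr0 mul0r scaler0.
    under eq_bigr do rewrite mulrDr mulrDl scalerDr -scalerAr -scalerAl scalerA mulrC -scalerA.
    by rewrite big_split /= -scaler_sumr h1 h2 scaler0 addr0.
  move=> {}x sx; have := c_rel x sx; under eq_bigr do rewrite TE.
  exact.
have rel (x : A) : \sum_(l < N) Z l * x * (s`_l : A) = 0.
  have -> : \sum_(l < N) Z l * x * (s`_l : A) =
      \sum_(l < N) \sum_(k < N.+1) (c k * Y k l) *: (z ^+ k * (x : AK) * s`_l).
    apply: eq_bigr => l _.
    have e (b : K) (y : AK) : (b *: y : A) * x * (s`_l : A) = b *: (y * (x : AK) * s`_l).
      by rewrite !scalerAl.
    by rewrite /Z !mulr_suml; apply: eq_bigr => k _; rewrite e.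
  rewrite exchange_big /= -[RHS](rel0 x); apply: eq_bigr => k _.
  rewrite YE mulr_sumr scaler_sumr; apply: eq_bigr => l _.
  by rewrite -scalerAr scalerA.
have Z0 := tensor_faithful fs rel.
have ge_Y k l : (l < N)%N -> Fin 0 <= beta s`_l + w (Y k l).
  move=> ltl; have := tower_coord sa (Y k) (subsp0 AK) ts erefl ltl.
  by rewrite add0r -YE tX.
(* As t^N has value 0, some coordinate l reaches it. In Z_l the term k = N then has value - p, and
   the others have more because w (c_k) > 0; so Z_l != 0. *)
have [l [ltl le_l]] : exists l, (l < N)%N /\ beta s`_l + w (Y ord_max l) <= Fin 0.
  apply: NNPP => nex; have : Fin 0 < beta (t ^+ N); last by rewrite tX ltxx.
  rewrite -[N]/(val (@ord_max N)) YE; apply: (ultra_lt_sum ua) => [|l _]; first exact: ext_lt_oo.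
  by rewrite sa.2 ltNge; apply/negP => le; apply: nex; exists l.
have [p slp] : exists p, beta s`_l = Fin p.
  by apply: (surm_neq_oo sa); apply: contraNneq s0 => <-; apply: mem_nth.
have Yp : w (Y ord_max l) = Fin (- p).
  have : beta s`_l + w (Y ord_max l) = 0 by apply/le_anti; rewrite le_l ge_Y.
  by rewrite slp => e; rewrite -[LHS](FinNK p) e addr0.
have Zl := Z0 _ ltl.
have : Fin (- p) < beta (Y ord_max l *: (z ^+ N : AK)).
  move: Zl; rewrite /Z big_ord_recr /= cN mul1r => /eqP; rewrite addrC addr_eq0 => /eqP->.
  rewrite (ultraN ua); apply: (ultra_lt_sum ua) => [|k _]; first exact: ext_lt_oo.
  rewrite sa.2 zX add0r valuationM -[- p]add0r FinD.
  apply: ext_lt_leD => //; first exact: c_gt.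
  have := ge_Y (widen_ord (leqnSn N) k) _ ltl.
  by rewrite slp -(Fin_leD2l (- p)) FinNK addr0.
by rewrite sa.2 zX add0r Yp ltxx.
Qed.

Lemma gauge_graded_simple : graded_simple S.
Proof.
split; first by rewrite -cls1 cls_eq0 filtration1 ?ltxx.
move=> I hI; have [e [Ie ee eL eC]] := ideal_identity hI.
have [e0|nze] := eqVneq e 0.
  by left=> g u /eL <-; rewrite e0 gmul0l.
have [e1|ne1] := eqVneq e (gone S).
  by right=> g u; rewrite -(gmul1l (add0r g) u) -e1; apply: hidealMr.
exfalso; have [z z0 zE] := cls_ex e.
have fil1 : Fin 0 <= fil 1 by rewrite filtration1.
have t0 : Fin 0 <= beta (1 - z) by apply: (ultra_leB ua).
have M0 x y : Fin 0 <= beta x -> Fin 0 <= beta y -> Fin 0 <= beta (x * y).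
  by move=> x0 y0; have := surmM surA x0 y0; rewrite -FinD addr0.
have tE : cls fil 0 (1 - z) = gone S - e by rewrite clsB // cls1 -zE.
have idemX (x : AK) (f : deg0 S) : Fin 0 <= beta x -> cls fil 0 x = f -> f * f = f -> f != 0 ->
    forall k, beta (x ^+ k) = 0.
  move=> x0 xf ff nzf [|k]; first by rewrite expr0 (surm1 surA).
  have [xk0 xkE] : Fin 0 <= beta (x ^+ k.+1) /\ cls fil 0 (x ^+ k.+1) = f.
    elim: k => [|k [xk0 IH]]; first by rewrite expr1.
    by rewrite exprS; split; [apply: M0 | rewrite -(cls_deg0_mul (beta := fil) x0 xk0) IH xf].
  apply/le_anti; rewrite xk0 leNgt -(cls_eq0 (beta := fil)) // xkE.
  by rewrite nzf.
pose ed : deg0 S := e.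
have tt : (1 - ed) * (1 - ed) = 1 - ed.
  by rewrite mulrBl mul1r mulrBr mulr1 [ed * ed]ee subrr subr0.
apply: (increasing_corner z0).
- by apply: (idemX z ed).
- apply: (idemX (1 - z) (1 - ed)) => //.
  by rewrite subr_eq0 eq_sym.
(* With u the class of x, that of z x (1 - z) is e u (1 - e), which vanishes because e is
   central. *)
move=> x nzx; have [g xg] := surm_neq_oo sa nzx.
have gx : Fin g <= beta x by rewrite xg.
have gzx : Fin g <= beta (z * x) by rewrite -[g]add0r FinD; apply: (surmM surA).
have gzxt : Fin g <= beta (z * x * (1 - z)).
  by rewrite -[g]addr0 FinD; apply: (surmM surA).
rewrite xg -(cls_eq0 (beta := fil)) // mulrBr mulr1 clsB //; last first.
  by rewrite -[g]addr0 FinD; apply: (surmM surA).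
rewrite -(cls_mul (beta := fil) (add0r g) z0 gx) -zE.
rewrite -(cls_mul (beta := fil) (addr0 g) gzx z0) -(cls_mul (beta := fil) (add0r g) z0 gx) -zE.
rewrite -eC -(gmulA (addr0 0) (add0r g) (add0r g) (add0r g)).
by rewrite [gmul _ (addr0 0) e e]ee subrr.
Qed.

End GradedSimple.

(** * Graded ranks *)

Lemma gr_map_cls (G : divOrderedGroupType) (B C : nzRingType)
    (beta : filtration G B) (gamma : filtration G C) (f : {rmorphism B -> C})
    (le_f : forall x, beta x <= gamma (f x)) g x : Fin g <= beta x ->
  gr_map_fun le_f (cls beta g x) = cls gamma g (f x).
Proof.
move=> gx; rewrite !clsE; first exact: le_trans gx (le_f x).
move=> fgx; apply: etrans (gr_map_class _ _) _; congr gr_class; exact: val_inj.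
Qed.

Section GradedRank.
Variables (G : divOrderedGroupType) (F : fieldType) (v : valuation G F).
Variables (B : nzRingType) (fil : filtration G B).
Variables (phi : F -> B) (f : gradedMorphism (gr_valuation v) (gr fil)).
Hypotheses (phiB : forall c c', phi (c - c') = phi c - phi c').
Hypothesis phi_ge : forall c, v c <= fil (phi c).
Hypothesis f_cls : forall g c, Fin g <= v c ->
  f g (cls (valuation_filtration v) g c) = cls fil g (phi c).
Variables (T : finType) (d : T -> G) (b : T -> B).
Hypothesis b_val : forall t, fil (b t) = Fin (d t).
Hypothesis b_free : forall (c : T -> F) t,
  fil (\sum_t b t * phi (c t)) <= Fin (d t) + v (c t).
Hypothesis b_dense : forall x g, fil x = Fin g -> exists c : T -> F,
  Fin g < fil (x - \sum_t b t * phi (c t)).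

Let fil_ge_sum (I : finType) (x : I -> B) g : (forall i, Fin g <= fil (x i)) ->
  Fin g <= fil (\sum_i x i).
Proof.
move=> gx; elim/big_ind: _ => //; first by rewrite filtration0 le_oo.
by move=> y z gy gz; apply: le_trans (filtrationD _ _ _); rewrite le_min gy.
Qed.

Let term_ge (c : T -> F) t g : Fin g <= Fin (d t) + v (c t) -> Fin g <= fil (b t * phi (c t)).
Proof.
move=> le; apply: le_trans le _; rewrite -b_val; apply: le_trans (filtrationM _ _ _).
exact: ext_leD.
Qed.

Let shift g t x : (Fin (g - d t) <= x) = (Fin g <= Fin (d t) + x).
Proof. by rewrite -(Fin_leD2l (d t)) -FinD subrKC. Qed.

Let combine g (c : forall t, gr_valuation v (g - d t)) (c' : T -> F) :
  (forall t, Fin (g - d t) <= v (c' t)) ->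
  (forall t, c t = cls (valuation_filtration v) (g - d t) (c' t)) ->
  \sum_t gmul (gr fil) (subrKC (d t) g) (cls fil (d t) (b t)) (f (g - d t) (c t)) =
    cls fil g (\sum_t b t * phi (c' t)).
Proof.
move=> c'_ge cE; rewrite cls_sum => [|t]; last by apply: term_ge; rewrite -shift.
apply: eq_bigr => t _; rewrite cE f_cls // cls_mul ?b_val //.
exact: le_trans (c'_ge t) (phi_ge _).
Qed.

(** [b_dense] gives existence of the coefficients and [b_free] their uniqueness. Density up to
    higher values takes the place of generation, since the rank of gr_w(K) may be less than
    [K : F]. *)
Lemma graded_rank_of_base : has_graded_rank f #|T|.
Proof.
exists (fun j => d (enum_val j)), (fun j => cls fil (d (enum_val j)) (b (enum_val j))).
move=> g u; have [x gx ->] := cls_ex u.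
have [c [c_ge c_lt]] : exists c : T -> F, (forall t, Fin g <= Fin (d t) + v (c t)) /\
    Fin g < fil (x - \sum_t b t * phi (c t)).
  have [lt|nlt] := boolP (Fin g < fil x).
    have phi0 : phi 0 = 0 by rewrite -(subrr 0) phiB subrr.
    exists (fun=> 0); split=> [t|]; first by rewrite (ultra0 (valuation_ultra v)) addoo le_oo.
    by rewrite big1 ?subr0 // => t _; rewrite phi0 mulr0.
  have xg : fil x = Fin g by apply/le_anti; rewrite gx leNgt nlt.
  have [c lt] := b_dense xg; exists c; split=> // t.
  apply: le_trans (b_free c t); rewrite -[\sum_t _](subKr x).
  apply: le_trans (filtrationD _ _ _); rewrite filtrationN le_min gx.
  exact: ltW.
pose sumT (c : forall t, gr_valuation v (g - d t)) :=
  \sum_t gmul (gr fil) (subrKC (d t) g) (cls fil (d t) (b t)) (f (g - d t) (c t)).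
have sumE (e : {dffun forall j : 'I_#|T|, gr_valuation v (g - d (enum_val j))})
    (c' : forall t, gr_valuation v (g - d t)) : (forall j, e j = c' (enum_val j)) ->
  \sum_j gmul (gr fil) (subrKC (d (enum_val j)) g) (cls fil (d (enum_val j)) (b (enum_val j)))
    (f (g - d (enum_val j)) (e j)) = sumT c'.
  move=> ec; rewrite /sumT (reindex (@enum_val T T)) /=; last first.
    by apply: onW_bij; apply: enum_val_bij.
  by apply: eq_bigr => j _; rewrite ec.
pose c0 t := cls (valuation_filtration v) (g - d t) (c t).
have c_ge' t : Fin (g - d t) <= v (c t) by rewrite shift.
have sum_ge (c' : T -> F) : (forall t, Fin (g - d t) <= v (c' t)) ->
    Fin g <= fil (\sum_t b t * phi (c' t)).
  by move=> ge; apply: fil_ge_sum => t; apply: term_ge; rewrite -shift.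
exists [ffun j => c0 (enum_val j)]; split.
  rewrite (sumE _ c0) => [|j]; last by rewrite ffunE.
  rewrite /sumT (combine c_ge') //; apply/eqP; rewrite cls_eq //.
  exact: sum_ge.
move=> e; have ex_e j : exists k : F, Fin (g - d (enum_val j)) <= v k /\
    e j = cls (valuation_filtration v) (g - d (enum_val j)) k.
  by have [k k_ge kE] := cls_ex (e j : gr (valuation_filtration v) _); exists k.
have [k /all_and2[k_ge kE]] := fin_all_exists ex_e.
pose c1 t := k (enum_rank t).
have c1E j : c1 (enum_val j) = k j by rewrite /c1 enum_valK.
have c1_ge t : Fin (g - d t) <= v (c1 t).
  by have := k_ge (enum_rank t); rewrite enum_rankK.
rewrite (sumE e (fun t => cls (valuation_filtration v) (g - d t) (c1 t))) => [|j]; last first.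
  by rewrite c1E.
rewrite /sumT (combine c1_ge) // => /eqP; rewrite cls_eq //; last exact: sum_ge.
move=> lt1; apply/ffunP => j; rewrite ffunE kE -c1E /c0; apply/eqP.
set t := enum_val j; rewrite (cls_eq (beta := valuation_filtration v) (c_ge' t) (c1_ge t)) /=.
rewrite -(Fin_ltD2l (d t)) -FinD subrKC.
apply: lt_le_trans (b_free (fun t => c t - c1 t) t).
under eq_bigr do rewrite phiB mulrBr.
rewrite sumrB; set X := \sum_t _; set Y := \sum_t _.
have -> : X - Y = (x - Y) - (x - X) by rewrite opprB [RHS]addrC subrKA.
by apply: lt_le_trans (filtrationD _ _ _); rewrite lt_min filtrationN c_lt lt1.
Qed.

End GradedRank.

Lemma tower_val (G : divOrderedGroupType) (F : fieldType) (v : valuation G F)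
    (V : falgType F) (a : V -> ext G) (sa : scaled v a)
    (s : seq V) (j : 'I_(size s)) :
  tower a (fun x => x = 0) s -> exists g, a s`_j = Fin g.
Proof.
move=> ts; apply: (surm_neq_oo sa).
have fs := tower_free sa (U := fun x : V => x = 0) erefl ts.
exact: (free_not0 fs (mem_nth 0 (ltn_ord j))).
Qed.

Section ExtensionRank.
Variables (G : divOrderedGroupType) (F : fieldType) (K : fieldExtType F).
Variables (v : valuation G F) (w : valuation G K) (ext_vw : extends v w).

Let sw : scaled v (w : K -> ext G).
Proof.
split; first exact: valuation_ultra.
by move=> c x; rewrite -mulr_algl valuationM ext_vw addrC.
Qed.

(** A longest tower, which may fail to span K: an x whose leading class it did not reach would
    prolong it. *)
Lemma dense_tower : exists2 s : seq K, tower w (fun x => x = 0) s &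
  forall x g, w x = Fin g -> exists c : nat -> F,
    Fin g < w (x - \sum_(j < size s) c j *: s`_j).
Proof.
pose P n := exists s : seq K, size s = n /\ tower w (fun x => x = 0) s.
have [||n [[s [sz ts]] max]] := @ex_max P 0%N (\dim {: K}).
- by exists [::].
- by move=> n [s [<- ts]]; apply: (tower_size sw _ ts).
exists s => // x g xg; apply: NNPP => no.
suff : P n.+1 by move/max; rewrite ltnn.
exists (x :: s); split; first by rewrite /= sz.
split=> //; first by apply/eqP => x0; rewrite x0 (ultra0 sw.1) in xg.
move=> u t -> /span_coord[c ->]; rewrite add0r leNgt; apply/negP => lt.
apply: no; exists (fun j => - c j); rewrite -xg; congr (_ < w _): lt.
by rewrite addrC -sumrN; congr (_ + _); apply: eq_bigr => j _; rewrite scaleNr opprK.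
Qed.

Lemma extension_graded_rank : exists2 s : seq K, tower w (fun x => x = 0) s /\
    (forall x g, Fin g <= w x -> exists c : 'I_(size s) -> F,
      Fin g < w (x - \sum_j c j *: s`_j))
  & has_graded_rank (gr_extension ext_vw) (size s).
Proof.
have [s ts dense] := dense_tower; exists s.
  split=> // x g; rewrite le_eqVlt => /orP[/eqP/esym xg|lt].
    by have [c lt] := dense x g xg; exists (fun j : 'I_(size s) => c j).
  by exists (fun=> 0); rewrite big1 ?subr0 // => j _; rewrite scale0r.
have /fin_all_exists[d dE] : forall j : 'I_(size s), exists g, w s`_j = Fin g.
  by move=> j; apply: (tower_val sw).
have sumE (c : 'I_(size s) -> F) : \sum_(j < size s) s`_j * in_alg K (c j) = \sum_j c j *: s`_j.
  by apply: eq_bigr => j _; rewrite mulrC mulr_algl.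
rewrite -[size s]card_ord.
apply: (@graded_rank_of_base _ _ v K (valuation_filtration w) (in_alg K) _ _ _ _ _ d
  (fun j : 'I_(size s) => s`_j)) => //.
- by move=> c c'; rewrite rmorphB.
- by move=> c; rewrite /= ext_vw.
- move=> g c gc; apply: gr_map_cls; exact: gc.
- move=> c t; rewrite sumE -dE.
  pose c' k := if insub k is Some j then c j else 0.
  have c'E (j : 'I_(size s)) : c' j = c j by rewrite /c' valK.
  have := tower_coord sw c' (subsp0 _) ts erefl (ltn_ord t).
  by rewrite add0r c'E; under eq_bigr do rewrite c'E.
- by move=> x g xg; have [c lt] := dense x g xg; exists (fun j : 'I_(size s) => c j); rewrite sumE.
Qed.

Lemma gauge_graded_rank (V : falgType K) (beta : gauge w V) : exists m : nat,
  has_graded_rank (gr_extension ext_vw) m /\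
  has_graded_rank (gstruct (grestrict (gr_extension ext_vw) (gr_gauge beta)))
    (\dim {: V} * m).
Proof.
have [s [ts dense] rk] := extension_graded_rank; exists (size s); split=> //.
have [q [tq qf]] := norm_tower (gauge_norm beta).
have sb : scaled w beta := (value_function_scaled w beta).1 (gauge_norm beta).1.
have fq := tower_free sb (U := fun x : V => x = 0) erefl tq.
have sz : size q = \dim {: V} by rewrite -qf; move/eqP: fq => ->.
have /fin_all_exists[d dE] : forall j : 'I_(size s), exists g, w s`_j = Fin g.
  by move=> j; apply: (tower_val sw).
have /fin_all_exists[h hE] : forall l : 'I_(size q), exists g, beta q`_l = Fin g.
  by move=> l; apply: (tower_val sb).
have coord_le (y : 'I_(size q) -> K) l : beta (\sum_l y l *: q`_l) <= Fin (h l) + w (y l).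
  rewrite -hE; pose y' k := if insub k is Some j then y j else 0.
  have y'E (j : 'I_(size q)) : y' j = y j by rewrite /y' valK.
  have := tower_coord sb y' (subsp0 _) tq erefl (ltn_ord l).
  by rewrite add0r y'E; under eq_bigr do rewrite y'E.
have coord_le_s (c : 'I_(size s) -> F) t : w (\sum_j c j *: s`_j) <= Fin (d t) + v (c t).
  rewrite -dE; pose c' k := if insub k is Some j then c j else 0.
  have c'E (j : 'I_(size s)) : c' j = c j by rewrite /c' valK.
  have := tower_coord sw c' (subsp0 _) ts erefl (ltn_ord t).
  by rewrite add0r c'E; under eq_bigr do rewrite c'E.
pose T := ('I_(size q) * 'I_(size s))%type.
have -> : (\dim {: V} * size s)%N = #|{: T}| by rewrite card_prod !card_ord sz.
pose phi c : V := in_alg V (in_alg K c).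
have sumE (c : T -> F) : \sum_(t : T) (s`_t.2 *: q`_t.1) * phi (c t) =
    \sum_l (\sum_j c (l, j) *: s`_j) *: q`_l.
  transitivity (\sum_(l < size q) \sum_(j < size s) (s`_j *: q`_l) * phi (c (l, j))).
    by rewrite pair_bigA /=; apply: eq_bigr => -[l j].
  apply: eq_bigr => l _; rewrite scaler_suml; apply: eq_bigr => j _.
  by rewrite /phi /= mulr_algr scalerA mulr_algl.
apply: (@graded_rank_of_base _ _ v V (gauge_filtration beta) phi _ _ _ _ _
  (fun t : T => h t.1 + d t.2) (fun t : T => s`_t.2 *: q`_t.1)).
- by move=> c c'; rewrite /phi !rmorphB.
- move=> c; apply: le_trans (gauge_in_alg beta (in_alg K c)).
  by rewrite /= ext_vw.
- move=> g c gc.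
  transitivity (gstruct (gr_gauge beta) g (cls (valuation_filtration w) g (in_alg K c))).
    by congr (gstruct (gr_gauge beta) g _); apply: gr_map_cls; exact: gc.
  by apply: gr_map_cls; rewrite /= ext_vw.
- by move=> [l j] /=; rewrite (sb.2) hE dE.
- move=> c [l j]; rewrite sumE /= FinD -addrA.
  apply: le_trans (coord_le _ l) _; apply: ext_leD => //; exact: coord_le_s.
- move=> x g xg; have /span_coord[y xE] : x \in <<q>>%VS by rewrite qf memvf.
  have /fin_all_exists[c c_lt] : forall l : 'I_(size q), exists c : 'I_(size s) -> F,
      Fin (g - h l) < w (y l - \sum_j c j *: s`_j).
    move=> l; apply: dense; rewrite -(Fin_leD2l (h l)) -FinD subrKC.
    by rewrite -xg xE; apply: (coord_le (fun l => y l)).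
  exists (fun t => c t.1 t.2); rewrite sumE /= xE -sumrB.
  under eq_bigr do rewrite -scalerBl.
  apply: (ultra_lt_sum sb.1) => // l _; rewrite (sb.2) hE -[g](subrKC (h l)) FinD.
  by rewrite Fin_ltD2l.
Qed.

End ExtensionRank.

(** * The degree-zero part *)

Section Semisimple.
Variables (R : pzRingType) (N : nat).
Hypotheses (nz1 : (1 : R) != 0) (bN : bounded_idempotents R N).
Hypothesis idem : forall x : R, x != 0 -> exists q, x * q != 0 /\ (x * q) * (x * q) = x * q.

(** A nonzero ideal contains a nonzero idempotent, so it is not nilpotent. *)
Lemma idempotent_semisimple : semisimple_ring R.
Proof.
move=> I [I0 IB IMl IMr] [n nilI] x Ix; apply/eqP; apply: contraT => /idem[q []].
set f := x * q => nzf ff; have If : I f by apply: IMr.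
have fX k : f ^+ k * f = f by elim: k => [|k IH]; rewrite ?mul1r // exprS -mulrA IH.
have := nilI (fun=> f) (fun=> If); rewrite prodr_const card_ord => fn0.
by move: nzf; rewrite -(fX n) fn0 mul0r eqxx.
Qed.

Lemma ring_ideal_identity (J : R -> Prop) : J 0 ->
  (forall x y, J x -> J y -> J (x - y)) -> (forall x y, J x -> J (x * y)) ->
  (forall x y, J x -> J (y * x)) ->
  exists e, [/\ J e, e * e = e, central e & forall x, J x -> e * x = x].
Proof.
move=> J0 JB JMr JMl; have JD x y : J x -> J y -> J (x + y).
  by move=> Jx Jy; rewrite -[y]opprK; apply: (JB) => //; rewrite -sub0r; apply: JB.
have [e [Je ee eJ]] := left_identity bN J0 JD JMr (fun x _ => @idem x).
have xe x : J x -> x * e = x.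
  move=> Jx; apply/eqP; rewrite eq_sym -subr_eq0; apply: contraT => /idem[q [nzf ff]].
  set y := x - x * e in nzf ff.
  have Jyq : J (q * y) by apply/JMl/JB => //; apply: JMr.
  have ye : y * e = 0 by rewrite mulrBl -mulrA ee subrr.
  by case/eqP: nzf; rewrite -ff mulrA -[y * q * y]mulrA -(eJ _ Jyq) !mulrA ye !mul0r.
exists e; split=> // x; rewrite -(eJ (x * e)); last exact: JMl.
by rewrite mulrA xe //; apply: JMr.
Qed.

(** An ideal of R e_j is an ideal of R, hence generated by a central idempotent f = f e_j, which
    primitivity forces to be 0 or e_j. *)
Lemma primitive_simple_components n (e : 'I_n -> R) :
  orthogonal_idempotents e -> (forall i, central (e i)) -> \sum_i e i = 1 ->
  (forall f, central f -> f * f = f -> forall i, f * e i = 0 \/ f * e i = e i) ->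
  simple_components (fun j x => e j * x = x).
Proof.
move=> [nze ee] ce e1 prim; split=> [j|x].
  split.
    split=> [|x y xj yj|x y yj|x y xj]; first by rewrite mulr0.
    - by rewrite mulrBr xj yj.
    - by rewrite mulrA ce -mulrA yj.
    - by rewrite mulrA xj.
  split; first by exists (e j); rewrite ?nze ?ee ?eqxx.
  move=> J JS J0 JB JM.
  have ejj : e j * e j = e j by rewrite ee eqxx.
  have JMr x y : J x -> J (x * y).
    move=> Jx; rewrite -(JS _ Jx) ce -mulrA; apply: (JM _ _ _ Jx).2.
    by rewrite mulrA ejj.
  have JMl x y : J x -> J (y * x).
    move=> Jx; rewrite -(JS _ Jx) mulrA; apply: (JM _ _ _ Jx).1.
    by rewrite -ce mulrA ejj.
  have [f [Jf ff cf fJ]] := ring_ideal_identity J0 JB JMr JMl.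
  have [|] := prim f cf ff j; rewrite cf (JS _ Jf) => fE.
    by left=> x Jx; rewrite -(fJ _ Jx) fE mul0r.
  by right=> x <-; rewrite -fE; apply: JMr.
exists [ffun j => e j * x]; split.
  split=> [j|]; first by rewrite ffunE mulrA ee eqxx.
  by under eq_bigr do rewrite ffunE; rewrite -mulr_suml e1 mul1r.
move=> y [yS ->]; apply/ffunP => j; rewrite ffunE mulr_sumr (bigD1 j) //= big1.
  by rewrite addr0 yS.
by move=> k ne; rewrite -yS mulrA ee eq_sym (negPf ne) mul0r.
Qed.

(** Each f i lies above some primitive idempotent, and orthogonal ones share none. *)
Lemma central_idempotents_components r (f : 'I_r -> R) :
  orthogonal_idempotents f -> (forall i, central (f i)) ->
  exists n (S : 'I_n -> R -> Prop), simple_components S /\ (r <= n)%N.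
Proof.
move=> [nzf ff] cf; have [n [e [oe ce e1 prim]]] := primitive_idempotents bN nz1.
have ffi i : f i * f i = f i by rewrite ff eqxx.
exists n, (fun j x => e j * x = x); split; first exact: primitive_simple_components.
have /fin_all_exists[t tE] : forall i, exists j, f i * e j = e j.
  move=> i; apply: NNPP => no; case/eqP: (nzf i).
  rewrite -[f i]mulr1 -e1 mulr_sumr big1 // => j _.
  by have [//|fe] := prim _ (cf i) (ffi i) j; case: no; exists j.
rewrite -[r]card_ord -[n]card_ord; apply: (leq_card t) => i j tij.
apply/eqP; apply: contraT => ne; case/eqP: (oe.1 (t i)).
by rewrite -tE tij -tE mulrA ff (negPf ne) mul0r.
Qed.

End Semisimple.

Section DegreeZeroGauge.
Variables (G : divOrderedGroupType) (F : fieldType) (v : valuation G F).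
Variables (A : falgType F) (alpha : gauge v A).
Local Notation fil := (gauge_filtration alpha).

Let sa : scaled v alpha := (value_function_scaled v alpha).1 (gauge_norm alpha).1.

(** A base element that can be scaled by F to value 0 contributes the class of its multiple; the
    terms of any other never have value exactly 0, so its b i is 0. *)
Lemma gauge_deg0_finite_dim : deg0_finite_dim (gr_gauge alpha).
Proof.
have [s [ts sf]] := norm_tower (gauge_norm alpha).
have /fin_all_exists[b bE] : forall i : 'I_(size s), exists b : deg0 (gr_gauge alpha),
    forall y, Fin 0 <= alpha (y *: s`_i) -> exists c : deg0 (gr_valuation v),
      cls fil 0 (y *: s`_i) = b * (gstruct (gr_gauge alpha) 0 c : deg0 (gr_gauge alpha)).
  move=> i; have [[c ci]|no] := classic (exists c, alpha (c *: s`_i) = Fin 0).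
    have nzc : c != 0.
      by apply/eqP => c0; move: ci; rewrite c0 scale0r (ultra0 sa.1).
    exists (cls fil 0 (c *: s`_i)) => y y0.
    have yc0 : Fin 0 <= v (y / c).
      by have := y0; rewrite -{1}[y](divfK nzc) -scalerA (sa.2) ci add0r.
    exists (cls (valuation_filtration v) 0 (y / c)).
    transitivity (gmul (gr fil) (addr0 0) (cls fil 0 (c *: s`_i)) (cls fil 0 (in_alg A (y / c)))).
      rewrite cls_mul /= ?ci //; first by rewrite mulr_algr scalerA divfK.
      by rewrite (sa.2) (gauge_surm alpha).1 add0r.
    by congr (gmul (gr fil) _ _ _); apply/esym/gr_map_cls.
  exists 0 => y y0; exists 0; rewrite mul0r cls_lt // lt_neqAle y0 andbT.
  by apply/eqP => ye; apply: no; exists y.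
exists (size s), b => x; have [y y0 ->] := cls_ex (x : gr fil 0).
have /span_coord[c cE] : y \in <<s>>%VS by rewrite sf memvf.
have c0 (i : 'I_(size s)) : Fin 0 <= alpha (c i *: s`_i).
  apply: le_trans y0 _; have := tower_coord sa c (subsp0 _) ts erefl (ltn_ord i).
  by rewrite add0r -cE (sa.2).
have /fin_all_exists[d dE] := fun i => bE i _ (c0 i).
by exists d; rewrite cE cls_sum //; apply: eq_bigr => i _; apply: dE.
Qed.

End DegreeZeroGauge.

(** * The graded isomorphism *)

Section GradedIsomorphism.
Variables (G : divOrderedGroupType) (F : fieldType) (v : valuation G F).
Variables (A : falgType F) (hA : simple_algebra A) (alpha : gauge v A).
Local Notation K := (center hA).
Local Notation AK := (over_center hA).
Variables (r : nat) (w : 'I_r -> valuation G K) (w_ext : forall i, extends v (w i)).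
Variable beta : forall i, gauge (w i) AK.
Local Notation gr_beta :=
  (fun i => grestrict (gr_extension (w_ext i)) (gr_gauge (beta i))).
Local Notation fil := (gauge_filtration alpha).
Local Notation fil_ i := (gauge_filtration (beta i)).

Hypothesis le_beta : forall i (u : A), alpha u <= beta i u.
Hypothesis beta_lt : forall (u : A) h, (forall i, Fin h < beta i u) -> Fin h < alpha u.
Hypothesis beta_approx : forall i (u : A) g, Fin g <= beta i u -> exists z : A,
  [/\ Fin g <= alpha z, Fin g < beta i (z - u) & forall j, j != i -> Fin g < beta j z].

Let proj i : gradedMorphism (gr fil) (gr (fil_ i)) :=
  gr_map (beta := fil) (gamma := fil_ i) (f := idfun) (le_beta i).

Definition leading_classes g (u : gr_gauge alpha g) : gprod gr_beta g :=
  finfun (fun i => proj i g u : gr_beta i g).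

Fact leading_classes_zmod g : zmod_morphism (@leading_classes g).
Proof. by move=> x y; apply/ffunP=> i; rewrite !ffunE raddfB. Qed.

HB.instance Definition _ g := GRing.isZmodMorphism.Build
  (gr_gauge alpha g) (gprod gr_beta g) (@leading_classes g) (@leading_classes_zmod g).

Fact leading_classes1 : leading_classes (gone (gr_gauge alpha)) = gone (gprod gr_beta).
Proof. by apply/ffunP=> i; rewrite !ffunE; apply: (gmorph1 (proj i)). Qed.

Fact leading_classesM g h k (e : g + h = k) x y :
  leading_classes (gmul (gr_gauge alpha) e x y) =
    gmul (gprod gr_beta) e (leading_classes x) (leading_classes y).
Proof. by apply/ffunP=> i; rewrite !ffunE; apply: (gmorphM (proj i)). Qed.

Definition leading_morphism : gradedMorphism (gr_gauge alpha) (gprod gr_beta) :=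
  @GradedMorphism _ (gr_gauge alpha) (gprod gr_beta) (fun g => @leading_classes g)
    leading_classes1 leading_classesM.

Lemma leading_classes_cls g (x : A) i : Fin g <= alpha x ->
  leading_classes (cls fil g x) i = cls (fil_ i) g x.
Proof. by move=> gx; rewrite ffunE; apply: gr_map_cls. Qed.

Lemma leading_classes_inj g : injective (@leading_classes g).
Proof.
move=> u t; have [x gx ->] := cls_ex (u : gr fil g); have [y gy ->] := cls_ex (t : gr fil g).
move=> e; apply/eqP; rewrite (cls_eq (beta := fil)) //; apply: beta_lt => i.
have /eqP := congr1 (fun f : gprod gr_beta g => f i) e.
by rewrite !leading_classes_cls // cls_eq //; apply: le_trans (le_beta i _).
Qed.

(** As in the Chinese remainder theorem: the z_i approximate the given components at i and vanish at
    the other indices, and their sum has all of these components. *)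
Lemma leading_classes_surj g (y : gprod gr_beta g) : exists u, leading_classes u = y.
Proof.
have /fin_all_exists[x /all_and2[x_ge yE]] : forall i, exists x : A,
    Fin g <= beta i x /\ y i = cls (fil_ i) g x.
  by move=> i; have [x gx e] := cls_ex (y i : gr (fil_ i) g); exists x.
have /fin_all_exists[z z_spec] := fun i => beta_approx (x_ge i).
exists (cls fil g (\sum_i z i)); apply/ffunP => i.
have z_ge j : Fin g <= alpha (z j) by case: (z_spec j).
have zb_ge j : Fin g <= beta i (z j) := le_trans (z_ge j) (le_beta i _).
have sum_ge : Fin g <= fil (\sum_i z i).
  elim/big_ind: _ => [|p q gp gq|j _]; [by rewrite filtration0 le_oo| |exact: z_ge].
  by apply: le_trans (filtrationD _ _ _); rewrite le_min gp.
apply: etrans (leading_classes_cls i sum_ge) _.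
have -> : cls (fil_ i) g (\sum_j z j) = \sum_j cls (fil_ i) g (z j) by apply: cls_sum.
rewrite (bigD1 i) //= big1 ?addr0 => [|j ne].
  rewrite yE; apply/eqP; rewrite (cls_eq (beta := fil_ i) (zb_ge i) (x_ge i)).
  by case: (z_spec i).
by apply: cls_lt; case: (z_spec j) => _ _; apply; rewrite eq_sym.
Qed.

Lemma leading_classes_bij g : bijective (@leading_classes g).
Proof.
have ex y : exists u, leading_classes (g := g) u == y.
  by have [u <-] := leading_classes_surj y; exists u.
exists (fun y => xchoose (ex y)) => [u|y].
  by apply: leading_classes_inj; apply/eqP/(xchooseP (ex _)).
exact/eqP/(xchooseP (ex y)).
Qed.

Lemma gauge_graded_isomorphic : galg_isomorphic (gr_gauge alpha) (gprod gr_beta).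
Proof.
exists leading_morphism; split=> [g|g c]; first exact: leading_classes_bij.
have [x gx ->] := cls_ex (c : gr (valuation_filtration v) g).
have ax : Fin g <= alpha (in_alg A x) := le_trans gx (gauge_in_alg alpha x).
have -> : gstruct (gr_gauge alpha) g (cls (valuation_filtration v) g x) =
    cls fil g (in_alg A x) by apply: gr_map_cls.
apply/ffunP => i; apply: etrans (leading_classes_cls i ax) _; rewrite [RHS]ffunE.
transitivity (gstruct (gr_gauge (beta i)) g
    (cls (valuation_filtration (w i)) g (in_alg K x))); last first.
  by congr (gstruct (gr_gauge (beta i)) g _); apply/esym/gr_map_cls; exact: gx.
transitivity (cls (fil_ i) g (in_alg AK (in_alg K x))).
  by congr cls; rewrite -[RHS]/(center_val (x *: 1 : K) * (1 : A)) mulr1 center_valZ rmorph1.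
by apply/esym/gr_map_cls; rewrite /= w_ext.
Qed.

End GradedIsomorphism.

Lemma gauge_deg0_idempotent (G : divOrderedGroupType) (F : fieldType) (v : valuation G F)
    (A : falgType F) (alpha : gauge v A) (x : deg0 (gr_gauge alpha)) :
  x != 0 -> exists q, x * q != 0 /\ (x * q) * (x * q) = x * q.
Proof.
exact: (deg0_idempotent (valA := (gauge_norm alpha).1) (surA := gauge_surm alpha)
  (gauge_semiprime alpha) (addr0 0)).
Qed.

Lemma gauge_deg0_components (G : divOrderedGroupType) (F : fieldType) (v : valuation G F)
    (A : falgType F) (hA : simple_algebra A) (alpha : gauge v A)
    r (eps : 'I_r -> center hA) : lifted_idempotents (center_fun (hA := hA) alpha) eps ->
  exists n (S : 'I_n -> deg0 (gr_gauge alpha) -> Prop), simple_components S /\ (r <= n)%N.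
Proof.
case=> eps0 epsI epsM _ _; pose fil := gauge_filtration alpha.
pose f i : deg0 (gr_gauge alpha) := cls fil 0 (center_val (eps i)).
have e0 i : Fin 0 <= fil (center_val (eps i)) by rewrite -[leRHS]/(center_fun alpha (eps i)) eps0.
have M0 x y : Fin 0 <= fil x -> Fin 0 <= fil y -> Fin 0 <= fil (x * y).
  by move=> x0 y0; apply: le_trans (filtrationM _ _ _); rewrite -(addr0 (0 : G)) FinD ext_leD.
have bN : bounded_idempotents (deg0 (gr_gauge alpha)) (\dim {: A}).
  exact: (@deg0_bounded _ _ _ _ _ (gauge_norm alpha).1 (gauge_surm alpha)).
apply: (@central_idempotents_components _ _ (deg0_nz1 fil) bN
  (@gauge_deg0_idempotent _ _ _ _ alpha) _ f); last first.
  move=> i y; have [z z0 ->] := cls_ex (y : gr fil 0).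
  by rewrite /f !(cls_deg0_mul (beta := fil)) // center_comm.
split=> [i|i j].
  rewrite cls_eq0 //; apply/negP => lt; have := eps0 i.
  by rewrite /center_fun => e; move: lt; rewrite /fil /= e ltxx.
rewrite /f (cls_deg0_mul (beta := fil)) // -rmorphM; case: eqVneq => [<-|ne].
  have ee0 : Fin 0 <= fil (center_val (eps i * eps i)) by rewrite rmorphM; apply: M0; apply: e0.
  by apply/eqP; rewrite (cls_eq (beta := fil) ee0 (e0 i)) -rmorphB; apply: epsI.
by apply: cls_lt; apply: epsM.
Qed.

Theorem theorem2p2 (G : divOrderedGroupType) (F : fieldType)
    (v : valuation G F) (A : falgType F) (hA : simple_algebra A)
    (r : nat) (w : 'I_r -> valuation G (center hA))
    (w_ext : forall i, extends v (w i))
    (w_inj : forall i j, w i =1 w j -> i = j)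
    (w_all : forall u : valuation G (center hA),
       extends v u -> exists i, u =1 w i)
    (alpha : gauge v A) :
  exists beta : forall i : 'I_r, gauge (w i) (over_center hA),
    let gr_beta i := grestrict (gr_extension (w_ext i)) (gr_gauge (beta i)) in
    [/\ forall a : A, alpha a = \big[Num.min/oo]_i beta i a,
        galg_isomorphic (gr_gauge alpha) (gprod gr_beta),
        deg0_finite_dim (gr_gauge alpha) /\
        semisimple_ring (deg0 (gr_gauge alpha)) /\
        (exists (n : nat) (S : 'I_n -> deg0 (gr_gauge alpha) -> Prop),
           simple_components S /\ (r <= n)%N),
        graded_simple_components (gr_gauge alpha) gr_beta
      & forall i : 'I_r, exists m : nat,
          has_graded_rank (gr_extension (w_ext i)) m /\
          has_graded_rank (gstruct (gr_beta i))
            (\dim {: over_center hA} * m)].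
Proof.
have [eps lift_eps w_unit] := center_valuations alpha w_ext w_inj w_all.
pose beta i : gauge (w i) (over_center hA) := local_gauge w_ext lift_eps w_unit i.
exists beta => gr_beta.
have iso : galg_isomorphic (gr_gauge alpha) (gprod gr_beta).
  apply: gauge_graded_isomorphic.
  - move=> i u; exact: (local_ge lift_eps).
  - exact: local_gauge_le.
  - exact: local_gauge_approx.
split=> //.
- exact: local_gauge_min.
- split; first exact: gauge_deg0_finite_dim.
  split; last exact: gauge_deg0_components lift_eps.
  exact: idempotent_semisimple (@gauge_deg0_idempotent _ _ _ _ alpha).
- split=> // i; exact: gauge_graded_simple (beta i).
- by move=> i; apply: gauge_graded_rank.
Qed.
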